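(* Let $\mathcal{X}$ be a Polish space and $\mathcal{H}\subseteq\{0,1\}^{\mathcal{X}}$ a measurable concept class with $|\mathcal{H}|\ge3$. Then: (i) if $\mathcal{H}$ does not have an infinite Littlestone tree, then $\mathcal{H}$ is learnable with optimal rate $e^{-n}$; (ii) if $\mathcal{H}$ has an infinite Littlestone tree but does not have an infinite VCL tree, then $\mathcal{H}$ is learnable with optimal rate $\frac1n$; (iii) if $\mathcal{H}$ has an infinite VCL tree, then $\mathcal{H}$ requires arbitrarily slow rates.
   Context: Measurability of $\mathcal{H}$: there exist a Polish space $\Theta$ and a Borel map $\mathsf{h}:\Theta\times\mathcal{X}\to\{0,1\}$ with $\mathcal{H}=\{\mathsf{h}(\theta,\cdot):\theta\in\Theta\}$. Classifiers are universally measurable $h:\mathcal{X}\to\{0,1\}$; $\mathrm{er}_P(h)=P\{(x,y):h(x)\ne y\}$ for a distribution $P$ on $\mathcal{X}\times\{0,1\}$; $P$ is realizable if $\inf_{h\in\mathcal{H}}\mathrm{er}_P(h)=0$. A learning algorithm is a sequence of universally measurable maps $H_n:(\mathcal{X}\times\{0,1\})^n\times\mathcal{X}\to\{0,1\}$ with output $\hat h_n(x)=H_n((X_1,Y_1),\ldots,(X_n,Y_n),x)$ on i.i.d. data from $P$. A rate function is $R:\mathbb{N}\to[0,1]$ with $R(n)\to0$. Learnable at rate $R$: some algorithm has, for every realizable $P$, constants $C,c>0$ with $\mathbf{E}[\mathrm{er}_P(\hat h_n)]\le CR(cn)$ for all $n$. Not learnable at rate faster than $R$: for every algorithm there are realizable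 $P$ and $C,c>0$ with $\mathbf{E}[\mathrm{er}_P(\hat h_n)]\ge CR(cn)$ for infinitely many $n$. Optimal rate $R$: both. Requires arbitrarily slow rates: not learnable faster than $R$ for every rate function $R$. Littlestone tree of depth $d\le\infty$: a collection $\{x_{\mathbf u}:0\le k<d,\ \mathbf u\in\{0,1\}^k\}\subseteq\mathcal{X}$ such that for every $\mathbf y\in\{0,1\}^d$ and every $n<d$ there is $h\in\mathcal{H}$ with $h(x_{\mathbf y_{\le k}})=y_{k+1}$ for $0\le k\le n$, where $\mathbf y_{\le k}=(y_1,\ldots,y_k)$. Infinite Littlestone tree: depth $d=\infty$. VCL tree of depth $d\le\infty$: a collection $\{x_{\mathbf u}\in\mathcal{X}^{k+1}:0\le k<d,\ \mathbf u\in\{0,1\}^1\times\{0,1\}^2\times\cdots\times\{0,1\}^k\}$ such that for every $n<d$ and every $\mathbf y\in\{0,1\}^1\times\cdots\times\{0,1\}^{n+1}$ there is $h\in\mathcal{H}$ with $h(x^i_{\mathbf y_{\le k}})=y^i_{k+1}$ for all $0\le i\le k$, $0\le k\le n$, where $\mathbf y_{\le k}=(y^0_1,(y^0_2,y^1_2),\ldots,(y^0_k,\ldots,y^{k-1}_k))$ and $x_{\mathbf y_{\le k}}=(x^0_{\mathbf y_{\le k}},\ldots,x^k_{\mathbf y_{\le k}})$. Infinite VCL tree: depth $d=\infty$. *)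

(* Defs.v *)
From HB Require Import structures.
From mathcomp Require Import all_boot all_order all_algebra.
From mathcomp Require Import all_classical all_reals all_analysis.
Set Implicit Arguments. Unset Strict Implicit. Unset Printing Implicit Defensive.
Import Order.TTheory GRing.Theory Num.Theory.
Import numFieldNormedType.Exports.
Local Open Scope classical_set_scope.
Local Open Scope ring_scope.

Definition polish (R : realType) (X : topologicalType) : Prop :=
  (exists D : set X, countable D /\ closure D = setT) /\
  exists d : X -> X -> R,
    [/\ (forall x y, d x y = 0 <-> x = y),
        (forall x y, d x y = d y x),
        (forall x y z, d x z <= d x y + d y z),
        (forall A : set X, open A <->
            (forall x, A x -> exists2 e : R, 0 < e & [set y | d x y < e] `<=` A)) &
        (forall u : nat -> X,
            (forall e : R, 0 < e -> exists N, forall m n, (N <= m)%N -> (N <= n)%N ->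
               d (u m) (u n) < e) ->
            exists x, forall e : R, 0 < e -> exists N, forall n, (N <= n)%N -> d (u n) x < e)].

Definition borel_set (T : topologicalType) (A : set T) : Prop := <<s @open T >> A.

Definition measurable_class (R : realType) (X : topologicalType) (H : set (X -> bool)) : Prop :=
  exists (Theta : topologicalType) (h : Theta -> X -> bool),
    [/\ polish R Theta,
        (forall b : bool, borel_set (T := (Theta * X)%type)
                            [set p | h p.1 p.2 = b]) &
        H = [set h th | th in [set: Theta]] ].

Definition BorelT (X : ptopologicalType) := g_sigma_algebraType (@open X).
Definition ZT (X : ptopologicalType) := (BorelT X * bool)%type.
Definition SampleT (X : ptopologicalType) (n : nat) := (n.-tuple (ZT X) * BorelT X)%type.

Definition univ_meas_set (R : realType) d (T : measurableType d) (A : set T) : Prop :=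
  forall P : probability T R, exists B1 B2 : set T,
    [/\ measurable B1, measurable B2, B1 `<=` A, A `<=` B2 & P (B2 `\` B1) = 0%E].

Definition univ_meas_fun (R : realType) d (T : measurableType d) (f : T -> bool) : Prop :=
  univ_meas_set R (f @^-1` [set true]).

(* er_P(h) = P{(x,y) : h x <> y}, written as the integral of the indicator
   (for universally measurable h this is the measure of the set under the
   completion of P). *)
Definition er (R : realType) (X : ptopologicalType) (P : probability (ZT X) R)
  (h : X -> bool) : \bar R :=
  (\int[P]_z (if h z.1 != z.2 then 1 else 0)%:E)%E.

Definition realizable (R : realType) (X : ptopologicalType) (H : set (X -> bool))
  (P : probability (ZT X) R) : Prop :=
  ereal_inf [set er P h | h in H] = 0%E.

Definition algorithm (X : ptopologicalType) := forall n : nat, n.-tuple (ZT X) -> X -> bool.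

Definition univ_meas_algorithm (R : realType) (X : ptopologicalType) (A : algorithm X) : Prop :=
  forall n, univ_meas_fun R (T := SampleT X n) (fun p => A n p.1 p.2).

(* Integration against the n-fold product P^n, as an iterated integral
   (first sample integrated outermost). *)
Fixpoint iid_int (R : realType) (X : ptopologicalType) (P : probability (ZT X) R) (n : nat)
  : (n.-tuple (ZT X) -> \bar R) -> \bar R :=
  match n return (n.-tuple (ZT X) -> \bar R) -> \bar R with
  | 0 => fun f => f [tuple]
  | n'.+1 => fun f => (\int[P]_z iid_int P (fun t : n'.-tuple (ZT X) => f (cons_tuple z t)))%E
  end.

Definition exp_err (R : realType) (X : ptopologicalType) (P : probability (ZT X) R)
  (A : algorithm X) (n : nat) : \bar R :=
  iid_int P (fun s : n.-tuple (ZT X) => er P (A n s)).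

Definition rate_function (R : realType) (Rt : nat -> R) : Prop :=
  (forall n, 0 <= Rt n <= 1) /\ Rt @ \oo --> (0 : R).

(* R(c n) for real c > 0 and n >= 1, read as R(ceil(c n)). *)
Definition rate_at (R : realType) (Rt : nat -> R) (c : R) (n : nat) : R :=
  Rt `|Num.ceil (c * n%:R)|%N.

Definition learnable_at (R : realType) (X : ptopologicalType) (H : set (X -> bool))
  (Rt : nat -> R) : Prop :=
  exists A : algorithm X, univ_meas_algorithm R A /\
    forall P : probability (ZT X) R, realizable H P ->
      exists C c : R, [/\ 0 < C, 0 < c &
        forall n, (0 < n)%N -> (exp_err P A n <= (C * rate_at Rt c n)%:E)%E].

Definition not_faster (R : realType) (X : ptopologicalType) (H : set (X -> bool))
  (Rt : nat -> R) : Prop :=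
  forall A : algorithm X, univ_meas_algorithm R A ->
    exists P : probability (ZT X) R, realizable H P /\
      exists C c : R, [/\ 0 < C, 0 < c &
        forall N, exists n, (N <= n)%N /\ (0 < n)%N /\
          ((C * rate_at Rt c n)%:E <= exp_err P A n)%E].

Definition optimal_rate (R : realType) (X : ptopologicalType) (H : set (X -> bool))
  (Rt : nat -> R) : Prop :=
  learnable_at H Rt /\ not_faster H Rt.

Definition requires_arbitrarily_slow (R : realType) (X : ptopologicalType)
  (H : set (X -> bool)) : Prop :=
  forall Rt : nat -> R, rate_function Rt -> not_faster H Rt.

Definition prefix (y : nat -> bool) (k : nat) : seq bool := mkseq y k.

Definition has_inf_littlestone (X : Type) (H : set (X -> bool)) : Prop :=
  exists x : seq bool -> X,
    forall (y : nat -> bool) (n : nat), exists2 h, H h &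
      forall k, (k <= n)%N -> h (x (prefix y k)) = y k.

(* VCL labels: y_{k+1} = (y k 0, ..., y k k) in {0,1}^(k+1); the prefix
   y_{<=k} = (y_1, ..., y_k) is a sequence of k strings of lengths 1..k. *)
Definition vcl_prefix (y : nat -> nat -> bool) (k : nat) : seq (seq bool) :=
  mkseq (fun j => mkseq (y j) j.+1) k.

(* Infinite VCL tree: node x_u (u at level k) is a (k+1)-tuple
   (x u 0, ..., x u k) of points. *)
Definition has_inf_VCL (X : Type) (H : set (X -> bool)) : Prop :=
  exists x : seq (seq bool) -> nat -> X,
    forall (y : nat -> nat -> bool) (n : nat), exists2 h, H h &
      forall k i, (k <= n)%N -> (i <= k)%N -> h (x (vcl_prefix y k) i) = y k i.

Definition at_least_three (T : Type) (H : set T) : Prop :=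
  exists a b c, [/\ H a, H b & H c] /\ [/\ a <> b, a <> c & b <> c].

(* Main.v *)
(* Upper bounds. In round [k] of a game the adversary shows a block of [b k] points, the player labels
   the block, and the adversary must stay consistent with the class; [b k = 1] corresponds to Littlestone
   trees and [b k = k + 1] to VCL trees. If there is no infinite tree, then the player wins, and the
   positions carry ordinal ranks that some answer of the player to each block decreases. Instead of
   ordinals, a position is compared with the nodes [w] of the well-founded Kunen-Martin tree of finite
   approximations to codes of trees: each single relation "[w] is below the rank" is Souslin, hence
   universally measurable, and so is everything built from countably many of them.

   The learner cuts the first half of the sample into disjoint pieces, reads each piece as a position of
   the game, and keeps a piece of minimal rank, at the lowest possible level. Take the least rank [w] and
   then the least level [k] reached with positive probability: except with exponentially small
   probability, the position kept has these. From such a position the answer of the player is almost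
   surely wrong on fresh blocks, since otherwise a smaller rank would be reached. Hence the labelings of
   the second half avoid a pattern on every [b k] points, so that they form a class of VC dimension less
   than [b k], and one-inclusion prediction errs with probability at most [2 (b k - 1) / (N + 1)]. This
   is [0] for Littlestone trees and of order [1 / n] for VCL trees.

   Lower bounds. The adversary fixes the branch of a tree level by level, labelling each level so that the
   algorithm errs on half of the points of the level that are missing from the sample; the masses of the
   levels decrease fast enough for the levels below to be unseen with probability at least [1/2]. *)

(* Two obstacles shape the details. Consistency with the class is only a Souslin condition, so a
   limit of consistent finite pieces need not be consistent. The nodes of the Kunen-Martin tree
   therefore approximate, besides the points, sequences that witness consistency; an infinite
   descent then converges to a genuine infinite tree, and without such a tree the descent relation
   is well-founded. The tree is also high enough: an adversary who survives it from the start would,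
   by his own choices, descend in it forever. As its nodes are countable in number, each step of an
   induction along it takes countable intersections and one projection, which keeps all relations
   Souslin.

   Expected errors are iterated integrals of functions that need not be Borel. Such integrals are
   suprema over simple functions below, hence monotone. The upper bound covers the error event by a
   measurable set of equal measure; the lower bounds replace the law by a finite sum of atoms below
   it.

   The factor 2 in the one-inclusion bound is the price of peeling off vertices of small degree in
   place of an optimal orientation of the graph. *)
Require Import Defs.
From HB Require Import structures.
From mathcomp Require Import all_boot.
Set Implicit Arguments. Unset Strict Implicit. Unset Printing Implicit Defensive.

(** * One-inclusion graphs *)

Section OneInclusion.
Variable I : finType.
Local Notation lab := {ffun I -> bool}.
Implicit Types (V C : {set lab}) (S T : {set I}) (u y : lab).
Local Open Scope nat_scope.

Definition flip (i : I) (u : lab) : lab := [ffun j => if j == i then ~~ u j else u j].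

Lemma flipK i : involutive (flip i).
Proof. by move=> u; apply/ffunP => j; rewrite !ffunE; case: eqP => // _; rewrite negbK. Qed.

Lemma flipC i j u : flip i (flip j u) = flip j (flip i u).
Proof. by apply/ffunP => k; rewrite !ffunE; do 2 case: eqP. Qed.

Lemma flip_neq i j u : j != i -> flip i u j = u j.
Proof. by rewrite ffunE => /negbTE ->. Qed.

Lemma flip_eq i u : flip i u i = ~~ u i.
Proof. by rewrite ffunE eqxx. Qed.

Definition shatters V T := forall p : lab, exists2 u, u \in V & {in T, u =1 p}.

(** Every edge of the one-inclusion graph of [V] in a direction from [S] is counted from both ends,
    so this is a sum of degrees. Restricting the directions to [S] allows induction on them. *)
Definition edges S V := \sum_(i in S) \sum_u ((u \in V) && (flip i u \in V)).

Lemma sum_flip a (F : lab -> nat) :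
  \sum_u F u = \sum_(u : lab | ~~ u a) (F u + F (flip a u)).
Proof.
rewrite (bigID (fun u : lab => u a)) /= addnC big_split /=; congr (_ + _).
rewrite (reindex_inj (can_inj (flipK a))) /=.
by apply: eq_bigl => u; rewrite flip_eq.
Qed.

(** Fibres of the projection that forgets the coordinate [a], each represented by its point with
    value [false] there: [collapse] has the fibres that meet [V], [doubled] those contained in
    [V]. *)
Definition collapse a V := [set u : lab | ~~ u a && ((u \in V) || (flip a u \in V))].
Definition doubled a V := [set u : lab | ~~ u a && ((u \in V) && (flip a u \in V))].

Lemma card_sum V : #|V| = \sum_u (u \in V).
Proof. by rewrite -sum1_card big_mkcond /=; apply: eq_bigr => u _; case: (_ \in _). Qed.

Lemma card_collapse a V : #|V| = #|collapse a V| + #|doubled a V|.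
Proof.
rewrite (card_sum V) (card_sum (collapse a V)) (card_sum (doubled a V)) !(sum_flip a).
rewrite -big_split /=; apply: eq_bigr => u ua.
by rewrite !inE flipK flip_eq ua /=; case: (_ \in _); case: (_ \in _).
Qed.

(** Compare two fibres adjacent in a direction other than [a]: one edge of [V] between them needs
    both fibres to meet [V], two edges need both to lie in [V]. *)
Lemma edges_collapse a S V : a \notin S ->
  edges S V <= edges S (collapse a V) + edges S (doubled a V).
Proof.
move=> aS; rewrite /edges -big_split /=; apply: leq_sum => i iS.
have ia : a != i by apply: contraNneq aS => ->.
rewrite !(sum_flip a) -big_split /=; apply: leq_sum => u ua.
rewrite !inE !(flip_neq _ ia) !flip_eq !flipK ua /= !addn0 [flip i (flip a u)]flipC.
by do 4 case: (_ \in V).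
Qed.

Lemma edges_setU1 a S V : a \in S -> edges S V = edges (S :\ a) V + 2 * #|doubled a V|.
Proof.
move=> aS; rewrite /edges (big_setD1 a) //= addnC; congr (_ + _).
rewrite card_sum !(sum_flip a) big_distrr /=; apply: eq_bigr => u ua.
rewrite !inE flip_eq flipK ua /= addn0.
by case: (_ \in _); case: (_ \in _).
Qed.

Lemma collapse_shatters a V T : a \notin T -> shatters (collapse a V) T -> shatters V T.
Proof.
move=> aT sT p; have [u] := sT p; rewrite inE => /andP[_ /orP[uV|uV]] up; first by exists u.
exists (flip a u) => // i iT; rewrite flip_neq ?up //.
by apply: contraNneq aT => <-.
Qed.

Lemma doubled_shatters a V T : a \notin T -> shatters (doubled a V) T -> shatters V (a |: T).
Proof.
move=> aT sT p; have [u] := sT p; rewrite inE => /andP[ua /andP[uV fuV]] up.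
have iu i : i \in T -> i != a by move=> iT; apply: contraNneq aT => <-.
case pa : (p a).
- exists (flip a u) => // i; rewrite !inE => /orP[/eqP ->|iT].
    by rewrite flip_eq (negbTE ua) pa.
  by rewrite flip_neq ?up // iu.
- exists u => // i; rewrite !inE => /orP[/eqP ->|iT]; last exact: up.
  by rewrite (negbTE ua) pa.
Qed.

(** The density bound of Haussler, Littlestone and Warmuth. In the induction [collapse a V] keeps
    the bound [d], while [doubled a V] loses one dimension, since a set shattered by it can be
    enlarged by [a]; this gain pays for the edges in direction [a]. *)
Lemma edges_bound d S V : (forall T, T \subset S -> #|T| = d.+1 -> ~ shatters V T) ->
  edges S V <= 2 * d * #|V|.
Proof.
move: {2}#|S| (leqnn #|S|) => n; elim: n S V d => [|n IH] S V d Sn nsh.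
  by move: Sn; rewrite leqn0 cards_eq0 => /eqP ->; rewrite /edges big_set0.
have [->|[a aS]] := set_0Vmem S; first by rewrite /edges big_set0.
have aS' : a \notin S :\ a by rewrite !inE eqxx.
have aT T : T \subset S :\ a -> a \notin T by move=> /subsetP TS; apply: contraNN aS' => /TS.
have S'n : #|S :\ a| <= n by move: Sn; rewrite (cardsD1 a) aS.
have h1 : edges (S :\ a) (collapse a V) <= 2 * d * #|collapse a V|.
  apply: IH => // T TS Td /(collapse_shatters (aT _ TS)); apply: nsh => //.
  exact: subset_trans TS (subD1set _ _).
rewrite (edges_setU1 V aS) (card_collapse a V) mulnDr.
apply: leq_trans (leq_add (edges_collapse V aS') (leqnn _)) _.
rewrite -addnA; apply: leq_add => //.
(* For [d = 0] no fibre is doubled, as it would shatter the singleton of [a]. *)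
case: d nsh {h1} => [|d] nsh.
  suff -> : doubled a V = set0.
    by rewrite cards0 muln0 addn0 /edges big1 // => i _; rewrite big1 // => u _; rewrite inE.
  apply/eqP; apply/set0Pn => -[u ud]; apply: (nsh [set a]); rewrite ?sub1set ?cards1 //.
  rewrite -[X in shatters _ X]setU0; apply: doubled_shatters; first by rewrite inE.
  by move=> p; exists u => // i; rewrite inE.
have := IH (S :\ a) (doubled a V) d S'n; set e := edges _ _; set D := #|_|.
move=> h; have : e <= 2 * d * D.
  apply: h => T TS Td sT; apply: (nsh (a |: T)).
  - by rewrite subUset sub1set aS (subset_trans TS) // subD1set.
  - by rewrite cardsU1 (aT _ TS) Td.
  - by apply: doubled_shatters => //; exact: aT.
by rewrite mulnS mulnDl addnC leq_add2l.
Qed.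

Definition nbrs V u := [set i | flip i u \in V].

(** The average degree in [V] is at most [2 * d]. All subsets [V] of [C] are covered, because
    peeling leaves arbitrary subsets. *)
Lemma low_degree d C V : (forall T, #|T| = d.+1 -> ~ shatters C T) -> V \subset C ->
  V != set0 -> exists2 u, u \in V & #|nbrs V u| <= 2 * d.
Proof.
move=> nsh /subsetP VC V0.
have nshV T : T \subset [set: I] -> #|T| = d.+1 -> ~ shatters V T.
  by move=> _ Td sT; apply: (nsh T Td) => p; have [u /VC] := sT p; exists u.
have := edges_bound nshV; rewrite /edges exchange_big /= => le.
case: (boolP [exists u in V, #|nbrs V u| <= 2 * d]) => [/exists_inP //|no].
have : \sum_(u in V) (2 * d).+1 <= \sum_u \sum_(i in [set: I]) ((u \in V) && (flip i u \in V)).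
  rewrite big_mkcond /=; apply: leq_sum => u _; case: ifP => // uV.
  have -> : \sum_(i in [set: I]) (true && (flip i u \in V)) = #|nbrs V u|.
    by rewrite -sum1_card [RHS]big_mkcond /=; apply: eq_big => [i|i _]; rewrite !inE //=; case: (_ \in _).
  by rewrite ltnNge; apply: contra no => h; apply/exists_inP; exists u.
rewrite sum_nat_const => le'; have := leq_trans le' le.
rewrite mulnC leq_pmul2r ?ltnn // lt0n; apply: contraNneq V0 => /eqP.
by rewrite cards_eq0.
Qed.

(** A round deletes all vertices of small degree at once. No order among the vertices has to be
    chosen, so the layers are invariant under permutations of the positions. *)
Definition peel e V := [set u in V | e < #|nbrs V u|].
Definition layer e C j := iter j (peel e) C.

Lemma layerS e C j : layer e C j.+1 \subset layer e C j.
Proof. by apply/subsetP => u; rewrite /layer /= inE => /andP[]. Qed.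

Lemma layer_sub e C j k : j <= k -> layer e C k \subset layer e C j.
Proof.
elim: k => [|k IH]; first by rewrite leqn0 => /eqP ->.
rewrite leq_eqVlt => /orP[/eqP -> //|]; rewrite ltnS => /IH.
exact: subset_trans (layerS _ _ _).
Qed.

Lemma layer_eq0 d C : (forall T, #|T| = d.+1 -> ~ shatters C T) -> layer (2 * d) C #|C| = set0.
Proof.
move=> nsh; have H j : #|layer (2 * d) C j| <= #|C| - j.
  elim: j => [|j IH]; first by rewrite subn0.
  have [l0|l0] := eqVneq (layer (2 * d) C j) set0.
    by have := layerS (2 * d) C j; rewrite l0 subset0 => /eqP ->; rewrite cards0.
  have [u uV un] := low_degree nsh (layer_sub (2 * d) C (leq0n j)) l0.
  rewrite subnS -ltnS; apply: (@leq_trans #|layer (2 * d) C j|); last first.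
    rewrite prednK //; apply: leq_trans IH; rewrite lt0n; apply: contraNneq l0 => /eqP.
    by rewrite cards_eq0.
  apply: proper_card; rewrite properE layerS; apply/subsetPn; exists u => //.
  by rewrite /layer /= inE negb_and -leqNgt un orbT.
by have := H #|C|; rewrite subnn leqn0 cards_eq0 => /eqP.
Qed.

Definition put i c u : lab := [ffun j => if j == i then c else u j].

(* The one-inclusion predictor: between the two completions of [y] at [i], guess the one that
   survives longer when vertices of degree at most [e] are repeatedly removed from [C]. *)
Definition predict e C y i : bool :=
  ~~ [exists j : 'I_#|C|.+1, (put i true y \notin layer e C j) && (put i false y \in layer e C j)].

Lemma predict_put e C y i c : predict e C (put i c y) i = predict e C y i.
Proof.
have pp c' : put i c' (put i c y) = put i c' y by apply/ffunP => j; rewrite !ffunE; case: eqP.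
by rewrite /predict; congr (~~ _); apply: eq_existsb => j; rewrite !pp.
Qed.

(** Take the last layer that contains [y]. A wrong guess at [i] means that [flip i y] survives at
    least as long, hence is a neighbour of [y] in this layer; and [y], being removed next, has at
    most [2 * d] neighbours there. *)
Lemma predict_errors d C y : (forall T, #|T| = d.+1 -> ~ shatters C T) -> y \in C ->
  #|[set i | predict (2 * d) C y i != y i]| <= 2 * d.
Proof.
move=> nsh yC.
have ex : exists j, y \notin layer (2 * d) C j by exists #|C|; rewrite layer_eq0 // inE.
case: (ex_minnP ex) => -[|j] yj jmin; first by move: yj; rewrite /layer /= yC.
have {}ex : j < #|C| by apply: jmin; rewrite layer_eq0 // inE.
have yj' : y \in layer (2 * d) C j by apply: contraT => /jmin; rewrite ltnn.
apply: (@leq_trans #|nbrs (layer (2 * d) C j) y|); last first.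
  by move: yj; rewrite {1}/layer /= inE yj' /= -leqNgt.
apply/subset_leq_card/subsetP => i; rewrite !inE /predict.
have yE : put i (y i) y = y by apply/ffunP => k; rewrite ffunE; case: eqP => // ->.
have fE : put i (~~ y i) y = flip i y by apply/ffunP => k; rewrite !ffunE; case: eqP => // ->.
case yi : (y i) yE fE => /= -> ->; case: existsP => //=.
- move=> [k /andP[/jmin jk yk]] _; exact: (subsetP (layer_sub _ _ (ltnW jk))).
- move=> no _; apply: contraT => fj; case: no.
  by exists (Ordinal (ltnW ex : j < #|C|.+1)); rewrite fj.
Qed.

Definition relabel (s : I -> I) u : lab := [ffun i => u (s i)].

Lemma relabel_inj s : injective s -> injective (relabel s).
Proof.
move=> si u v /ffunP uv; apply/ffunP => i.
by have := uv (invF si i); rewrite !ffunE f_invF.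
Qed.

Lemma layer_relabel e s C C' : injective s -> (forall u, (relabel s u \in C') = (u \in C)) ->
  forall j u, (relabel s u \in layer e C' j) = (u \in layer e C j).
Proof.
move=> si CC'; elim=> [|j IH] u //.
rewrite /layer /= !inE -![iter j _ _]/(layer e _ j) IH; congr (_ && (_ < _)).
rewrite -(card_preimset (nbrs (layer e C j) u) si); apply: eq_card => i; rewrite !inE -IH.
suff -> : flip i (relabel s u) = relabel s (flip (s i) u) by [].
by apply/ffunP => k; rewrite !ffunE (inj_eq si).
Qed.

(** Equivariance is what later allows exchangeability of the sample to turn the error at the last
    position into an average over all positions. *)
Lemma predict_relabel e s C C' y i : injective s -> (forall u, (relabel s u \in C') = (u \in C)) ->
  predict e C' (relabel s y) i = predict e C y (s i).
Proof.
move=> si CC'.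
have cC : #|C'| = #|C|.
  rewrite -(card_preimset C' (relabel_inj si)); apply: eq_card => u; rewrite inE; exact: CC'.
have pE c : put i c (relabel s y) = relabel s (put (s i) c y).
  by apply/ffunP => k; rewrite !ffunE (inj_eq si).
rewrite /predict cC; congr (~~ _); apply: eq_existsb => j.
by rewrite !pE !(layer_relabel e si CC').
Qed.

End OneInclusion.

From mathcomp Require Import all_order all_algebra all_fingroup.
From mathcomp Require Import all_classical all_reals all_analysis.
From mathcomp Require Import measurable_realfun ring lra zify.
Import Order.TTheory GRing.Theory Num.Theory.
Import numFieldNormedType.Exports.
Local Open Scope classical_set_scope.
Local Open Scope ring_scope.

(** * Souslin sets and codes of Polish spaces *)

Section LocallyConstant.
Implicit Types f g : nat -> nat.

Definition agree n f g := forall j, (j < n)%N -> f j = g j.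

Lemma agree_le m n f g : (m <= n)%N -> agree n f g -> agree m f g.
Proof. by move=> mn fg j jm; apply: fg; exact: leq_trans mn. Qed.

Definition lc2 (S : Type) (K : (nat -> nat) -> (nat -> nat) -> S) :=
  forall f g, exists n, forall f' g', agree n f f' -> agree n g g' -> K f' g' = K f g.

Definition ucont (s : (nat -> nat) -> nat -> nat) :=
  forall n, exists N, forall f g, agree N f g -> agree n (s f) (s g).

Lemma lc2_comp (S : Type) (K : (nat -> nat) -> (nat -> nat) -> S) s t :
  ucont s -> ucont t -> lc2 K -> lc2 (fun f g => K (s f) (t g)).
Proof.
move=> us ut lK f g; have [n Kn] := lK (s f) (t g).
have [N1 h1] := us n; have [N2 h2] := ut n.
exists (maxn N1 N2) => f' g' ff' gg'; apply: Kn.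
- by apply: h1; apply: agree_le ff'; rewrite leq_maxl.
- by apply: h2; apply: agree_le gg'; rewrite leq_maxr.
Qed.

Definition column g (a : nat) : nat -> nat := fun j => g (pickle (a, j)).
Definition join (gs : nat -> nat -> nat) : nat -> nat := fun q =>
  if unpickle q is Some p then gs p.1 p.2 else 0%N.

Lemma column_join gs a : column (join gs) a = gs a.
Proof. by apply/funext => j; rewrite /column /join pickleK. Qed.

Lemma bounded_codes (a n : nat) : exists N, forall j, (j < n)%N -> (pickle (a, j) < N)%N.
Proof.
exists (\max_(j < n) pickle (a, (j : nat))).+1 => j jn; rewrite ltnS.
exact: (leq_bigmax (Ordinal jn)).
Qed.

Lemma ucont_column a : ucont (column ^~ a).
Proof.
move=> n; have [N NP] := bounded_codes a n.
by exists N => f g fg j jn; apply: fg; exact: NP.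
Qed.

Lemma ucont_id : ucont id. Proof. by move=> n; exists n. Qed.

Definition shift g : nat -> nat := fun j => g j.+1.
Definition unshift a g : nat -> nat := fun j => if j is j'.+1 then g j' else a.

Lemma ucont_shift : ucont shift.
Proof. by move=> n; exists n.+1 => f g fg j jn; apply: fg. Qed.

Definition join2 f g := join (fun a => if a is 0%N then f else g).

Lemma column0_join2 f g : column (join2 f g) 0 = f.
Proof. by rewrite /join2 column_join. Qed.

Lemma column1_join2 f g : column (join2 f g) 1 = g.
Proof. by rewrite /join2 column_join. Qed.

Lemma agree_join2 n : exists N, forall f g f' g', agree N f f' -> agree N g g' ->
  agree n (join2 f g) (join2 f' g').
Proof.
pose c q := if unpickle q is Some p then (p : nat * nat).2 else 0%N.
exists (\max_(q < n) c q).+1 => f g f' g' ff' gg' q qn.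
have cq : (c q < (\max_(q < n) c q).+1)%N by rewrite ltnS; exact: (leq_bigmax (Ordinal qn)).
rewrite /join2 /join; move: cq; rewrite {1}/c; case: (unpickle q) => [[a j]|//] /= jl.
by case: a => [|a]; [exact: ff'|exact: gg'].
Qed.

End LocallyConstant.

(** * Closure properties of Souslin sets *)

Section Analytic.
Implicit Types f g : nat -> nat.

(* Souslin sets with a parameter [f] in the Baire space. Dependence on the Baire coordinates is only
   ever locally constant, so that continuous codes may be substituted for [f] without a measurable
   structure on the space of codes. *)
Definition pana d (T : measurableType d) (Q : (nat -> nat) -> set T) :=
  exists K : nat -> (nat -> nat) -> (nat -> nat) -> set T,
    [/\ forall i f g, measurable (K i f g), forall i, lc2 (K i) &
        forall f t, Q f t <-> exists g, forall i, K i f g t].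

Lemma pana_ext d (T : measurableType d) (Q Q' : (nat -> nat) -> set T) :
  (forall f t, Q f t <-> Q' f t) -> pana Q -> pana Q'.
Proof.
by move=> QQ' [K [mK lK KQ]]; exists K; split=> // f t; rewrite -QQ' KQ.
Qed.

Lemma pana_lc d (T : measurableType d) (Q : (nat -> nat) -> set T) :
  (forall f, measurable (Q f)) -> (forall f, exists n, forall f', agree n f f' -> Q f' = Q f) ->
  pana Q.
Proof.
move=> mQ lQ; exists (fun _ f _ => Q f); split=> //.
- by move=> _ f g; have [n Qn] := lQ f; exists n => f' g' /Qn.
- by move=> f t; split=> [Qt|[g /(_ 0%N)]//]; exists (fun=> 0%N).
Qed.

Lemma measurable_prop d (T : measurableType d) (P : Prop) : measurable [set _ : T | P].
Proof.
have [p|np] := pselect P; first by rewrite (_ : mkset _ = setT) //; apply/seteqP; split.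
by rewrite (_ : mkset _ = set0) //; apply/seteqP; split.
Qed.

Lemma pana_cst d (T : measurableType d) (B : set T) : measurable B -> pana (fun=> B).
Proof. by move=> mB; apply: pana_lc => // f; exists 0%N. Qed.

(** The witnesses for all [a] are packed into the columns of one sequence; numbers that code no pair
    impose no condition. *)
Lemma pana_forall d (T : measurableType d) (A : countType) (Q : A -> (nat -> nat) -> set T) :
  (forall a, pana (Q a)) -> pana (fun f t => forall a, Q a f t).
Proof.
move=> /choice [K KQ].
exists (fun q f g => if @unpickle (A * nat)%type q is Some p
                     then K p.1 p.2 f (column g (pickle p.1)) else setT); split.
- by move=> q f g; case: unpickle => // -[a i]; have [] := KQ a.
- move=> q; case: unpickle => [[a i]|]; last by move=> f g; exists 0%N.
  have [_ lK _] := KQ a.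
  by apply: (lc2_comp ucont_id (ucont_column (pickle a))); exact: lK.
- move=> f t; split=> [Qt|[g Kg] a].
  + have /choice [gs gsP] : forall a, exists g, forall i, K a i f g t.
      by move=> a; have [_ _ <-] := KQ a.
    exists (join (fun p => if unpickle p is Some a then gs a else fun=> 0%N)) => q.
    by case: unpickle => // -[a i]; rewrite column_join pickleK; exact: gsP.
  + have [_ _ ->] := KQ a; exists (column g (pickle a)) => i.
    by have := Kg (pickle (a, i)); rewrite pickleK.
Qed.

(** The first entry of the witness stores the index [a], the rest a witness for [Q a]. *)
Lemma pana_exists d (T : measurableType d) (A : countType) (Q : A -> (nat -> nat) -> set T) :
  (forall a, pana (Q a)) -> pana (fun f t => exists a, Q a f t).
Proof.
move=> /choice [K KQ].
exists (fun i f g => if unpickle (g 0%N) is Some a then K a i f (shift g) else set0); split.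
- by move=> q f g; case: unpickle => // a; have [] := KQ a.
- move=> q f g; case E : (unpickle (g 0%N)) => [a|].
  + have [_ lK _] := KQ a; have [n nP] := lc2_comp ucont_id ucont_shift (lK q) f g.
    exists n.+1 => f' g' ff' gg'; rewrite -gg' // E.
    by apply: nP; [apply: agree_le ff'|apply: agree_le gg'].
  + by exists 1%N => f' g' _ gg'; rewrite -gg' // E.
- move=> f t; split=> [[a]|[g Kg]].
  + have [_ _ ->] := KQ a; move=> [g Kg]; exists (unshift (pickle a) g) => i.
    by rewrite /= pickleK; exact: Kg.
  + move: Kg; case: unpickle => [a Kg|/(_ 0%N)//]; exists a.
    by have [_ _ ->] := KQ a; exists (shift g).
Qed.

Lemma pana_subst d (T : measurableType d) s (Q : (nat -> nat) -> set T) :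
  ucont s -> pana Q -> pana (fun f => Q (s f)).
Proof.
move=> us [K [mK lK KQ]]; exists (fun i f => K i (s f)); split=> // i.
exact: (lc2_comp us ucont_id).
Qed.

Lemma pana_proj d (T : measurableType d) (Q : (nat -> nat) -> set T) :
  pana Q -> pana (fun f t => exists f', Q (join2 f f') t).
Proof.
move=> [K [mK lK KQ]]; exists (fun i f g => K i (join2 f (column g 0)) (column g 1)); split=> //.
- move=> i f g; have [n nP] := lK i (join2 f (column g 0)) (column g 1).
  have [N NP] := agree_join2 n.
  have [N0 N0P] := ucont_column 0 N; have [N1 N1P] := ucont_column 1 n.
  exists (maxn N (maxn N0 N1)) => f' g' ff' gg'; apply: nP.
  + by apply: NP; [apply: agree_le ff'|apply: N0P; apply: agree_le gg']; rewrite !leq_max leqnn ?orbT.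
  + by apply: N1P; apply: agree_le gg'; rewrite !leq_max leqnn ?orbT.
- move=> f t; split=> [[f' /KQ[g Kg]]|[g Kg]].
  + by exists (join2 f' g) => i; rewrite column0_join2 column1_join2.
  + by exists (column g 0); apply/KQ; exists (column g 1).
Qed.

Lemma pana_preimage d d' (T : measurableType d) (T' : measurableType d') (F : T' -> T)
  (Q : (nat -> nat) -> set T) :
  measurable_fun setT F -> pana Q -> pana (fun f => F @^-1` Q f).
Proof.
move=> mF [K [mK lK KQ]]; exists (fun i f g => F @^-1` K i f g); split=> //.
- by move=> i f g; rewrite -[_ @^-1` _]setTI; exact: mF.
- by move=> i f g; have [n nP] := lK i f g; exists n => f' g' ff' gg'; rewrite (nP f' g').
- by move=> f t; exact: KQ.
Qed.

(** What is kept of a continuous surjection from the Baire space: [phi] can be substituted into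
    measurable conditions, which is all that projection along [Y] requires. *)
Definition coded d (Y : measurableType d) (phi : (nat -> nat) -> Y) :=
  (forall y, exists f, phi f = y) /\
  forall d' (T : measurableType d') (B : set Y), measurable B ->
    pana (fun f (_ : T) => B (phi f)).

Lemma pana_and d (T : measurableType d) (Q Q' : (nat -> nat) -> set T) :
  pana Q -> pana Q' -> pana (fun f t => Q f t /\ Q' f t).
Proof.
move=> pQ pQ'; have /pana_forall : forall b : bool, pana (if b then Q else Q') by case.
by apply: pana_ext => f t; split=> [h|[h h'] []//]; split; [exact: (h true)|exact: (h false)].
Qed.

Lemma pana_or d (T : measurableType d) (Q Q' : (nat -> nat) -> set T) :
  pana Q -> pana Q' -> pana (fun f t => Q f t \/ Q' f t).
Proof.
move=> pQ pQ'; have /pana_exists : forall b : bool, pana (if b then Q else Q') by case.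
apply: pana_ext => f t; split=> [[[]]|[]]; by [left|right|exists true|exists false].
Qed.

(** Souslin sets are not closed under complements, so the induction over the sigma-algebra carries
    every set together with its complement. *)
Lemma pana_sigma d (T : measurableType d) (S : Type) (G : set (set S))
    (F : (nat -> nat) -> T -> S) :
  (forall B, G B -> pana (fun f t => B (F f t)) /\ pana (fun f t => ~ B (F f t))) ->
  forall B, <<s G >> B -> pana (fun f t => B (F f t)) /\ pana (fun f t => ~ B (F f t)).
Proof.
move=> GP B; apply: (@smallest_sub _ _ _
  [set B | pana (fun f t => B (F f t)) /\ pana (fun f t => ~ B (F f t))]); last exact: GP.
split=> /=.
- split; first exact: (@pana_cst _ T set0 measurable0).
  by apply: (pana_ext _ (@pana_cst _ T setT measurableT)) => f t; split=> // _ [].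
- move=> A [pA pA']; split.
  + by apply: pana_ext pA' => f t; split=> [h|[]].
  + by apply: pana_ext pA => f t; split=> [h [_ /(_ h)]//|h]; apply: contrapT => h'; exact: h.
- move=> A pA; split.
  + have /pana_exists : forall n : nat, pana (fun f t => A n (F f t)) by move=> n; have [] := pA n.
    by apply: pana_ext => f t; split=> [[n An]|[n _ An]]; exists n.
  + have /pana_forall : forall n : nat, pana (fun f t => ~ A n (F f t)).
      by move=> n; have [] := pA n.
    by apply: pana_ext => f t; split=> [h [n _ An]|h n An]; [exact: (h n)|apply: h; exists n].
Qed.

Lemma pana_measurable d d' (T : measurableType d) (Y : measurableType d') phi
  (M : set (T * Y)) :
  coded phi -> measurable M -> pana (fun f t => M (t, phi f)).
Proof.
move=> [_ cphi]; rewrite measurable_prod_measurableType.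
move=> /(@pana_sigma _ T _ _ (fun f t => (t, phi f))) []// _ [A mA [B mB <-]]; split.
- exact: (pana_and (pana_cst mA) (cphi _ T _ mB)).
- have := pana_or (pana_cst (measurableC mA)) (cphi _ T _ (measurableC mB)).
  by apply: pana_ext => f t /=; split=> [[h []//|h []//]|/not_andP[]]; [left|right].
Qed.

Definition ana d (T : measurableType d) (A : set T) := pana (fun=> A).

Lemma ana_exists d d' (T : measurableType d) (Y : measurableType d') (phi : (nat -> nat) -> Y) (A : set (T * Y)) :
  coded phi -> ana A -> ana [set t | exists y, A (t, y)].
Proof.
move=> cphi [K [mK lK KA]].
pose z := (fun=> 0%N) : nat -> nat.
pose ext (s : seq nat) : nat -> nat := nth 0%N s.
pose cst i s := forall g, agree (size s) (ext s) g -> K i z g = K i z (ext s).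
(* [K i z] depends on a finite prefix of the witness. Once a prefix [s] that determines it is fixed,
   a single measurable set remains, into which the code of the point can be substituted. *)
have H i : pana (fun f (t : T) => K i z (column f 1) (t, phi (column f 0))).
  pose Q s f (t : T) := cst i s /\ (agree (size s) (ext s) (column f 1) /\ K i z (ext s) (t, phi (column f 0))).
  have pQ s : pana (Q s).
    apply: pana_and; first exact: pana_cst (measurable_prop _ _).
    apply: pana_and.
      apply: pana_lc => f.
      - exact: measurable_prop.
      - have [N NP] := ucont_column 1 (size s); exists N => f' /NP ff'.
        apply/funext => t; apply/propext; split=> h j js; first by rewrite ff' // h.
        by rewrite -ff' // h.
    exact: (pana_subst (ucont_column 0) (pana_measurable cphi (mK i z (ext s)))).
  have /pana_exists := pQ; apply: pana_ext => f t; split.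
    by move=> [s [cs [sf Ks]]]; rewrite (cs _ sf).
  move=> Kt; have [n nP] := lK i z (column f 1).
  have sz : size (mkseq (column f 1) n) = n by rewrite size_mkseq.
  have ag : agree n (column f 1) (ext (mkseq (column f 1) n)).
    by move=> j jn; rewrite /ext nth_mkseq.
  exists (mkseq (column f 1) n); split; [|split].
  - rewrite /cst sz => g gg; rewrite (nP z g) ?(nP z (ext _)) //.
    by move=> j jn; rewrite ag // gg.
  - by rewrite sz => j jn; rewrite ag.
  - by rewrite (nP z).
apply: pana_ext (pana_proj (pana_subst (ucont_column 1) (pana_forall H))) => f t; split.
- move=> [f' Kf]; exists (phi (column f' 0)); apply/(KA z); exists (column f' 1).
  by move=> i; have := Kf i; rewrite column1_join2.
- move=> [y /(KA z)[g Kg]]; have [f0 f0y] : exists f, phi f = y by case: cphi.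
  by exists (join2 f0 g) => i; rewrite !column1_join2 column0_join2 f0y; exact: Kg.
Qed.

Lemma ana_forall d (T : measurableType d) (A : countType) (Q : A -> set T) :
  (forall a, ana (Q a)) -> ana [set t | forall a, Q a t].
Proof. by move=> /pana_forall. Qed.

Lemma ana_and d (T : measurableType d) (Q Q' : set T) : ana Q -> ana Q' -> ana (Q `&` Q').
Proof. exact: pana_and. Qed.

Lemma ana_measurable d (T : measurableType d) (Q : set T) : measurable Q -> ana Q.
Proof. exact: pana_cst. Qed.

Lemma ana_preimage d d' (T : measurableType d) (T' : measurableType d') (F : T' -> T)
  (Q : set T) : measurable_fun setT F -> ana Q -> ana (F @^-1` Q).
Proof. exact: pana_preimage. Qed.

Lemma coded_tuple d (Y : measurableType d) (phi : (nat -> nat) -> Y) n :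
  coded phi -> coded (fun f => [tuple phi (column f i) | i < n]).
Proof.
move=> [sphi cphi]; split.
  move=> y; have /choice [F FP] : forall i : nat, exists f, forall j : 'I_n, j = i :> nat -> phi f = tnth y j.
    move=> i; have [ni|ni] := ltnP i n.
    + have [f fi] := sphi (tnth y (Ordinal ni)); exists f => j ji; rewrite fi.
      by congr (tnth y _); apply/val_inj.
    + by exists (fun=> 0%N) => j ji; move: (ltn_ord j); rewrite ji ltnNge ni.
  by exists (join F); apply: eq_from_tnth => i; rewrite tnth_mktuple column_join; exact: FP.
move=> d' T B /(@pana_sigma _ T _ _ (fun f _ => [tuple phi (column f i) | i < n])) [] // {}B.
rewrite -bigcup_seq => -[i _ [A mA <-]].
have H (C : set Y) : measurable C -> pana (fun f (_ : T) => C (phi (column f i))).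
  by move=> mC; exact: (pana_subst (ucont_column i) (cphi _ T _ mC)).
split.
- by apply: pana_ext (H A mA) => f t /=; rewrite tnth_mktuple; split=> // -[].
- apply: pana_ext (H _ (measurableC mA)) => f t /=; rewrite tnth_mktuple.
  by split=> [h [_ /h]//|h h']; exact: h.
Qed.

End Analytic.

(** * Continuous codes of Polish spaces *)

Section PolishCoding.
Variable R : realType.

Lemma expr_half_lt (e : R) : 0 < e -> exists N, 2^-1 ^+ N < e.
Proof.
move=> e0; exists (Num.bound e^-1); rewrite exprVn invf_plt ?posrE ?exprn_gt0 //.
apply: lt_le_trans (archi_boundP _) _; first by rewrite invr_ge0 ltW.
by rewrite -natrX ler_nat ltnW // ltn_expl.
Qed.

Definition continuous_code (Y : topologicalType) (phi : (nat -> nat) -> Y) :=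
  forall U f, open U -> U (phi f) -> exists N, forall f', agree N f f' -> U (phi f').

Lemma polish_code (Y : topologicalType) : polish R Y -> inhabited Y ->
  exists phi : (nat -> nat) -> Y, (forall y, exists f, phi f = y) /\ continuous_code phi.
Proof.
move=> [[D [cD dD]] [d [d0 dC dT dO dK]]] [y0].
have dge0 x y : 0 <= d x y.
  have := dT x y x; rewrite (proj2 (d0 x x) erefl) (dC y x) -mulr2n.
  by rewrite pmulrn_lge0.
have oball y (e : R) : open [set z | d y z < e].
  apply/dO => z /= yz; exists (e - d y z); first by rewrite subr_gt0.
  by move=> t /=; rewrite ltrBrDl; exact: le_lt_trans (dT _ _ _).
have [e eD] : exists e : nat -> Y, forall y, D y -> exists n, e n = y.
  have /countable_injP [g gi] := cD.
  have /choice [e eP] : forall n, exists y, (exists2 z, D z & g z = n) -> D y /\ g y = n.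
    move=> n; have [[z Dz gz]|no] := pselect (exists2 z, D z & g z = n); first by exists z.
    by exists y0 => /no.
  exists e => y Dy; exists (g y); have [Dey ge] := eP (g y) (ex_intro2 _ _ y Dy erefl).
  by apply: gi; rewrite ?inE.
have dense y (r : R) : 0 < r -> exists n, d y (e n) < r.
  move=> r0; have : closure D y by rewrite dD.
  move=> /(_ [set z | d y z < r]) [].
    by apply: open_nbhs_nbhs; split => //=; rewrite (proj2 (d0 y y) erefl).
  by move=> z [/eD [n <-] yz]; exists n.
have [hp [hp_gt0 hpS half_small]] : exists hp : nat -> R, [/\ forall n, 0 < hp n,
    forall n, hp n.+1 = hp n / 2 &
    forall r, 0 < r -> exists N, forall n, (N <= n)%N -> 2 * hp n < r].
  exists (fun n => 2^-1 ^+ n); split=> [n|n|r r0].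
  - by rewrite exprn_gt0.
  - by rewrite exprSr.
  - have [N NP] := expr_half_lt (divr_gt0 r0 (ltr0n R 2)).
    exists N => n Nn; have : 2^-1 ^+ n <= 2^-1 ^+ N :> R.
      by apply: ler_wiXn2l => //; rewrite ?invr_ge0 // invf_le1 ?ler1n.
    by rewrite mulrC -ltr_pdivlMr // => h; exact: le_lt_trans NP.
(* A code lists indices into the dense sequence [e]. An entry that jumps further than [hp m] from
   its corrected predecessor is replaced by that predecessor, so every code converges, at a rate
   common to all codes. *)
pose ft := fix ft (f : nat -> nat) n := if n is m.+1 then
  if d (e (ft f m)) (e (f n)) <= hp m then f n else ft f m else f 0%N.
have ft_step f n : d (e (ft f n)) (e (ft f n.+1)) <= hp n.
  by rewrite /=; case: ifP => // _; rewrite (proj2 (d0 _ _) erefl) ltW // hp_gt0.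
have ft_dist f n m : d (e (ft f n)) (e (ft f (n + m)%N)) <= 2 * hp n - 2 * hp (n + m)%N.
  elim: m => [|m IH]; first by rewrite addn0 (proj2 (d0 _ _) erefl) subrr.
  have := dT (e (ft f n)) (e (ft f (n + m)%N)) (e (ft f (n + m).+1)).
  have := ft_step f (n + m)%N; rewrite addnS hpS; lra.
have ft_lim f : exists x, forall n, d (e (ft f n)) x <= 2 * hp n.
  have [|x xP] := dK (fun n => e (ft f n)).
    move=> r r0; have [N NP] := half_small _ (divr_gt0 r0 (ltr0n R 2)).
    exists N => m n Nm Nn; apply: le_lt_trans (dT _ (e (ft f N)) _) _.
    have := ft_dist f N (m - N)%N; have := ft_dist f N (n - N)%N; rewrite !subnKC // (dC (e (ft f m))).
    have h := hp_gt0.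
    by have := NP N (leqnn _); have := h n; have := h m; lra.
  exists x => n; rewrite leNgt; apply/negP => /[dup] nx; rewrite -subr_gt0 => /xP [N NP].
  have := NP (n + N)%N (leq_addl _ _); have := ft_dist f n N.
  have := dT (e (ft f n)) (e (ft f (n + N)%N)) x.
  have h := hp_gt0.
  by have := h (n + N)%N; lra.
have /choice [phi phiP] := ft_lim.
exists phi; split.
(* With tolerance [hp n / 4] nothing is corrected: successive points are within
   [hp n / 4 + hp n.+1 / 4], less than [hp n]. *)
- move=> y; have /choice [f fP] : forall n, exists k, d y (e k) < hp n / 4%:R.
    by move=> n; apply: dense; rewrite divr_gt0.
  have ftf n : ft f n = f n.
    elim: n => // n IH /=; rewrite IH.
    have := dT (e (f n)) y (e (f n.+1)); rewrite (dC _ y) => h.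
    case: ifP => // /negP; case; apply: le_trans h _.
    have := fP n; have := fP n.+1; rewrite hpS.
    have h := hp_gt0 n.
    by move: h; lra.
  exists f; apply/d0; apply/eqP; rewrite eq_le dge0 andbT leNgt; apply/negP => r0.
  have [N NP] := half_small _ (divr_gt0 r0 (ltr0n R 4)).
  have := phiP f N; have := fP N; have := NP N (leqnn _); rewrite ftf.
  have := dT (phi f) (e (f N)) y; rewrite (dC (e (f N)) y) (dC (phi f) (e _)).
  have h := hp_gt0 N.
  by move: h; lra.
- move=> U f /dO oU /oU [r r0 rU]; have [N NP] := half_small _ (divr_gt0 r0 (ltr0n R 2)).
  exists N.+1 => f' ff'; apply: rU => /=.
  have ftE n : (n <= N)%N -> ft f' n = ft f n.
    elim: n => [|n IH] nN /=; first by rewrite ff'.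
    by rewrite IH ?ff' // ltnW.
  have := phiP f N; have := phiP f' N; have := NP N (leqnn _); rewrite ftE //.
  have := dT (phi f) (e (ft f N)) (phi f'); rewrite (dC (phi f) (e _)).
  by lra.
Qed.

Lemma pana_borel (S : topologicalType) (phi : (nat -> nat) -> S) (B : set S) :
  continuous_code phi -> borel_set B ->
  forall d (T : measurableType d), pana (fun f (_ : T) => B (phi f)).
Proof.
move=> cphi bB d T; move: bB.
move=> /(@pana_sigma _ T _ _ (fun f _ => phi f)) [] // {}B oB.
(* By continuity an open set contains [phi f] exactly when it contains the image of a whole cylinder
   around [f], and the latter is locally constant in [f]. *)
pose C (n : nat) f := forall f', agree n f f' -> B (phi f').
have lC n f f' : agree n f f' -> C n f' = C n f.
  move=> ff'; apply/propext.
  by split=> h g fg; apply: h => j jn; rewrite -fg // ff'.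
have CB f : B (phi f) <-> exists n, C n f.
  split=> [/(cphi _ _ oB)//|[n nP]]; exact: nP.
have pC n : pana (fun f (_ : T) => C n f) /\ pana (fun f (_ : T) => ~ C n f).
  by split; apply: pana_lc; try (by move=> f; exact: measurable_prop);
    move=> f; exists n => f' ff'; rewrite (lC _ _ _ ff').
split.
- by apply: pana_ext (pana_exists (fun n => proj1 (pC n))) => f t; rewrite CB.
- apply: pana_ext (pana_forall (fun n => proj2 (pC n))) => f t; rewrite CB.
  by split=> [h [n nP]|h n Cn]; [exact: (h n)|apply: h; exists n].
Qed.

Lemma coded_borel (X : ptopologicalType) (phi : (nat -> nat) -> X) :
  (forall y, exists f, phi f = y) -> continuous_code phi ->
  @coded _ (BorelT X) phi.
Proof. by move=> sphi cphi; split=> // d T B /(pana_borel cphi). Qed.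

Lemma continuous_code_pair (S S' : topologicalType) (phi : (nat -> nat) -> S)
    (psi : (nat -> nat) -> S') : continuous_code phi -> continuous_code psi ->
  continuous_code (fun f => (phi (column f 0), psi (column f 1))).
Proof.
move=> cphi cpsi M f oM Mf.
have : nbhs (phi (column f 0), psi (column f 1)) M by apply: open_nbhs_nbhs.
move=> [[A B] /= [nA nB] AB].
move: nA; rewrite nbhsE => -[U [oU Ux] UA]; move: nB; rewrite nbhsE => -[V [oV Vx] VB].
have [n nP] := cphi _ _ oU Ux; have [m mP] := cpsi _ _ oV Vx.
have [N NP] := ucont_column 0 n; have [N' NP'] := ucont_column 1 m.
exists (maxn N N') => f' ff'; apply: (AB (_, _)); split.
- by apply: UA; apply: nP; apply: NP; apply: agree_le ff'; rewrite leq_maxl.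
- by apply: VB; apply: mP; apply: NP'; apply: agree_le ff'; rewrite leq_maxr.
Qed.

(** Borel refers here to the product topology. At coded parameters an open [M] is the union over [n]
    of sets [C n f] that are open in the point and locally constant in the code. *)
Lemma pana_borel_prod (Theta : topologicalType) (X : ptopologicalType)
    (phi : (nat -> nat) -> Theta) (M : set (Theta * X)) :
  continuous_code phi -> borel_set M ->
  pana (T := BorelT X) (fun f (x : X) => M (phi f, x)).
Proof.
move=> cphi /(@pana_sigma _ (BorelT X) _ _ (fun f x => (phi f, x : X))) [] // {}M oM.
pose C (n : nat) f : set X := [set x | exists V : set X, [/\ open V, V x &
  forall f' x', agree n f f' -> V x' -> M (phi f', x')]].
have oC n f : measurable (C n f : set (BorelT X)).
  apply: sub_sigma_algebra; rewrite (_ : C n f = \bigcup_(V in [set V | open V /\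
     forall f' x', agree n f f' -> V x' -> M (phi f', x')]) V).
    by apply: bigcup_open => V [].
  by apply/seteqP; split=> [x [V [oV Vx VM]]|x [V [oV VM] Vx]]; exists V.
have lC n : forall f, exists m, forall f', agree m f f' -> C n f' = C n f.
  move=> f; exists n => f' ff'; apply/seteqP.
  split=> x [V [oV Vx VM]]; exists V; split=> // g x' gg; apply: VM => j jn.
  - by rewrite -ff' // gg.
  - by rewrite ff' // gg.
have CM f x : M (phi f, x) <-> exists n, C n f x.
  split=> [Mfx|[n [V [oV Vx VM]]]]; last exact: VM.
  have : nbhs (phi f, x) M by apply: open_nbhs_nbhs.
  move=> [[A B] /= [nA nB] AB].
  have [U [oU Ux UA]] : exists U, [/\ open U, U (phi f) & U `<=` A].
    by move: nA; rewrite nbhsE => -[U [oU Ux] UA]; exists U.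
  move: nB; rewrite nbhsE => -[V [oV Vx] VB].
  have [n nP] := cphi _ _ oU Ux.
  exists n; exists V; split=> // f' x' /nP Uf' Vx'; apply: (AB (_, _)); split; [exact: UA|exact: VB].
split.
- have pC n : pana (T := BorelT X) (C n) by apply: pana_lc; [exact: oC|exact: lC].
  by apply: pana_ext (pana_exists pC) => f t; rewrite CM.
- have pC n : pana (T := BorelT X) (fun f => ~` C n f).
    apply: pana_lc; first by move=> f; apply: measurableC; exact: oC.
    by move=> f; have [m mP] := lC n f; exists m => f' /mP ->.
  apply: pana_ext (pana_forall pC) => f t; rewrite CM.
  by split=> [h [n nP]|h n Cn]; [exact: (h n)|apply: h; exists n].
Qed.

End PolishCoding.

(** * Universally measurable sets *)

Lemma mkseq_rcons (S : Type) (f : nat -> S) n : mkseq f n.+1 = rcons (mkseq f n) (f n).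
Proof. by rewrite /mkseq -addn1 iotaD map_cat /= cats1 add0n. Qed.

Section CountableSets.
Context d (T : measurableType d).

Lemma measurable_exists (A : countType) (Q : A -> set T) :
  (forall a, measurable (Q a)) -> measurable [set t | exists a, Q a t].
Proof.
move=> mQ; rewrite (_ : mkset _ = \bigcup_a Q a); last first.
  by apply/seteqP; split=> t; [move=> [a Qa]; exists a|move=> [a _ Qa]; exists a].
exact: countable_bigcupT_measurable.
Qed.

Lemma measurable_forall (A : countType) (Q : A -> set T) :
  (forall a, measurable (Q a)) -> measurable [set t | forall a, Q a t].
Proof.
move=> mQ; rewrite (_ : mkset _ = ~` [set t | exists a, (~` Q a) t]).
  by apply: measurableC; apply: measurable_exists => a; exact: measurableC.
apply/seteqP; split=> t h; first by move=> [a]; exact.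
by move=> a; apply: contrapT => na; apply: h; exists a.
Qed.

End CountableSets.

Definition pushprob d d' (T : measurableType d) (T' : measurableType d') (R : realType)
  (P : probability T R) (F : T -> T') (mF : measurable_fun setT F) := pushforward P F.

Section PushforwardProbability.
Context d d' (T : measurableType d) (T' : measurableType d') (R : realType)
  (P : probability T R) (F : T -> T') (mF : measurable_fun setT F).

Let pushprob0 : pushprob P mF set0 = 0%E.
Proof. by rewrite /pushprob /pushforward preimage_set0 measure0. Qed.

Let pushprob_ge0 A : (0 <= pushprob P mF A)%E.
Proof. exact: measure_ge0. Qed.

Let pushprob_sigma_additive : semi_sigma_additive (pushprob P mF).
Proof.
move=> E mE tE mUE; rewrite /pushprob /pushforward preimage_bigcup.
apply: measure_semi_sigma_additive.
- by move=> n; rewrite -[X in measurable X]setTI; exact: mF.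
- apply/trivIsetP => /= i j _ _ ij; rewrite -preimage_setI.
  by move/trivIsetP : tE => /(_ _ _ _ _ ij) ->//; rewrite preimage_set0.
- by rewrite -preimage_bigcup -[X in measurable X]setTI; exact: mF.
Qed.

HB.instance Definition _ := isMeasure.Build _ _ _ (pushprob P mF) pushprob0 pushprob_ge0 pushprob_sigma_additive.

Let pushprob_setT : pushprob P mF setT = 1%E.
Proof. by rewrite /pushprob /pushforward preimage_setT probability_setT. Qed.

HB.instance Definition _ := Measure_isProbability.Build _ _ _ (pushprob P mF) pushprob_setT.
End PushforwardProbability.

Section UniversallyMeasurable.
Variable R : realType.
Local Notation um := (univ_meas_set R).

Lemma um_measurable d (T : measurableType d) (A : set T) : measurable A -> um A.
Proof. by move=> mA P; exists A, A; split=> //; rewrite setDv measure0. Qed.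

Lemma um_setC d (T : measurableType d) (A : set T) : um A -> um (~` A).
Proof.
move=> uA P; have [B1 [B2 [m1 m2 B1A AB2 P0]]] := uA P.
exists (~` B2), (~` B1); split; [exact: measurableC|exact: measurableC|exact: subsetC|exact: subsetC|].
by rewrite setDE setCK setIC -setDE.
Qed.

Lemma um_exists d (T : measurableType d) (I : countType) (A : I -> set T) :
  (forall i, um (A i)) -> um [set t | exists i, A i t].
Proof.
move=> uA P; have /choice [B1 /choice [B2 BP]] := fun i => uA i P.
exists [set t | exists i, B1 i t], [set t | exists i, B2 i t]; split.
- by apply: measurable_exists => i; have [] := BP i.
- by apply: measurable_exists => i; have [] := BP i.
- by move=> t [i]; have [_ _ h _ _] := BP i => /h; exists i.
- by move=> t [i]; have [_ _ _ h _] := BP i => /h; exists i.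
pose D n := if @unpickle I n is Some i then B2 i `\` B1 i else set0.
apply: (@measure_negligible _ _ _ P).
  by apply: measurableD; apply: measurable_exists => i; have [] := BP i.
apply: (@negligibleS _ _ _ P (\bigcup_n D n)).
  move=> t [[i B2i] B1t]; exists (pickle i) => //; rewrite /D pickleK; split=> // B1i.
  by apply: B1t; exists i.
apply: negligible_bigcup => n; rewrite /D; case: unpickle => [i|]; last exact: negligible_set0.
have [m1 m2 _ _ P0] := BP i.
by apply/negligibleP; first exact: measurableD.
Qed.

Lemma um_forall d (T : measurableType d) (I : countType) (A : I -> set T) :
  (forall i, um (A i)) -> um [set t | forall i, A i t].
Proof.
move=> uA; rewrite (_ : mkset _ = ~` [set t | exists i, (~` A i) t]).
  by apply: um_setC; apply: um_exists => i; exact: um_setC.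
apply/seteqP; split=> t h; first by move=> [a]; exact.
by move=> a; apply: contrapT => na; apply: h; exists a.
Qed.

Lemma um_prop d (T : measurableType d) (Q : Prop) : um [set _ : T | Q].
Proof. exact/um_measurable/measurable_prop. Qed.

Lemma um_setI d (T : measurableType d) (A B : set T) : um A -> um B -> um (A `&` B).
Proof.
move=> uA uB; rewrite (_ : A `&` B = [set t | forall b : bool, (if b then A else B) t]).
  by apply: um_forall => -[].
apply/seteqP; split=> t; first by move=> [At Bt] [].
by move=> h; split; [exact: (h true)|exact: (h false)].
Qed.

Lemma um_setU d (T : measurableType d) (A B : set T) : um A -> um B -> um (A `|` B).
Proof.
move=> uA uB; rewrite -[_ `|` _]setCK setCU; apply: um_setC.
by apply: um_setI; exact: um_setC.
Qed.

Lemma um_imply d (T : measurableType d) (A B : set T) :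
  um A -> um B -> um [set t | A t -> B t].
Proof.
move=> uA uB; rewrite (_ : mkset _ = ~` A `|` B); first exact: um_setU (um_setC uA) uB.
apply/seteqP; split=> t => [AB|[nA /nA|Bt _]//].
by have [/AB|] := pselect (A t); [right|left].
Qed.

Lemma um_preimage d d' (T : measurableType d) (T' : measurableType d') (F : T -> T')
  (A : set T') : measurable_fun setT F -> um A -> um (F @^-1` A).
Proof.
move=> mF uA P; have [B1 [B2 [m1 m2 B1A AB2 P0]]] := uA (pushprob P mF).
exists (F @^-1` B1), (F @^-1` B2); split=> //.
- by rewrite -[X in measurable X]setTI; exact (mF measurableT _ m1).
- by rewrite -[X in measurable X]setTI; exact (mF measurableT _ m2).
- by move=> t; exact: B1A.
- by move=> t; exact: AB2.
Qed.

Lemma um_comp d (T : measurableType d) (I : countType) (F : T -> I) (G : I -> Prop) :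
  (forall i, um [set t | F t = i]) -> um [set t | G (F t)].
Proof.
move=> uF; rewrite (_ : mkset _ = [set t | exists i, G i /\ F t = i]).
  by apply: um_exists => i; exact: (um_setI (um_prop (T := T) (G i)) (uF i)).
by apply/seteqP; split=> t => [GF|[i [Gi Fi]]]; [exists (F t)|rewrite /= Fi].
Qed.

Lemma um_ffun d (T : measurableType d) (I : finType) (F : T -> {ffun I -> bool}) :
  (forall i, um [set t | F t i]) -> forall f, um [set t | F t = f].
Proof.
move=> uF f; rewrite (_ : mkset _ = [set t | forall i : I, (if f i then [set t | F t i] else ~` [set t | F t i]) t]).
  by apply: um_forall => i; case: (f i) => //; exact: um_setC.
apply/seteqP; split=> t => [<- i|h]; first by case E: (F t i) => //=; rewrite E.
by apply/ffunP => i; have := h i; case: (f i) => /=; case: (F t i).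
Qed.

Lemma um_finset d (T : measurableType d) (I : finType) (F : T -> {set I}) :
  (forall i, um [set t | i \in F t]) -> forall f, um [set t | F t = f].
Proof.
move=> uF f; rewrite (_ : mkset _ = [set t | [ffun i => i \in F t] = [ffun i => i \in f]]).
  by apply: um_ffun => i; under eq_set do rewrite ffunE; exact: uF.
apply/seteqP; split=> t /= => [->//|/ffunP h].
by apply/setP => i; have := h i; rewrite !ffunE.
Qed.

End UniversallyMeasurable.

(** * Outer measure and Luzin's theorem *)

Section Lusin.
Context d (T : measurableType d) (R : realType) (P : probability T R).

Lemma measurable_hull (A : set T) : exists B, [/\ measurable B, A `<=` B &
  forall C, measurable C -> A `<=` C -> (P B <= P C)%E].
Proof.
pose S := [set P C | C in [set C | measurable C /\ A `<=` C]].
have S0 C : measurable C -> A `<=` C -> (ereal_inf S <= P C)%E.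
  by move=> mC AC; apply: ereal_inf_lbound; exists C.
have fS : ereal_inf S \is a fin_num.
  rewrite ge0_fin_numE; last by apply/ereal_infP => _ [C _ <-].
  by apply: le_lt_trans (S0 setT _ _) _ => //; rewrite probability_setT ltry.
have /choice [C CP] : forall n : nat, exists C, [/\ measurable C, A `<=` C &
    (P C < ereal_inf S + (n.+1%:R^-1)%:E)%E].
  move=> n; have [|_ [C [mC AC] <-] PC] := @lb_ereal_inf_adherent _ S n.+1%:R^-1 _ fS.
    by rewrite invr_gt0.
  by exists C.
have mB : measurable (\bigcap_n C n) by apply: bigcapT_measurable => n; have [] := CP n.
exists (\bigcap_n C n); split=> //.
- by move=> t At n _; have [_ h _] := CP n; exact: h.
- move=> D mD AD; apply: le_trans (S0 _ mD AD).
  apply/lee_addgt0Pr => e e0.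
  have [n ne] : exists n : nat, n.+1%:R^-1 < e.
    exists (Num.bound e^-1); rewrite invf_plt ?posrE //.
    apply: lt_trans (archi_boundP _) _; first by rewrite invr_ge0 ltW.
    by rewrite ltr_nat.
  have [mC AC PC] := CP n.
  apply: le_trans (_ : (P (C n) <= _)%E); first by apply: le_measure; rewrite ?inE // => t; exact.
  by apply: le_trans (ltW PC) _; rewrite leeD2l // lee_fin ltW.
Qed.

Definition hull (A : set T) := projT1 (cid (measurable_hull A)).

Lemma measurable_hullP A : measurable (hull A).
Proof. by rewrite /hull; case: cid => B []. Qed.

Lemma sub_hull A : A `<=` hull A.
Proof. by rewrite /hull; case: cid => B []. Qed.

Lemma hull_min A C : measurable C -> A `<=` C -> (P (hull A) <= P C)%E.
Proof. by rewrite /hull; case: cid => B [] /= _ _; exact. Qed.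

Let pr (A : set T) : R := fine (P A).

Let prE A : measurable A -> P A = (pr A)%:E.
Proof. by move=> mA; rewrite fineK // fin_num_measure. Qed.

Let pr_le A B : measurable A -> measurable B -> A `<=` B -> pr A <= pr B.
Proof. by move=> mA mB AB; rewrite -lee_fin -!prE //; apply: le_measure; rewrite ?inE. Qed.

(** The intersections [F r] of the hulls of all [E q] with [q >= r] are measurable, increase with
    [r] and still contain [E r]; continuity of the measure along them becomes continuity of the
    outer measure. *)
Lemma hull_continuous (E : (set T)^nat) (e : R) : 0 < e ->
  (forall n, E n `<=` E n.+1) -> exists n, pr (hull (\bigcup_k E k)) <= pr (hull (E n)) + e.
Proof.
move=> e0 iE; have iE' m n : (m <= n)%N -> E m `<=` E n.
  elim: n => [|n IH]; first by rewrite leqn0 => /eqP ->.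
  by rewrite leq_eqVlt => /orP[/eqP->//|]; rewrite ltnS => /IH h; exact: subset_trans (iE n).
pose F r := \bigcap_(q in [set q | (r <= q)%N]) hull (E q).
have mF r : measurable (F r) by apply: bigcap_measurableType => q _; exact: measurable_hullP.
have mUF : measurable (\bigcup_r F r) by exact: bigcupT_measurable.
have ndF : nondecreasing_seq F.
  by move=> m n mn; apply/subsetPset => t Fm q /= nq; apply: Fm => /=; exact: leq_trans nq.
have : P \o F @ \oo --> (pr (\bigcup_r F r))%:E.
  by rewrite -(prE mUF); exact: nondecreasing_cvg_mu.
move=> /fine_cvgP [_ /cvgrPdist_le /(_ e e0) [n _ /(_ n (leqnn n)) /=]].
have <- : pr (F n) = fine (P (F n)) by [].
rewrite ler_distlC => /andP[h1 h2].
exists n; apply: (@le_trans _ _ (pr (\bigcup_r F r))).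
  rewrite -lee_fin -!prE //; last exact: measurable_hullP.
  apply: hull_min => // t [q _ Eq]; exists q => // q' qq'; apply: sub_hull; exact: iE' Eq.
have : pr (F n) <= pr (hull (E n)).
  by apply: pr_le => //; [exact: measurable_hullP|move=> t; apply => /=].
by move: h1 h2; lra.
Qed.


(* Luzin's theorem: Souslin sets are universally measurable.  The witness sequence is bounded
   coordinatewise at a small cost of outer measure; by Koenig's lemma the resulting measurable
   sets shrink to a subset of the Souslin set. *)
Section Souslin.
Variable K : nat -> (nat -> nat) -> set T.
Hypothesis mK : forall i g, measurable (K i g).
Hypothesis lK : forall i g, exists n, forall g', agree n g g' -> K i g' = K i g.

Let ext (s : seq nat) : nat -> nat := nth 0%N s.
(** [cst i s] says that the prefix [s] already determines [K i]. The sets [B s] collect the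
    conditions determined so far, so they shrink along a branch [g] to the intersection of the
    [K i g]. *)
Let cst i s := forall g, agree (size s) (ext s) g -> K i g = K i (ext s).
Let B (s : seq nat) : set T := \bigcap_(i in [set i | cst i s]) K i (ext s).

Let mB s : measurable (B s). Proof. exact: bigcap_measurableType. Qed.

Let agree_ext g n : agree n (ext (mkseq g n)) g.
Proof. by move=> j jn; rewrite /ext nth_mkseq. Qed.

Let BK g t : (forall n, B (mkseq g n) t) <-> forall i, K i g t.
Proof.
split=> [Bt i|Kt n i].
- have [n nP] := lK i g; have gn := @agree_ext g n.
  have <- : K i (ext (mkseq g n)) = K i g by apply: nP => j jn; rewrite gn.
  apply: (Bt n) => g'; rewrite size_mkseq => gg'; rewrite (nP g').
    by rewrite nP // => j jn; rewrite gn.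
  by move=> j jn; rewrite -gg' // gn.
- by rewrite /= => /(_ g) <- //; rewrite size_mkseq.
Qed.

Let B_rcons s r : B (rcons s r) `<=` B s.
Proof.
move=> t Bt i /= ci; have ag g : agree (size (rcons s r)) (ext (rcons s r)) g -> agree (size s) (ext s) g.
  move=> sg j js; have jr : (j < size (rcons s r))%N by rewrite size_rcons ltnS ltnW.
  by rewrite -(sg j jr) /ext nth_rcons js.
rewrite -(ci (ext (rcons s r))); last exact: ag.
by apply: Bt => g /ag sg; rewrite ci // -(ci (ext (rcons s r))) //; exact: ag.
Qed.

Let A_ (s : seq nat) := [set t | exists g, (forall j, (j < size s)%N -> (g j <= ext s j)%N) /\ forall i, K i g t].

Let bounded (M : nat -> nat) (s : seq nat) := all (fun j => (ext s j <= M j)%N) (iota 0 (size s)).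

Let bounded_rcons M s r : bounded M (rcons s r) = bounded M s && (r <= M (size s))%N.
Proof.
rewrite /bounded size_rcons -addn1 iotaD all_cat /= andbT add0n.
congr (_ && _); last by rewrite /ext nth_rcons ltnn eqxx.
apply: eq_in_all => j; rewrite mem_iota /= add0n => js; by rewrite /ext nth_rcons js.
Qed.

(** A [good] node has admissible extensions of every length. The bound [M] leaves it finitely many
    children, so one of them is good again. *)
Let koenig M t : (forall n, exists s, [/\ size s = n, bounded M s & B s t]) ->
  exists g, forall n, B (mkseq g n) t.
Proof.
move=> H.
pose good s := forall n, exists u, [/\ size u = n, bounded M (s ++ u) & B (s ++ u) t].
have good0 : good [::] by [].
have Bcat s u : B (s ++ u) t -> B s t.
  elim/last_ind: u => [|u r IH]; first by rewrite cats0.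
  by rewrite -rcons_cat => /B_rcons /IH.
have bcat s u : bounded M (s ++ u) -> bounded M s.
  elim/last_ind: u => [|u r IH]; first by rewrite cats0.
  by rewrite -rcons_cat bounded_rcons => /andP[/IH].
have goodS s : good s -> exists r, good (rcons s r).
  move=> gs; apply: contrapT => no.
  have /choice [N NP] : forall r, exists n, ~ exists u, [/\ size u = n, bounded M (rcons s r ++ u) & B (rcons s r ++ u) t].
    move=> r; apply: contrapT => h; apply: no; exists r => n.
    by apply: contrapT => h'; apply: h; exists n.
  pose m := (\max_(r < (M (size s)).+1) N r)%N.
  have [[|r u] [//= um bu Bu]] := gs m.+1; case: um => um.
  have rM : (r <= M (size s))%N.
    by move: bu; rewrite -cat_rcons => /bcat; rewrite bounded_rcons => /andP[].
  have Nm : (N r <= m)%N by exact: (leq_bigmax (Ordinal (rM : (r < (M (size s)).+1)%N))).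
  apply: (NP r); exists (take (N r) u); split; first by rewrite size_takel // um.
  - by apply: (bcat _ (drop (N r) u)); rewrite -catA cat_take_drop cat_rcons.
  - by apply: (Bcat _ (drop (N r) u)); rewrite -catA cat_take_drop cat_rcons.
have /choice [nx nxP] : forall s, exists r, good s -> good (rcons s r).
  by move=> s; have [/goodS[r]|ns] := pselect (good s); [exists r|exists 0%N].
pose S := fix S n := if n is m.+1 then rcons (S m) (nx (S m)) else [::].
have Sgood n : good (S n) by elim: n => //= n; exact: nxP.
have Ssz n : size (S n) = n by elim: n => //= n IH; rewrite size_rcons IH.
exists (fun n => nx (S n)) => n.
have -> : mkseq (fun n => nx (S n)) n = S n.
  by elim: n => // n IH; rewrite mkseq_rcons IH.
have [u [_ _ /Bcat]] := Sgood n 0%N; exact.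
Qed.

Lemma souslin_inner (e : R) : 0 < e -> exists C, [/\ measurable C,
  C `<=` [set t | exists g, forall i, K i g t] &
  pr (hull [set t | exists g, forall i, K i g t]) <= pr C + e].
Proof.
move=> e0.
(* These losses sum to [e / 2]; the other half of [e] is spent on continuity from above along the
   sets [C n]. *)
have step s : exists r, pr (hull (A_ s)) <= pr (hull (A_ (rcons s r))) + e * 2^-1 ^+ (size s).+2.
  have -> : A_ s = \bigcup_r A_ (rcons s r).
    apply/seteqP; split=> [t [g [gs Kg]]|t [r _ [g [gs Kg]]]].
    + exists (g (size s)) => //; exists g; split=> // j.
      rewrite size_rcons ltnS leq_eqVlt => /orP[/eqP->|js].
        by rewrite /ext nth_rcons ltnn eqxx.
      by rewrite /ext nth_rcons js; exact: gs.
    + exists g; split=> // j js; have := gs j; rewrite size_rcons ltnS ltnW // => /(_ isT).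
      by rewrite /ext nth_rcons js.
  apply: hull_continuous; first by rewrite mulr_gt0 // exprn_gt0.
  move=> r t [g [gs Kg]]; exists g; split=> // j js; apply: leq_trans (gs j _) _.
    by move: js; rewrite !size_rcons.
  by rewrite /ext !nth_rcons; case: ifP => // _; case: ifP.
have [nx nxP] := choice step.
pose S := fix S n := if n is m.+1 then rcons (S m) (nx (S m)) else [::].
have Ssz n : size (S n) = n by elim: n => //= n IH; rewrite size_rcons IH.
pose M j := nx (S j).
have extS n j : (j < n)%N -> ext (S n) j = M j.
  elim: n => // n IH; rewrite ltnS leq_eqVlt => /orP[/eqP->|jn].
    by rewrite /= /ext nth_rcons Ssz ltnn eqxx.
  by rewrite /= /ext nth_rcons Ssz jn; exact: IH.
pose A := [set t | exists g, forall i, K i g t].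
have A0 : A_ [::] = A.
  by apply/seteqP; split=> t; [move=> [g [_ Kg]]; exists g|move=> [g Kg]; exists g].
have outer n : pr (hull A) <= pr (hull (A_ (S n))) + e * (2^-1 - 2^-1 ^+ n.+1).
  elim: n => [|n IH]; first by rewrite /= A0 expr1 subrr mulr0 addr0.
  apply: le_trans IH _; have := nxP (S n); rewrite Ssz /= => h.
  move: h; rewrite ![2^-1 ^+ n.+2]exprS; set p := 2^-1 ^+ n.+1.
  by rewrite !mulrBr [e * (_ * p)]mulrCA; move: (e * p) (pr _) (pr _) => x y z; lra.
pose C n := [set t | exists s, (size s = n /\ bounded M s) /\ B s t].
have mC n : measurable (C n).
  by apply: measurable_exists => s; apply: measurableI; [exact: measurable_prop|exact: mB].
have CS n : C n.+1 `<=` C n.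
  move=> t [s [[sn]]]; case/lastP: s sn => // s r; rewrite size_rcons bounded_rcons => -[sn] /andP[bs _] Bt.
  by exists s; split=> //; exact: B_rcons Bt.
have AC n : A_ (S n) `<=` C n.
  move=> t [g [gM Kg]]; exists (mkseq g n); split; last exact: (proj2 (BK g t) Kg n).
  rewrite size_mkseq; split=> //; apply/allP => j; rewrite mem_iota size_mkseq /= add0n => jn.
  by rewrite agree_ext // -(extS n) //; apply: gM; rewrite Ssz.
have mI : measurable (\bigcap_n C n) by exact: bigcapT_measurable.
exists (\bigcap_n C n); split=> //.
  move=> t Ct; have [n|g /BK] := @koenig M t; last by exists g.
  by have [s [[]]] := Ct n I; exists s.
have niC : nonincreasing_seq C.
  apply/nonincreasing_seqP => n; exact/subsetPset.
have fC : (P (C 0%N) < +oo)%E by rewrite prE // ltry.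
have : P \o C @ \oo --> (pr (\bigcap_n C n))%:E.
  by rewrite -(prE mI); exact: nonincreasing_cvg_mu.
have e2 : 0 < e / 2 by rewrite divr_gt0.
move=> /fine_cvgP [_ /cvgrPdist_le /(_ _ e2) [n _ /(_ n (leqnn n)) /=]].
rewrite ler_distlC => /andP[_ h1].
have h2 : pr (hull (A_ (S n))) <= pr (C n).
  by rewrite -lee_fin -!prE //; [exact: hull_min|exact: measurable_hullP].
have h3 := outer n; have h4 : 0 < e * 2^-1 ^+ n.+1 by rewrite mulr_gt0 // exprn_gt0.
move: h1 h2 h3 h4; rewrite -[fine (P (C n))]/(pr (C n)) mulrBr; lra.
Qed.

End Souslin.
End Lusin.

Lemma ana_um d (T : measurableType d) (R : realType) (A : set T) : ana A -> univ_meas_set R A.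
Proof.
move=> [K [mK lK KA]] P; pose z := (fun=> 0%N) : nat -> nat.
have AE : A = [set t | exists g, forall i, K i z g t] by apply/seteqP; split=> t; rewrite (KA z).
have lK' i g : exists n, forall g', agree n g g' -> K i z g' = K i z g.
  by have [n nP] := lK i z g; exists n => g' /nP; apply.
have /choice [C CP] : forall n : nat, exists C, [/\ measurable C, C `<=` A &
    fine (P (hull P A)) <= fine (P C) + n.+1%:R^-1].
  by move=> n; rewrite AE; apply: souslin_inner.
have mU : measurable (\bigcup_n C n) by apply: bigcupT_measurable => n; have [] := CP n.
exists (\bigcup_n C n), (hull P A); split=> //; [exact: measurable_hullP| |exact: sub_hull|].
  by move=> t [n _]; have [_ h _] := CP n; exact: h.
have UA : \bigcup_n C n `<=` hull P A.
  by move=> t [n _ Ct]; apply: sub_hull; have [_ h _] := CP n; exact: h.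
have mH := measurable_hullP P A.
have le0 : (P (hull P A) <= P (\bigcup_n C n))%E.
  apply/lee_addgt0Pr => e e0.
  have [n ne] : exists n : nat, n.+1%:R^-1 < e.
    exists (Num.bound e^-1); rewrite invf_plt ?posrE //.
    apply: lt_trans (archi_boundP _) _; first by rewrite invr_ge0 ltW.
    by rewrite ltr_nat.
  have [mC _ CA] := CP n.
  have : (P (C n) <= P (\bigcup_n C n))%E by apply: le_measure; rewrite ?inE //; exact: bigcup_sup.
  have f1 := @fin_num_measure _ _ _ P _ mH; have f2 := @fin_num_measure _ _ _ P _ mC.
  move=> CU; apply: (@le_trans _ _ (P (C n) + e%:E)%E); last exact: leeD2r.
  rewrite -(fineK f1) -(fineK f2) -EFinD lee_fin; apply: le_trans CA _.
  by rewrite lerD2l ltW.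
apply/eqP; rewrite eq_le measure_ge0 andbT measureD //.
  by rewrite setIidr // sube_le0.
by rewrite ltey_eq fin_num_measure.
Qed.

(** * Positions of the game and their ranks *)

Section Positions.
Variables (X : Type) (b : nat -> nat).

Fixpoint hsize k := if k is k'.+1 then (hsize k' + b k')%N else 0%N.

Definition block k (xs : nat -> X) (c : seq bool) : seq (X * bool) :=
  mkseq (fun i => (xs i, nth false c i)) (b k).

Variable alive : nat -> seq nat -> seq (X * bool) -> Prop.

(** Read [alive k w v] as: the rank of [w] is at most that of [v]. Optimal labels defeat every
    counter that some labels defeat, that is, they minimise the rank of the next position. *)
Definition optimal_labels k v xs c := forall w, (exists c', ~ alive k.+1 w (v ++ block k xs c')) ->
  ~ alive k.+1 w (v ++ block k xs c).

End Positions.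

(** * Ranks of positions through the Kunen-Martin tree *)

Section Game.
Variables (R : realType) (X : ptopologicalType) (Theta : topologicalType).
Variable h : Theta -> X -> bool.
Variable b : nat -> nat.
Variables (phiT : (nat -> nat) -> Theta) (phiX : (nat -> nat) -> X).
Hypothesis phiT_surj : forall y, exists f, phiT f = y.
Hypothesis phiT_cont : continuous_code phiT.
Hypothesis phiX_surj : forall y, exists f, phiX f = y.
Hypothesis phiX_cont : continuous_code phiX.
Hypothesis h_borel : forall c : bool, borel_set (T := (Theta * X)%type) [set p | h p.1 p.2 = c].

Local Notation block := (block b).
Local Notation hsize := (hsize b).

Definition has_tree := exists x : seq (seq bool) -> nat -> X,
  forall (y : nat -> seq bool) n, exists th, forall k i, (k <= n)%N -> (i < b k)%N ->
    h th (x (mkseq y k) i) = nth false (y k) i.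

Definition consistent (v : seq (X * bool)) := exists th, all (fun z => h th z.1 == z.2) v.

(** Once the points are given by codes, consistency concerns codes alone; over the one-point space
    [unit] its Souslin scheme is a locally constant relation. *)
Lemma consistent_code : exists L : seq bool -> nat -> (nat -> nat) -> (nat -> nat) -> Prop,
  (forall y i, lc2 (L y i)) /\
  forall y f, consistent (mkseq (fun i => (phiX (column f i), nth false y i)) (size y)) <->
    exists g, forall i, L y i f g.
Proof.
have H y : pana (fun f (_ : unit) =>
    consistent (mkseq (fun i => (phiX (column f i), nth false y i)) (size y))).
  pose phi f := (phiT (column f 0), phiX (column f 1)).
  have cphi : continuous_code phi by exact: continuous_code_pair.
  pose s i f := join2 (column f 1) (column (column f 0) i).
  have us i : ucont (s i).
    move=> n; have [N NP] := agree_join2 n.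
    have [N1 N1P] := ucont_column 1 N; have [N2 N2P] := ucont_column i N.
    have [N3 N3P] := ucont_column 0 N2.
    exists (maxn N1 N3) => f g fg; apply: NP.
    - by apply: N1P; apply: agree_le fg; rewrite leq_maxl.
    - by apply: N2P; apply: N3P; apply: agree_le fg; rewrite leq_maxr.
  have pi (i : 'I_(size y)) : pana (fun f (_ : unit) => h (phi (s i f)).1 (phi (s i f)).2 = nth false y i).
    exact: (pana_subst (us i) (pana_borel cphi (h_borel (nth false y i)) _)).
  apply: pana_ext (pana_proj (pana_forall pi)) => f t; split.
  - move=> [g gP]; exists (phiT g); apply/allP => z /mapP[i]; rewrite mem_iota add0n => /andP[_ iy] ->.
    by have := gP (Ordinal iy); rewrite /phi /s /= !column0_join2 !column1_join2 => ->.
  - move=> [th /allP thP]; have [g gth] := phiT_surj th; exists g => i.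
    rewrite /phi /s /= !column0_join2 !column1_join2 gth.
    by apply/eqP; apply: (thP (_, _)); apply: map_f; rewrite mem_iota /=.
have /choice [K KP] := H.
exists (fun y i f g => K y i f g tt); split=> [y i f g|y f].
  have [_ lK _] := KP y; have [n nP] := lK i f g.
  by exists n => f' g' ff' gg'; rewrite (nP f' g').
by have [_ _ /(_ f tt)] := KP y.
Qed.

Let L := projT1 (cid consistent_code).
Let lL : forall y i, lc2 (L y i). Proof. by have [] := projT2 (cid consistent_code). Qed.
Let LP : forall y f, consistent (mkseq (fun i => (phiX (column f i), nth false y i)) (size y)) <->
    exists g, forall i, L y i f g.
Proof. by have [] := projT2 (cid consistent_code). Qed.

Local Notation node := (seq (seq bool) * nat)%type.
Local Notation coding := (node -> nat -> nat).

(* A coding stores at [(u, 0)] a witness for the consistency of the labelled branch [u] and at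
   [(u, i.+1)] the [i]-th point of the node [u]. *)
Definition branch (u : seq (seq bool)) : seq (node * bool) :=
  flatten (mkseq (fun k => mkseq (fun i => ((take k u, i.+1), nth false (nth [::] u k) i)) (b k)) (size u)).

Lemma branch_rcons u c : branch (rcons u c) =
  branch u ++ mkseq (fun i => ((u, i.+1), nth false c i)) (b (size u)).
Proof.
rewrite /branch size_rcons /mkseq -addn1 iotaD map_cat flatten_cat /= cats0 add0n.
congr (flatten _ ++ _).
  apply/eq_in_map => k; rewrite mem_iota add0n /= => ku.
  by apply: eq_map => i; rewrite -cats1 takel_cat ?(ltnW ku) // nth_cat ku.
by apply: eq_map => i; rewrite -cats1 take_size_cat // nth_cat ltnn subnn.
Qed.

Lemma mem_branch u e : e \in branch u -> (size e.1.1 < size u)%N /\ (0 < e.1.2)%N.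
Proof.
move=> /flattenP[s /mapP[k]]; rewrite mem_iota add0n /= => ku -> /mapP[i _ ->] /=.
by rewrite size_takel // ltnW.
Qed.

Definition labels u := [seq e.2 | e <- branch u].
Definition history (x : node -> X) u := [seq (x e.1, e.2) | e <- branch u].
Definition codes (G : coding) u := join (fun p =>
  if (p < size (branch u))%N then G (nth (([::], 0%N), false) (branch u) p).1 else fun=> 0%N).

Definition valid (G : coding) u := forall i, L (labels u) i (codes G u) (G (u, 0%N)).

Lemma historyE G u : history (phiX \o G) u =
  mkseq (fun i => (phiX (column (codes G u) i), nth false (labels u) i)) (size (labels u)).
Proof.
apply: (@eq_from_nth _ (point, false)) => [|i]; first by rewrite size_mkseq !size_map.
rewrite size_map => iu; rewrite nth_mkseq ?size_map //.
rewrite (nth_map (([::], 0%N), false)) // (nth_map (([::], 0%N), false)) //.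
by rewrite /codes column_join iu.
Qed.

Lemma valid_consistent G u : valid G u -> consistent (history (phiX \o G) u).
Proof. by move=> vG; rewrite historyE LP; exists (G (u, 0%N)). Qed.

(** The stage at which a coordinate is settled: the witness for [u] at stage [size u], the points of
    the node [u], chosen in the following round, one stage later. *)
Definition lev (a : node) := (size a.1 + (a.2 != 0%N))%N.

(** Coordinates of later stages are left free even when their codes are small, so that [w] commits
    itself to no choice before its round. *)
Definition approx (w : seq nat) (G : coding) := forall a j,
  (pickle (a, j) < size w)%N -> (lev a <= size w)%N -> nth 0%N w (pickle (a, j)) = G a j.

Definition feasible (w : seq nat) := exists G, approx w G /\
  forall u, (size u <= size w)%N -> valid G u.

(* The Kunen-Martin tree: finite approximations to codings of finite Littlestone-type trees. *)
Definition prec (w' w : seq nat) := [/\ size w' = (size w).+1, feasible w &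
  forall (a : node) (j : nat), (pickle (a, j) < size w)%N -> (lev a <= size w)%N ->
    nth 0%N w' (pickle (a, j)) = nth 0%N w (pickle (a, j))].

(** Along an infinite descent every coordinate is constant from [thr] on, which gives a limit coding
    [G]. Validity passes to [G] because [L] reads finitely many coordinates, and on these [G] agrees
    with a coding that makes some long node feasible. *)
Lemma prec_chain_tree (w : nat -> seq nat) : (forall n, prec (w n.+1) (w n)) -> has_tree.
Proof.
move=> wP; have sw n : size (w n) = (size (w 0%N) + n)%N.
  by elim: n => [|n IH]; [rewrite addn0|have [-> _ _] := wP n; rewrite IH addnS].
have nw n : (n <= size (w n))%N by rewrite sw leq_addl.
pose thr (a : node) (j : nat) := maxn (pickle (a, j)).+1 (lev a).
pose G : coding := fun a j => nth 0%N (w (thr a j)) (pickle (a, j)).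
have stable a j n : (thr a j <= n)%N -> nth 0%N (w n) (pickle (a, j)) = G a j.
  elim: n => [|n IH]; first by rewrite geq_max.
  rewrite leq_eqVlt => /orP[/eqP <- //|]; rewrite ltnS => tn.
  have [_ _ ->] := wP n; first exact: IH; apply: leq_trans (nw n); move: tn;
  by rewrite /thr geq_max => /andP[].
have /choice [Gn GnP] : forall n, exists G, approx (w n) G /\ forall u, (size u <= size (w n))%N -> valid G u.
  by move=> n; have [_ ? _] := wP n.
have GnE a j n : (thr a j <= n)%N -> Gn n a j = G a j.
  move=> tn; rewrite -(stable _ _ _ tn); have [ap _] := GnP n; rewrite ap //;
  by move: tn; rewrite /thr geq_max => /andP[h1 h2]; apply: leq_trans (nw n).
have vG u : valid G u.
  move=> i; have [m mP] := lL (labels u) i (codes G u) (G (u, 0%N)).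
  pose c q : nat := if unpickle q is Some p then
     thr (nth (([::], 0%N), false) (branch u) (p : nat * nat).1).1 p.2 else 0%N.
  pose N := (size u + \max_(q < m) c q + \max_(q < m) thr (u, 0%N) q)%N.
  rewrite -(mP (codes (Gn N) u) (Gn N (u, 0%N))).
  - have [_ vN] := GnP N; apply: vN; apply: leq_trans (nw N).
    by rewrite /N -addnA leq_addr.
  - move=> q qm; have : (c q <= N)%N.
      apply: leq_trans (@leq_bigmax _ (fun q : 'I_m => c q) (Ordinal qm)) _.
      by rewrite /N addnAC leq_addl.
    by rewrite /c /codes /join; case: unpickle => // p /GnE pE; case: ifP.
  - move=> q qm; rewrite GnE //; apply: leq_trans (@leq_bigmax _ (fun q : 'I_m => thr (u, 0%N) q) (Ordinal qm)) _.
    by rewrite /N leq_addl.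
exists (fun u i => phiX (G (u, i.+1))) => y n.
have [th /allP thP] := valid_consistent (vG (mkseq y n.+1)).
exists th => k i kn ib; apply/eqP; apply: (thP (_, _)).
apply/mapP; exists ((mkseq y k, i.+1), nth false (y k) i) => //.
pose u := mkseq y n.+1; have su : size u = n.+1 by rewrite size_mkseq.
apply/flattenP; exists (mkseq (fun i => ((take k u, i.+1), nth false (nth [::] u k) i)) (b k)).
  by apply/mapP; exists k => //; rewrite mem_iota -/u su.
apply/mapP; exists i; first by rewrite mem_iota.
rewrite nth_mkseq //; congr ((_, _), _).
by rewrite /u /mkseq -map_take take_iota (minn_idPl _) // ltnW.
Qed.

Hypothesis no_tree : ~ has_tree.

Lemma prec_wf : well_founded prec.
Proof.
move=> w0; apply: contrapT => nacc.
have step (w : {w | ~ Acc prec w}) : exists w' : {w | ~ Acc prec w}, prec (projT1 w') (projT1 w).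
  case: w => w /= nw; apply: contrapT => no; apply: nw; constructor => w' ww'.
  by apply: contrapT => nw'; apply: no; exists (exist _ w' nw').
have /choice [f fP] := step.
apply: no_tree; apply: (@prec_chain_tree (fun n => projT1 (iter n f (exist _ w0 nacc)))).
by move=> n /=; exact: fP.
Qed.

(* From the position [v], reached after [k] rounds, the adversary can go on choosing points for as long
   as the counter [w] can be decreased. *)
Inductive alive : nat -> seq nat -> seq (X * bool) -> Prop :=
  Alive k w v xs : consistent v ->
    (forall c w', prec w' w -> alive k.+1 w' (v ++ block k xs c)) -> alive k w v.

Lemma aliveE k w v : alive k w v <-> consistent v /\
  exists xs, forall c w', prec w' w -> alive k.+1 w' (v ++ block k xs c).
Proof.
split; first by case=> {}k {}w {}v xs cv vP; split=> //; exists xs.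
by move=> [cv [xs vP]]; exact: Alive vP.
Qed.

Lemma history_rcons x u c :
  history x (rcons u c) = history x u ++ block (size u) (fun i => x (u, i.+1)) c.
Proof.
rewrite /history branch_rcons map_cat; congr (_ ++ _).
by rewrite /block /mkseq -map_comp.
Qed.

Lemma prec_approx w (G G' : coding) : approx w G -> (forall u, (size u <= size w)%N -> valid G u) ->
  (forall a, (lev a <= size w)%N -> G' a = G a) ->
  exists w', prec w' w /\ approx w' G'.
Proof.
move=> aG vG GG'.
pose val q := if @unpickle (node * nat)%type q is Some p then G' p.1 p.2 else 0%N.
exists (mkseq val (size w).+1); split.
- split; [by rewrite size_mkseq|by exists G|].
  move=> a j pw lw; rewrite nth_mkseq; last exact: ltnW.
  by rewrite /val pickleK /= GG' // aG.
- by move=> a j; rewrite size_mkseq => pw _; rewrite nth_mkseq // /val pickleK.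
Qed.

(** If all positions reached after [size w] rounds are alive at [w], the next points of the
    adversary and new witnesses of consistency extend the coding by one stage. This gives a node
    below [w] with the same property, which induction along [prec] excludes. *)
Lemma no_alive_approx w G : approx w G -> (forall u, (size u <= size w)%N -> valid G u) ->
  (forall u, size u = size w -> alive (size w) w (history (phiX \o G) u)) -> False.
Proof.
elim/(well_founded_ind prec_wf): w G => w IH G aG vG alG; set n := size w in alG.
have /choice [xs xsP] : forall u, exists xs, size u = n -> forall c w', prec w' w ->
    alive n.+1 w' (history (phiX \o G) u ++ block n xs c).
  move=> u; have [/alG/aliveE[_ [xs xsP]]|?] := pselect (size u = n); first by exists xs.
  by exists (fun=> point).
have /choice [fx fxP] : forall p : seq (seq bool) * nat, exists f, phiX f = xs p.1 p.2.
  by move=> p; exact: phiX_surj.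
pose G1 : coding := fun a => if (size a.1 == n) && (a.2 != 0%N) then fx (a.1, a.2.-1) else G a.
have G1G a : (lev a <= n)%N -> G1 a = G a.
  rewrite /lev /G1; have [->|] //= := eqVneq (size a.1) n.
  by case: (a.2 != 0%N) => //=; rewrite addn1 ltnn.
have hist1 (G' : coding) u : (forall a, a.2 != 0%N -> (size a.1 <= n)%N -> G' a = G1 a) ->
   size u = n -> forall c, history (phiX \o G') (rcons u c) = history (phiX \o G) u ++ block n (xs u) c.
  move=> GG1 un c; rewrite history_rcons un; congr (_ ++ _).
    apply/eq_in_map => e /mem_branch []; rewrite un => e1 e2; rewrite /= GG1 -?lt0n //; last exact: ltnW.
    by rewrite G1G // /lev -lt0n e2 addn1.
  apply: eq_map => i; rewrite /= GG1 ?un //.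
  by rewrite /G1 /= un eqxx fxP.
(* Some counter below [w] is required to learn that the new positions are consistent; only then do
   the witnesses stored in [G2] exist. *)
have [w1 [w1w _]] := prec_approx aG vG G1G.
have cons1 u : size u = n.+1 -> consistent (history (phiX \o G1) u).
  case/lastP: u => // u c; rewrite size_rcons => -[un].
  by rewrite hist1 //; have /aliveE [] := xsP u un c _ w1w.
have /choice [g gP] : forall u, exists g, size u = n.+1 -> forall i, L (labels u) i (codes G1 u) g.
  move=> u; have [/cons1|?] := pselect (size u = n.+1); last by exists (fun=> 0%N).
  by rewrite historyE LP => -[g gP]; exists g.
pose G2 : coding := fun a => if (size a.1 == n.+1) && (a.2 == 0%N) then g a.1 else G1 a.
have G2G1 a : a.2 != 0%N -> G2 a = G1 a by rewrite /G2 => /negbTE ->; rewrite andbF.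
have G2G a : (lev a <= n)%N -> G2 a = G a.
  move=> la; rewrite /G2; case: eqP => [an|_] /=; last exact: G1G.
  by move: la; rewrite /lev an; case: (_ != _); rewrite ?addn1 ?addn0 ltnNge ?leqnSn ?leqnn.
have [w2 [w2w aG2]] := prec_approx aG vG G2G.
have sw2 : size w2 = n.+1 by have [] := w2w.
have codesE (G3 G4 : coding) u : (forall a, (size a.1 < size u)%N -> a.2 != 0%N -> G3 a = G4 a) ->
    codes G3 u = codes G4 u.
  move=> GG; rewrite /codes; congr join; apply/funext => p; case: ifP => // pu.
  by have /mem_branch [u1 u2] := mem_nth (([::], 0%N), false) pu; rewrite GG // -lt0n.
apply: (IH w2 w2w G2 aG2).
- move=> u; rewrite sw2 leq_eqVlt => /orP[/eqP un|]; last rewrite ltnS => un.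
  + move=> i; have := gP u un i; rewrite (codesE G2 G1).
    * by rewrite /G2 /= un eqxx.
    * by move=> a _; exact: G2G1.
  + have vu := vG u un; move=> i; have := vu i; rewrite (codesE G2 G).
    * by rewrite (G2G (u, 0%N)) // /lev /= addn0.
    * move=> a au _; apply: G2G; rewrite /lev; case: (_ != _); rewrite ?addn1 ?addn0.
      - exact: leq_trans un.
      - by apply: leq_trans un; exact: ltnW.
- move=> u; rewrite sw2; case/lastP: u => // u c; rewrite size_rcons => -[un].
  by rewrite hist1 //; [exact: xsP|move=> a a2 _; exact: G2G1].
Qed.

Lemma root_not_alive : ~ alive 0 [::] [::].
Proof.
move=> al; have [c0 _] := proj1 (aliveE _ _ _) al.
have [g gP] : exists g, forall i, L [::] i (codes (fun=> fun=> 0%N) [::]) g by apply/LP.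
apply: (@no_alive_approx [::] (fun=> g)) => //.
- by move=> u; rewrite leqn0 => /nilP -> i; exact: gP.
- by move=> u /eqP /nilP ->.
Qed.

(** Comparison of the ordinal ranks in the well-founded tree, expressed as a simulation. *)
Inductive rank_le : seq nat -> seq nat -> Prop :=
  RankLe w w' : (forall u, prec u w -> exists2 u', prec u' w' & rank_le u u') -> rank_le w w'.

Lemma rank_leE w w' : rank_le w w' <->
  forall u, prec u w -> exists2 u', prec u' w' & rank_le u u'.
Proof. by split; [case|exact: RankLe]. Qed.

Lemma rank_le_total w w' : ~ rank_le w w' -> exists2 u, prec u w & rank_le w' u.
Proof.
elim/(well_founded_ind prec_wf): w w' => w IH w' nw.
have [u uw uP] : exists2 u, prec u w & forall u', prec u' w' -> ~ rank_le u u'.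
  apply: contrapT => no; apply: nw; apply/rank_leE => u uw.
  apply: contrapT => no'; apply: no; exists u => // u' uw' uu'; apply: no'.
  by exists u'.
exists u => //; apply/rank_leE => u' u'w'; exact: (IH u uw u' (uP u' u'w')).
Qed.

Lemma alive_mono w w' k v : rank_le w w' -> alive k w' v -> alive k w v.
Proof.
elim/(well_founded_ind prec_wf): w w' k v => w IH w' k v /rank_leE ww' /aliveE [cv [xs xsP]].
apply/aliveE; split=> //; exists xs => c u uw; have [u' u'w' uu'] := ww' u uw.
by apply: (IH u uw u') => //; exact: xsP.
Qed.

(** A position that survives [w''] but not [w] shows that [w''] has smaller rank than [w], hence at
    most the rank of some [u] below [w]. *)
Lemma alive_compare w w'' k v : alive k w'' v -> ~ alive k w v ->
  exists2 u, prec u w & forall k v, alive k u v -> alive k w'' v.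
Proof.
move=> av nav; have [u uw w''u] : exists2 u, prec u w & rank_le w'' u.
  by apply: rank_le_total => ww''; apply: nav; exact: alive_mono av.
by exists u => // k' v'; exact: alive_mono.
Qed.

(** If optimal labels left every counter below [w] alive, so would all labels, and the block [xs]
    would keep [v] alive at [w]. *)
Lemma bestP k v xs c w : consistent v -> ~ alive k w v -> optimal_labels b alive k v xs c ->
  exists2 w', prec w' w & ~ alive k.+1 w' (v ++ block k xs c).
Proof.
move=> cv nav bc; apply: contrapT => no; apply: nav; apply/aliveE; split=> //; exists xs => c' w' w'w.
apply: contrapT => nal; apply: no; exists w' => //; apply: bc; by exists c'.
Qed.

(** Take a [prec]-minimal counter [w] that some labels [c] defeat. A counter surviving [c] has rank
    at most that of some [u] below [w], so labels that defeat it would defeat [u], against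
    minimality. *)
Lemma best_exists k v xs : exists c, optimal_labels b alive k v xs c.
Proof.
have [|no] := pselect (exists w c, ~ alive k.+1 w (v ++ block k xs c)); last first.
  by exists [::] => w [c nal]; exfalso; apply: no; exists w, c.
move=> [w]; elim/(well_founded_ind prec_wf): w => w IH [c nal].
have [[u uw [c' nal']]|min] := pselect (exists2 u, prec u w & exists c, ~ alive k.+1 u (v ++ block k xs c)).
  by apply: (IH u uw); exists c'.
exists c => w' [c' nal'] al.
have [u uw uw'] := alive_compare al nal.
by apply: min; exists u => //; exists c' => /uw'.
Qed.

Lemma coded_X : @coded _ (BorelT X) phiX. Proof. exact: coded_borel. Qed.

Lemma consistent_ana n : ana [set t : n.-tuple (ZT X) | consistent t].
Proof.
pose Q (i : 'I_n) f (t : n.-tuple (ZT X)) := exists c, h (phiT f) (tnth t i).1 = c /\ (tnth t i).2 = c.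
have pQ i : pana (Q i).
  apply: pana_exists => c; apply: pana_and.
  - have mF : measurable_fun setT (fun t : n.-tuple (ZT X) => (tnth t i).1).
      exact: (measurableT_comp measurable_fst (measurable_tnth i)).
    exact: (pana_preimage mF (pana_borel_prod phiT_cont (h_borel c))).
  - apply: pana_cst.
    have mF : measurable_fun setT (fun t : n.-tuple (ZT X) => (tnth t i).2).
      exact: (measurableT_comp measurable_snd (measurable_tnth i)).
    by rewrite -[X in measurable X]setTI; exact: (mF measurableT [set c]).
apply: pana_ext (pana_proj (pana_subst (ucont_column 1) (pana_forall pQ))) => f t.
split=> [[g gP]|[th /all_tnthP thP]].
- exists (phiT g); apply/all_tnthP => i; have [c] := gP i.
  by rewrite column1_join2 => -[-> ->].
- have [g gth] := phiT_surj th; exists g => i; rewrite column1_join2.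
  by exists (tnth t i).2; split=> //; rewrite gth; exact/eqP/thP.
Qed.

Definition extend k (c : seq bool) (p : (hsize k).-tuple (ZT X) * (b k).-tuple (BorelT X)) :
    (hsize k.+1).-tuple (ZT X) :=
  [tuple of p.1 ++ [tuple (tnth p.2 i, nth false c i) | i < b k]].

Lemma measurable_extend k c : measurable_fun setT (extend (k := k) c).
Proof.
apply/measurable_fun_tnthP => i; case: (split_ordP (i : 'I_(hsize k + b k))) => j ->.
- apply: (eq_measurable_fun (fun p => tnth p.1 j)).
    by move=> p _; rewrite /= /extend tnth_lshift.
  exact: (measurableT_comp (measurable_tnth j) measurable_fst).
- apply: (eq_measurable_fun (fun p => (tnth p.2 j, nth false c j))).
    by move=> p _; rewrite /= /extend tnth_rshift tnth_mktuple.
  apply: measurable_fun_pair; last exact: measurable_cst.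
  exact: (measurableT_comp (measurable_tnth j) measurable_snd).
Qed.

Lemma extendE k c t (y : (b k).-tuple (BorelT X)) :
  extend c (t, y) = t ++ block k (fun i => nth point y i) c :> seq (X * bool).
Proof.
rewrite /extend /=; congr (_ ++ _); apply: (@eq_from_nth _ (point, false)).
  by rewrite size_mkseq size_map size_enum_ord.
move=> i; rewrite size_map size_enum_ord => ib; rewrite nth_mkseq //.
by rewrite (nth_map (Ordinal ib)) ?size_enum_ord // (tnth_nth point) nth_enum_ord.
Qed.

(** Induction along [prec]: labels and counters range over countable types, and the block is a tuple
    of coded points, along which one projects. *)
Lemma alive_ana k w : ana [set t : (hsize k).-tuple (ZT X) | alive k w t].
Proof.
elim/(well_founded_ind prec_wf): w k => w IH k.
pose A (p : seq bool * seq nat) : set ((hsize k).-tuple (ZT X) * (b k).-tuple (BorelT X)) :=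
  [set z | prec p.2 w -> alive k.+1 p.2 (extend p.1 z)].
have aA p : ana (A p).
  have [pw|npw] := pselect (prec p.2 w).
  - rewrite (_ : A p = extend p.1 @^-1` [set t | alive k.+1 p.2 t]); last first.
      by apply/seteqP; split=> z; [move=> /(_ pw)|move=> az _].

    exact: (ana_preimage (measurable_extend p.1) (IH _ pw k.+1)).
  - rewrite (_ : A p = setT); last by apply/seteqP; split=> z // _ /npw.
    by apply: ana_measurable; exact: measurableT.
rewrite (_ : mkset _ = [set t : (hsize k).-tuple (ZT X) | consistent t] `&` [set t | exists y, forall p, A p (t, y)]).
  apply: ana_and; first exact: consistent_ana.
  exact: (ana_exists (coded_tuple (b k) coded_X) (ana_forall aA)).
apply/seteqP; split=> t.
- move=> /aliveE [ct [xs xsP]]; split=> //; exists [tuple xs i | i < b k] => -[c w'] /= w'w.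
  rewrite extendE (_ : block k _ c = block k xs c); first exact: xsP.
  apply/eq_in_map => i; rewrite mem_iota add0n => /andP[_ ib].
  by rewrite -[X in nth _ _ X]/(val (Ordinal ib)) -tnth_nth tnth_mktuple.
- move=> [ct [y yP]]; apply/aliveE; split=> //; exists (fun i => nth point y i) => c w' w'w.
  by rewrite -extendE; exact: (yP (c, w')).
Qed.

Theorem rank_system : exists (prec : seq nat -> seq nat -> Prop)
    (alive : nat -> seq nat -> seq (X * bool) -> Prop),
  [/\ well_founded prec, ~ alive 0%N [::] [::],
     forall k w, ana [set t : (hsize k).-tuple (ZT X) | alive k w t],
     forall w w'' k v, alive k w'' v -> ~ alive k w v ->
       exists2 u, prec u w & forall k v, alive k u v -> alive k w'' v &
     forall k v xs, (exists c, optimal_labels b alive k v xs c) /\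
       forall c w, consistent v -> ~ alive k w v -> optimal_labels b alive k v xs c ->
         exists2 w', prec w' w & ~ alive k.+1 w' (v ++ block k xs c)].
Proof.
exists prec, alive; split; [exact: prec_wf|exact: root_not_alive|exact: alive_ana|exact: alive_compare|].
move=> k v xs; split; first exact: best_exists.
by move=> c w; exact: bestP.
Qed.

End Game.

(** * Powers of a probability *)

Section LowerIntegral.
Local Open Scope ereal_scope.
Context d (T : measurableType d) (R : realType).

(* The library integral of a nonnegative function is the supremum of the integrals of the simple
   functions below it, hence monotone without any measurability assumption. *)
Lemma le_integralT (mu : {measure set T -> \bar R}) (f g : T -> \bar R) :
  (forall x, 0 <= f x) -> (forall x, f x <= g x) -> \int[mu]_x f x <= \int[mu]_x g x.
Proof.
move=> f0 fg; have g0 x : 0 <= g x by exact: le_trans (fg x).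
rewrite !ge0_integralTE //; apply/ge_ereal_sup => _ [h /= hf <-]; apply: ereal_sup_ubound.
by exists h => //= x; exact: le_trans (fg x).
Qed.

End LowerIntegral.

Section Tuples.
Context d (T : measurableType d).

Definition totup n (s : seq T) : n.-tuple T := [tuple nth point s i | i < n].

Lemma totupK n (s : seq T) : size s = n -> totup n s = s :> seq T.
Proof.
move=> sn; apply: (@eq_from_nth _ point); first by rewrite size_tuple sn.
move=> i; rewrite size_tuple => ni.
by rewrite -[X in nth _ _ X]/(val (Ordinal ni)) -tnth_nth tnth_mktuple.
Qed.

Lemma measurable_totup d' (T' : measurableType d') (G : T' -> seq T) n :
  (forall i, (i < n)%N -> measurable_fun setT (fun x => nth point (G x) i)) ->
  measurable_fun setT (fun x => totup n (G x)).
Proof.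
move=> mG; apply/measurable_fun_tnthP => i.
apply: (eq_measurable_fun (fun x => nth point (G x) i)); last exact: mG.
by move=> x _ /=; rewrite tnth_mktuple.
Qed.

Lemma measurable_nth n i : measurable_fun setT (fun t : n.-tuple T => nth point t i).
Proof.
have [ni|ni] := ltnP i n.
  apply: (eq_measurable_fun (fun t => tnth t (Ordinal ni))); last exact: measurable_tnth.
  by move=> t _; rewrite (tnth_nth point).
apply: (eq_measurable_fun (fun=> point)); last exact: measurable_cst.
by move=> t _; rewrite nth_default // size_tuple.
Qed.

End Tuples.

Section ProductPower.
Local Open Scope ereal_scope.
Context d (T : measurableType d) (R : realType) (P : probability T R).

(** Working on sequences in place of tuples lets samples be split and concatenated without casts. *)
Fixpoint seqint (n : nat) (f : seq T -> \bar R) : \bar R :=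
  if n is n'.+1 then \int[P]_z seqint n' (fun t => f (z :: t)) else f [::].

Lemma seqint_ge0 n f : (forall s, 0 <= f s) -> 0 <= seqint n f.
Proof. by elim: n f => //= n IH f f0; apply: integral_ge0 => z _; exact: IH. Qed.

Lemma le_seqint n f g : (forall s, 0 <= f s) -> (forall s, size s = n -> f s <= g s) ->
  seqint n f <= seqint n g.
Proof.
elim: n f g => [|n IH] f g f0 fg /=; first exact: fg.
apply: le_integralT => z; first by apply: seqint_ge0.
by apply: IH => // s sn; apply: fg => /=; rewrite sn.
Qed.

Lemma eq_seqint n f g : (forall s, size s = n -> f s = g s) -> seqint n f = seqint n g.
Proof.
elim: n f g => [|n IH] f g fg /=; first exact: fg.
by apply: eq_integral => z _; apply: IH => s sn; apply: fg => /=; rewrite sn.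
Qed.

Lemma seqint_cat m n f : seqint (m + n) f = seqint m (fun s => seqint n (fun t => f (s ++ t))).
Proof. by elim: m f => //= m IH f; apply: eq_integral => z _; rewrite IH. Qed.

Lemma seqint_cst n c : seqint n (fun=> c) = c.
Proof.
elim: n => //= n IH; under eq_integral do rewrite IH.
rewrite integral_cst; last exact: measurableT.
by rewrite [X in c * X](_ : _ = 1) ?mule1 //; exact: probability_setT.
Qed.

Lemma measurable_mcons n : measurable_fun setT (fun p : T * n.-tuple T => cons_tuple p.1 p.2).
Proof. exact: (measurable_cons measurable_fst measurable_snd). Qed.

Definition pcons n (Q : probability (n.-tuple T) R) : probability (n.+1.-tuple T) R :=
  @pushprob _ _ (T * n.-tuple T)%type (n.+1.-tuple T) R (P \x Q) _ (@measurable_mcons n).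

Fixpoint power n : probability (n.-tuple T) R :=
  if n is n'.+1 then pcons (power n') else dirac ([tuple] : 0.-tuple T).

Lemma seqint_power n (f : seq T -> \bar R) : (forall s, 0 <= f s) -> measurable_fun [set: n.-tuple T] (fun t => f t) ->
  seqint n f = \int[power n]_t f t.
Proof.
elim: n f => [|n IH] f f0 mf.
  by rewrite /= integral_dirac // diracE in_setT mul1e.
pose g := fun p : T * n.-tuple T => f (p.1 :: p.2).
have mg : measurable_fun setT g.
  exact: (measurableT_comp (f := fun t : n.+1.-tuple T => f t) mf (@measurable_mcons n)).
transitivity (\int[P \x power n]_p g p).
  rewrite fubini_tonelli1 //; last by move=> p; exact: f0.
  rewrite /=; apply: eq_integral => z _; rewrite IH //.
  exact: (measurable_fun_pair2 z mg).
by rewrite ge0_integral_pushforward //; exact: measurable_mcons.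
Qed.

Definition ind (B : set (seq T)) (s : seq T) : \bar R := (\1_B s)%:E.

Lemma ind_ge0 B s : 0 <= ind B s.
Proof. by rewrite lee_fin. Qed.

Lemma ind_in (B : set (seq T)) s : B s -> ind B s = 1.
Proof. by move=> Bs; rewrite /ind indicE mem_set. Qed.

Lemma ind_notin (B : set (seq T)) s : ~ B s -> ind B s = 0.
Proof. by move=> Bs; rewrite /ind indicE memNset. Qed.

Lemma measurable_ind n (B : set (seq T)) : measurable [set t : n.-tuple T | B t] ->
  measurable_fun setT (fun t : n.-tuple T => ind B t).
Proof. by move=> mB; apply/measurable_EFinP; exact: (measurable_indic mB). Qed.

Lemma power_seqint n (B : set (seq T)) : measurable [set t : n.-tuple T | B t] ->
  power n [set t | B t] = seqint n (ind B).
Proof.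
move=> mB; rewrite seqint_power; [|exact: ind_ge0|exact: measurable_ind].
by have := integral_indic (power n) measurableT mB; rewrite setIT => <-.
Qed.

Lemma totup_tuple n (t : n.-tuple T) : totup n t = t.
Proof. by apply/val_inj; rewrite /= totupK // size_tuple. Qed.

Lemma power_rect n (A : 'I_n -> set T) : (forall i, measurable (A i)) ->
  power n [set t | forall i, A i (tnth t i)] = \prod_(i < n) P (A i).
Proof.
elim: n A => [|n IH] A mA.
  rewrite big_ord0 /= (_ : mkset _ = setT) ?diracT //.
  by apply/seteqP; split=> // t _ [].
rewrite big_ord_recl /= -IH // -product_measure1E //; last first.
  rewrite (_ : mkset _ = [set t : n.-tuple T | forall i : 'I_n, ((fun t : n.-tuple T => tnth t i) @^-1` A (lift ord0 i)) t]) //.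
  apply: measurable_forall => i; rewrite -[X in measurable X]setTI.
  exact: (measurable_tnth i).
congr (_ _); apply/seteqP; split=> -[z t] /= h.
- by split=> [|i]; [have := h ord0|have := h (lift ord0 i); rewrite tnthS].
- by move=> i; case: (unliftP ord0 i) => [j ->|->]; [rewrite tnthS; exact: h.2|exact: h.1].
Qed.

Definition rects n : set (set (n.-tuple T)) :=
  [set B | exists A : 'I_n -> set T, (forall i, measurable (A i)) /\
     B = [set t | forall i, A i (tnth t i)]].

Lemma measurable_rects n : @measurable _ (n.-tuple T) = <<s @rects n >>.
Proof.
apply/seteqP; split.
- apply: smallest_sub; first exact: smallest_sigma_algebra.
  rewrite -bigcup_seq => _ [i _ [A mA <-]]; apply: sub_sigma_algebra.
  exists (fun j => if j == i then A else setT); split; first by move=> j; case: ifP.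
  apply/seteqP; split=> t /=; first by move=> [_ Ai] j; case: eqP => // ->.
  by move=> h; split=> //; have := h i; rewrite eqxx.
- apply: smallest_sub; first exact: sigma_algebra_measurable.
  move=> _ [A [mA ->]].
  rewrite (_ : mkset _ = [set t : n.-tuple T | forall i : 'I_n, ((fun t : n.-tuple T => tnth t i) @^-1` A i) t]) //.
  apply: measurable_forall => i; rewrite -[X in measurable X]setTI.
  exact: (measurable_tnth i).
Qed.

Definition retuple n m (s : 'I_m -> 'I_n) (t : n.-tuple T) : m.-tuple T :=
  [tuple tnth t (s i) | i < m].

Lemma measurable_retuple n m (s : 'I_m -> 'I_n) : measurable_fun setT (retuple s).
Proof.
apply/measurable_fun_tnthP => i.
apply: (eq_measurable_fun (fun t : n.-tuple T => tnth t (s i))); last exact: measurable_tnth.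
by move=> t _; rewrite /= tnth_mktuple.
Qed.

(** The two measures agree on rectangles, coordinates outside the image of [s] contributing factors
    1. Slices, transpositions and choices of [b k] points of the sample are all of this form. *)
Lemma power_retuple n m (s : 'I_m -> 'I_n) (B : set (m.-tuple T)) : injective s ->
  measurable B -> power n (retuple s @^-1` B) = power m B.
Proof.
move=> si mB.
pose Q := pushprob (power n) (measurable_retuple s).
apply: (@measure_unique _ R (m.-tuple T) (@rects m) (fun=> setT) _ _ _ _ Q (power m)) => //.
- exact: measurable_rects.
- move=> _ _ [A [mA ->]] [A' [mA' ->]]; exists (fun i => A i `&` A' i); split.
    by move=> i; exact: measurableI.
  by apply/seteqP; split=> t; [move=> [h h'] i; split|move=> h; split=> i; have [] := h i].
- by move=> _; exists (fun=> setT); split=> //; apply/seteqP; split.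
- by rewrite bigcup_const.
- move=> _ [A [mA ->]]; transitivity (\prod_(i < m) P (A i)); last exact/esym/power_rect.
  pose A' (j : 'I_n) := if [pick i | s i == j] is Some i then A i else setT.
  have A's i : A' (s i) = A i.
    rewrite /A'; case: pickP => [i' /eqP /si -> //|/(_ i)]; by rewrite eqxx.
  have mA' j : measurable (A' j) by rewrite /A'; case: pickP.
  transitivity (power n [set t | forall j, A' j (tnth t j)]).
    congr (power n _); apply/seteqP; split=> t /= h.
    + move=> j; rewrite /A'; case: pickP => // i /eqP <-.
      by have := h i; rewrite tnth_mktuple.
    + by move=> i; rewrite tnth_mktuple -A's.
  rewrite power_rect // (bigID (fun j => j \in codom s)) /=.
  rewrite [X in _ * X]big1 ?mule1; last first.
    move=> j js; rewrite /A'; case: pickP => [i /eqP ij|_]; last exact: probability_setT.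
    by rewrite -ij codom_f in js.
  transitivity (\prod_(i < m) P (A' (s i))); last by apply: eq_bigr => i _; rewrite A's.
  rewrite (eq_bigl (mem [set s i | i in 'I_m])%SET); last first.
    by move=> j; rewrite inE; apply/codomP/imsetP => [[i ->]|[i _ ->]]; exists i.
  by rewrite big_imset //= => i i' _ _; exact: si.
- have Q1 : Q [set: m.-tuple T] = 1 by exact: probability_setT.
  by move=> _; exact: (@eq_ind_r _ 1 (fun x => x < +oo) (ltry 1) _ Q1).
Qed.

Lemma measurable_setseq d' (T' : measurableType d') (G : T' -> seq T) n (B : set (n.-tuple T)) :
  (forall i, (i < n)%N -> measurable_fun setT (fun x => nth point (G x) i)) ->
  measurable B -> measurable [set x | B (totup n (G x))].
Proof. by move=> mG mB; rewrite -[X in measurable X]setTI; apply: (measurable_totup mG). Qed.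

Definition slice o m (s : seq T) : m.-tuple T := totup m (drop o s).

Lemma measurable_slice n o m (B : set (m.-tuple T)) : measurable B ->
  measurable [set t : n.-tuple T | B (slice o m t)].
Proof.
apply: measurable_setseq => i im.
apply: (eq_measurable_fun (fun t : n.-tuple T => nth point t (o + i))); last exact: measurable_nth.
by move=> t _; rewrite nth_drop.
Qed.

Lemma power_slice n o m (B : set (m.-tuple T)) : (o + m <= n)%N -> measurable B ->
  power n [set t | B (slice o m t)] = power m B.
Proof.
move=> omn mB; have oi (i : 'I_m) : (o + i < n)%N.
  by apply: leq_trans omn; rewrite ltn_add2l.
pose s (i : 'I_m) := Ordinal (oi i).
rewrite -(@power_retuple n m s) //; last by move=> i j [] /addnI /val_inj.
congr (power n _); apply/seteqP; split=> t /=;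
  rewrite (_ : slice o m t = retuple s t) //; apply: eq_from_tnth => i;
  by rewrite !tnth_mktuple (tnth_nth point) /= nth_drop.
Qed.

(** The stride is [K.+1] so that the empty history, [K = 0], needs no separate treatment when pieces
    are counted by division. *)
Definition missed q K (G : set (K.-tuple T)) :=
  [set s | forall j, (j < q)%N -> ~ G (slice (j * K.+1) K s)].

Lemma measurable_missed n q K (G : set (K.-tuple T)) : measurable G ->
  measurable [set t : n.-tuple T | missed q G t].
Proof.
move=> mG.
rewrite (_ : mkset _ = [set t : n.-tuple T | forall j : 'I_q, (~` [set t : n.-tuple T | G (slice (j * K.+1) K t)]) t]).
  by apply: measurable_forall => j; apply: measurableC; exact: measurable_slice.
apply/seteqP; split=> t h; first by move=> j; exact: h.
by move=> j jq; exact: (h (Ordinal jq)).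
Qed.

Lemma power_missed n q K (G : set (K.-tuple T)) (r : R) : (q * K.+1 <= n)%N ->
  measurable G -> power K (~` G) = r%:E ->
  power n [set t | missed q G t] = (r ^+ q)%:E.
Proof.
move=> qn mG rE; rewrite (power_seqint (measurable_missed _ mG)) -(subnKC qn).
move: (n - _)%N => m; have r0 : (0 <= r)%R.
  by rewrite -lee_fin -rE; exact: measure_ge0.
elim: q {n qn} => [|q IH].
  rewrite expr0; transitivity (seqint (0 * K.+1 + m) (fun=> 1)); last exact: seqint_cst.
  by apply: eq_seqint => s _; rewrite ind_in.
have -> : (q.+1 * K.+1 + m = K + (1 + (q * K.+1 + m)))%N by lia.
pose nG := [set v : seq T | (~` G) (totup K v)].
rewrite seqint_cat.
transitivity (seqint K (fun v => (r ^+ q)%:E * ind nG v)).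
  apply: eq_seqint => v vK; rewrite seqint_cat.
  transitivity (seqint 1 (fun=> (r ^+ q)%:E * ind nG v)); last exact: seqint_cst.
  apply: eq_seqint => z z1.
  have mE s : missed q.+1 G (v ++ (z ++ s)) <-> nG v /\ missed q G s.
    have E0 : slice (0 * K.+1) K (v ++ (z ++ s)) = totup K v.
      apply: eq_from_tnth => i; rewrite /slice mul0n drop0 !tnth_mktuple nth_cat vK.
      by rewrite ltn_ord.
    have ES j : slice (j.+1 * K.+1) K (v ++ (z ++ s)) = slice (j * K.+1) K s.
      congr totup; rewrite catA drop_cat size_cat vK z1 addn1 mulSn ltnNge leq_addr /=.
      by rewrite addKn.
    split=> [h|[nGv h] [|j]]; last by rewrite ltnS ES; exact: h.
      split=> [|j jq]; last by rewrite -ES; exact: h.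
      by rewrite /nG /= -E0; exact: h.
    by rewrite E0.
  have [nGv|Gv] := pselect (nG v); last first.
    rewrite [ind nG v]ind_notin //.
    rewrite mule0; transitivity (seqint (q * K.+1 + m) (fun=> 0)); last exact: seqint_cst.
    by apply: eq_seqint => s _; rewrite ind_notin // => /mE [].
  rewrite [ind nG v]ind_in // mule1 -IH; apply: eq_seqint => s _.
  have [ms|nms] := pselect (missed q G s); first by rewrite !ind_in //; apply/mE.
  by rewrite !ind_notin // => /mE [].
have nGE : [set t : K.-tuple T | nG t] = ~` G.
  by apply/seteqP; split=> t; rewrite /nG /= totup_tuple.
have mC : measurable [set t : K.-tuple T | nG t] by rewrite nGE; exact: measurableC.
rewrite seqint_power; first last.
- by apply: measurable_funeM; exact: measurable_ind.
- by move=> s; rewrite mule_ge0 ?ind_ge0 // lee_fin exprn_ge0.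
rewrite ge0_integralZl_EFin ?exprn_ge0 //; last 2 first.
- by move=> t _; exact: ind_ge0.
- exact: measurable_ind.
rewrite -(seqint_power (ind_ge0 _) (measurable_ind mC)) -(power_seqint mC).
rewrite (_ : power K _ = r%:E); first by rewrite -EFinM exprSr.
by rewrite -rE -nGE.
Qed.

End ProductPower.

(** * The learner *)

Section Algorithm.
Variables (R : realType) (X : ptopologicalType) (b : nat -> nat).
Variable alive : nat -> seq nat -> seq (X * bool) -> Prop.
Local Notation um := (univ_meas_set R).
Hypothesis alive_um : forall k w, um [set t : (hsize b k).-tuple (ZT X) | alive k w t].
Hypothesis best_exists : forall k v xs, exists c, optimal_labels b alive k v xs c.

Lemma strategy_ex k v xs :
  exists n, `[< exists2 c, pickle c = n & optimal_labels b alive k v xs c >].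
Proof.
by have [c oc] := best_exists k v xs; exists (pickle c); apply/asboolP; exists c.
Qed.

(** The least code singles out one optimal answer; as answers are countable in number, this
    selection is universally measurable. *)
Definition strategy k v xs : seq bool :=
  odflt [::] (unpickle (ex_minn (strategy_ex k v xs))).

Lemma strategyE k v xs c : strategy k v xs = c <->
  optimal_labels b alive k v xs c /\
  forall c', optimal_labels b alive k v xs c' -> (pickle c <= pickle c')%N.
Proof.
rewrite /strategy; case: ex_minnP => n /asboolP [c0 <- oc0] min; rewrite pickleK /=.
have {}min c' : optimal_labels b alive k v xs c' -> (pickle c0 <= pickle c')%N.
  by move=> oc'; apply: min; apply/asboolP; exists c'.
split=> [<-|[oc cmin]]; first by split.
by apply: (pcan_inj (@pickleK (seq bool))); apply/eqP; rewrite eqn_leq min // cmin.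
Qed.

Section Measurability.
Context d (T : measurableType d).

Definition mseq n (V : T -> seq (ZT X)) := (forall x, size (V x) = n) /\
  forall i, (i < n)%N -> measurable_fun setT (fun x => nth point (V x) i).

Lemma um_mseq n (V : T -> seq (ZT X)) (B : seq (X * bool) -> Prop) : mseq n V ->
  um [set t : n.-tuple (ZT X) | B t] -> um [set x | B (V x)].
Proof.
move=> [sV mV] uB; have -> : [set x | B (V x)] = (fun x => totup n (V x)) @^-1` [set t : n.-tuple (ZT X) | B t].
  by apply/seteqP; split=> x /=; rewrite totupK.
exact: um_preimage (measurable_totup mV) uB.
Qed.

Lemma mseq_cat m n V V' : mseq m V -> mseq n V' -> mseq (m + n) (fun x => V x ++ V' x).
Proof.
move=> [sV mV] [sV' mV']; split=> [x|i imn]; first by rewrite size_cat sV sV'.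
have [im|mi] := ltnP i m.
  apply: (eq_measurable_fun (fun x => nth point (V x) i)); last exact: mV.
  by move=> x _; rewrite nth_cat sV im.
apply: (eq_measurable_fun (fun x => nth point (V' x) (i - m))).
  by move=> x _; rewrite nth_cat sV ltnNge mi.
by apply: mV'; rewrite ltn_subLR.
Qed.

Lemma mseq_block k (xs : T -> nat -> X) c :
  (forall i, (i < b k)%N -> measurable_fun setT (fun x => xs x i : BorelT X)) ->
  mseq (b k) (fun x => block b k (xs x) c).
Proof.
move=> mxs; split=> [x|i ib]; first by rewrite size_mkseq.
apply: (eq_measurable_fun (fun x => (xs x i : BorelT X, nth false c i))).
  by move=> x _; rewrite nth_mkseq.
by apply: measurable_fun_pair; [exact: mxs|exact: measurable_cst].
Qed.

Variables (k : nat) (V : T -> seq (ZT X)) (xs : T -> nat -> X).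
Hypothesis mV : mseq (hsize b k) V.
Hypothesis mxs : forall i, (i < b k)%N -> measurable_fun setT (fun x => xs x i : BorelT X).

Lemma um_optimal c : um [set x | optimal_labels b alive k (V x) (xs x) c].
Proof.
have ua w c' : um [set x | alive k.+1 w (V x ++ block b k (xs x) c')].
  refine (um_mseq (B := alive k.+1 w) (mseq_cat mV (mseq_block c' mxs)) (@alive_um k.+1 w)).
apply: um_forall => w; apply: um_imply; last exact: (um_setC (ua w c)).
by apply: um_exists => c'; exact: (um_setC (ua w c')).
Qed.

Lemma um_strategy c : um [set x | strategy k (V x) (xs x) = c].
Proof.
have -> : [set x | strategy k (V x) (xs x) = c] =
  [set x | optimal_labels b alive k (V x) (xs x) c] `&`
  [set x | forall c', optimal_labels b alive k (V x) (xs x) c' -> (pickle c <= pickle c')%N].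
  by apply/seteqP; split=> x /strategyE.
apply: um_setI; first exact: um_optimal.
by apply: um_forall => c'; apply: um_imply; [exact: um_optimal|exact: um_prop].
Qed.

End Measurability.

Definition pattern k v (xs : 'I_(b k) -> X) : seq bool :=
  strategy k v (fun a => if insub a is Some a' then xs a' else point).

(** All injections are considered, not only increasing ones; this makes the set equivariant under
    permutations of the positions. *)
Definition avoiders N k v (p : 'I_N.+1 -> X) : {set {ffun 'I_N.+1 -> bool}} :=
  [set u : {ffun 'I_N.+1 -> bool} | `[< forall i : {ffun 'I_(b k) -> 'I_N.+1}, injective i ->
     exists a, u (i a) <> nth false (pattern v (fun a => p (i a))) a >] ]%SET.

(* Candidate number [c] sits at level [c %/ n1.+1] of the game and occupies the sample positions from
   [(c %% n1.+1) * (hsize b k).+1] on, so that candidates are enumerated by increasing level. *)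
Definition level n1 c := (c %/ n1.+1)%N.
Definition position n1 c (s : seq (ZT X)) : (hsize b (level n1 c)).-tuple (ZT X) :=
  slice ((c %% n1.+1) * (hsize b (level n1 c)).+1) (hsize b (level n1 c)) s.
Definition candidates n1 := [seq c <- iota 0 (n1.+1 * n1.+1) |
  ((c %% n1.+1).+1 * (hsize b (level n1 c)).+1 <= n1)%N].

(** Strict comparison of ranks, certified by one counter [w] that separates the two positions. *)
Definition lower k v k' v' := exists w, ~ alive k w v /\ alive k' w v'.

Definition minimal n1 s c := forall c', c' \in candidates n1 ->
  ~ lower (level n1 c') (position n1 c' s) (level n1 c) (position n1 c s).

Definition selected n1 s := head 0%N [seq c <- candidates n1 | `[< minimal n1 s c >]].

(** The test point occupies the last position. Its unknown label reads as the default [false], which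
    does not matter by [predict_put]. *)
Definition learner n (s : seq (ZT X)) (x : X) : bool :=
  let c := selected n./2 s in
  predict (2 * (b (level n./2 c)).-1)
    (avoiders (N := n - n./2) (level n./2 c) (position n./2 c s)
      (fun i => nth point (rcons [seq z.1 | z <- drop n./2 s] x) i))
    [ffun i : 'I_(n - n./2).+1 => nth false [seq z.2 | z <- drop n./2 s] i] ord_max.

Lemma um_head d (T : measurableType d) (Q : nat -> T -> Prop) l c :
  (forall a, um (Q a)) -> um [set t | head 0%N [seq a <- l | `[< Q a t >]] = c].
Proof.
move=> uQ; elim: l => [|a l IH]; first exact: (@um_prop R _ T (0%N = c)).
rewrite (_ : mkset _ = (Q a `&` [set _ | a = c]) `|`
  (~` Q a `&` [set t | head 0%N [seq a <- l | `[< Q a t >]] = c])).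
  by apply: um_setU; apply: um_setI => //; [exact: um_prop|exact: um_setC].
apply/seteqP; split=> t /=; case: asboolP => Qa /=; [by left|by right|by case=> -[]|by case=> -[]].
Qed.

Section LearnerMeasurability.
Variable n : nat.
Local Notation S := (SampleT X n).

Lemma measurable_sample i : measurable_fun setT (fun p : S => nth point p.1 i).
Proof. exact: (measurableT_comp (@measurable_nth _ (ZT X) n i) measurable_fst). Qed.

Lemma mseq_position n1 c : mseq (hsize b (level n1 c)) (fun p : S => position n1 c p.1).
Proof.
split=> [p|i ih]; first by rewrite size_tuple.
pose o := ((c %% n1.+1) * (hsize b (level n1 c)).+1)%N.
apply: (eq_measurable_fun (fun p : S => nth point p.1 (o + i))); last exact: measurable_sample.
move=> p _; transitivity (tnth (position n1 c p.1) (Ordinal ih)).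
  by rewrite tnth_mktuple nth_drop.
by rewrite (tnth_nth point).
Qed.

Lemma um_selected n1 c : um [set p : S | selected n1 p.1 = c].
Proof.
apply: um_head => a; apply: um_forall => c'.
apply: um_imply; first exact: um_prop.
apply: um_setC; apply: um_exists => w.
by apply: um_setI; [apply: um_setC|]; exact: (um_mseq (B := alive _ w) (mseq_position n1 _) (alive_um w)).
Qed.

Lemma measurable_test_point i : measurable_fun setT (fun p : S =>
  nth point (rcons [seq z.1 | z <- drop n./2 p.1] p.2) i : BorelT X).
Proof.
have sz (p : S) : size [seq z.1 | z <- drop n./2 p.1] = (n - n./2)%N.
  by rewrite size_map size_drop size_tuple.
have [iN|] := ltnP i (n - n./2).
  apply: (eq_measurable_fun (fun p : S => (nth point p.1 (n./2 + i)).1)).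
    move=> p _; rewrite nth_rcons sz iN (nth_map point) ?nth_drop //.
    by rewrite size_drop size_tuple.
  exact: (measurableT_comp measurable_fst (measurable_sample _)).
rewrite leq_eqVlt => /orP[/eqP <-|Ni].
  apply: (eq_measurable_fun (fun p : S => p.2)); last exact: measurable_snd.
  by move=> p _; rewrite nth_rcons sz ltnn eqxx.
apply: (eq_measurable_fun (fun p : S => point : BorelT X)); last exact: measurable_cst.
by move=> p _; rewrite nth_rcons sz ltnNge (ltnW Ni) gtn_eqF.
Qed.

(** The selected candidate, the avoiding set and the observed labels take countably many values and
    determine the output, so it suffices to treat the events that fix these values. *)
Lemma um_learner : um [set p : S | learner n p.1 p.2 = true].
Proof.
set n1 := n./2; set N := (n - n1)%N.
pose pts (p : S) (i : 'I_N.+1) := nth point (rcons [seq z.1 | z <- drop n1 p.1] p.2) i.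
pose C c (p : S) := avoiders (N := N) (level n1 c) (position n1 c p.1) (pts p).
pose Y (p : S) : {ffun 'I_N.+1 -> bool} := [ffun i => nth false [seq z.2 | z <- drop n1 p.1] (i : 'I_N.+1)].
rewrite (_ : mkset _ = [set p : S | exists c, selected n1 p.1 = c /\
    predict (2 * (b (level n1 c)).-1) (C c p) (Y p) ord_max]); last first.
  by apply/seteqP; split=> p; [exists (selected n1 p.1)|move=> [c [<-]]].
apply: um_exists => c; apply: um_setI; first exact: um_selected.
apply: (@um_comp R _ S _ (fun p => (C c p, Y p)) (fun z => predict _ z.1 z.2 ord_max)) => -[C0 Y0].
rewrite (_ : mkset _ = [set p : S | C c p = C0] `&` [set p : S | Y p = Y0]); last first.
  by apply/seteqP; split=> p /=; [case=> -> ->|case=> -> ->].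
apply: um_setI; last first.
  apply: um_ffun => i; under eq_set do rewrite ffunE.
  have [iN|Ni] := ltnP i N.
    have mF : measurable_fun setT (fun p : S => (nth point p.1 (n1 + i)).2).
      exact: (measurableT_comp measurable_snd (measurable_sample _)).
    apply: um_measurable; rewrite -[X in measurable X]setTI.
    rewrite (_ : mkset _ = (fun p : S => (nth point p.1 (n1 + i)).2) @^-1` [set true]); first exact: mF.
    apply/seteqP; split=> p /=; rewrite (nth_map point) ?nth_drop //; by rewrite size_drop size_tuple.
  rewrite (_ : mkset _ = [set _ : S | False]); first exact: um_prop.
  by apply/seteqP; split=> p //=; rewrite nth_default // size_map size_drop size_tuple.
apply: um_finset => u; under eq_set do rewrite inE.
rewrite (_ : mkset _ = [set p : S | forall i : {ffun 'I_(b (level n1 c)) -> 'I_N.+1}, injective i ->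
    exists a, u (i a) <> nth false (pattern (position n1 c p.1) (fun a => pts p (i a))) a]); last first.
  by apply/seteqP; split=> p /asboolP.
apply: um_forall => i; apply: um_imply; first exact: um_prop.
apply: um_exists => a.
apply: (@um_comp R _ S _ (fun p => pattern (position n1 c p.1) (fun a => pts p (i a)))
                (fun s => u (i a) <> nth false s a)) => s.
apply: um_strategy; first exact: mseq_position.
move=> j jb; rewrite insubT /=; exact: measurable_test_point.
Qed.

End LearnerMeasurability.
End Algorithm.

(** * Negligible sets *)

Section Negligible.
Context d (T : measurableType d) (R : realType) (P : probability T R).

Lemma negligible0 (A : set T) : measurable A -> P A = 0%E -> P.-negligible A.
Proof. by move=> mA A0; apply/negligibleP. Qed.

Lemma um_negligible (A : set T) : univ_meas_set R A ->
  (forall B, measurable B -> B `<=` A -> P B = 0%E) -> P.-negligible A.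
Proof.
move=> uA A0; have [B1 [B2 [m1 m2 B1A AB2 P0]]] := uA P.
apply: (negligibleS AB2); apply/(negligibleP P m2)/eqP; rewrite eq_le measure_ge0 andbT.
have -> : B2 = B1 `|` (B2 `\` B1) by rewrite setDE setUIr setUv setIT setUidr //; exact: subset_trans AB2.
apply: le_trans (measureU2 _ m1 (measurableD m2 m1)) _.
have h1 : (P B1 <= 0)%E by rewrite A0.
have h2 : (P (B2 `\` B1) <= 0)%E by rewrite P0.
by rewrite -[leRHS]adde0; exact: leeD h1 h2.
Qed.

Lemma negligible_exists (I : countType) (A : I -> set T) :
  (forall i, P.-negligible (A i)) -> P.-negligible [set t | exists i, A i t].
Proof.
move=> nA; pose D n := if @unpickle I n is Some i then A i else set0.
apply: (@negligibleS _ _ _ P (\bigcup_n D n)).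
  by move=> t [i Ai]; exists (pickle i) => //; rewrite /D pickleK.
by apply: negligible_bigcup => n; rewrite /D; case: unpickle => // ; exact: negligible_set0.
Qed.

Lemma negligible_cover (A : set T) : P.-negligible A ->
  exists B, [/\ measurable B, P B = 0%E & A `<=` B].
Proof. by move=> [B [mB P0 AB]]; exists B. Qed.

Lemma not_negligible_inner (A : set T) : univ_meas_set R A -> ~ P.-negligible A ->
  exists B, [/\ measurable B, B `<=` A & P B != 0%E].
Proof.
move=> uA nA; apply: contrapT => no; apply: nA; apply: um_negligible => // B mB BA.
by apply: contrapT => /eqP PB; apply: no; exists B.
Qed.

End Negligible.

Section PowerFacts.
Context d (T : measurableType d) (R : realType) (P : probability T R).
Local Open Scope ereal_scope.

Lemma power_coord n (i : 'I_n) (E : set T) : measurable E ->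
  power P n [set t | E (tnth t i)] = P E.
Proof.
move=> mE; pose A (j : 'I_n) := if j == i then E else setT.
have mA j : measurable (A j) by rewrite /A; case: ifP.
rewrite (_ : mkset _ = [set t : n.-tuple T | forall j, A j (tnth t j)]).
  rewrite (power_rect P mA) (bigD1 i) //= /A eqxx big1 ?mule1 // => j /negbTE ->.
  exact: probability_setT.
apply/seteqP; split=> t; first by move=> Ei j; rewrite /A; case: eqP => // ->.
by move=> /(_ i); rewrite /A eqxx.
Qed.

Lemma negligible_retuple n m (s : 'I_m -> 'I_n) (A : set (m.-tuple T)) : injective s ->
  (power P m).-negligible A -> (power P n).-negligible (retuple s @^-1` A).
Proof.
move=> si /negligible_cover [B [mB B0 AB]].
apply: (@negligibleS _ _ _ _ (retuple s @^-1` B)); first by move=> t; exact: AB.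
apply: negligible0; last by rewrite power_retuple.
by rewrite -[X in measurable X]setTI; apply: measurable_retuple.
Qed.

Lemma negligible_slice n o m (A : set (m.-tuple T)) : (o + m <= n)%N ->
  (power P m).-negligible A -> (power P n).-negligible [set t | A (slice o m t)].
Proof.
move=> omn /negligible_cover [B [mB B0 AB]].
apply: (@negligibleS _ _ _ _ [set t : n.-tuple T | B (slice o m t)]); first by move=> t; exact: AB.
by apply: negligible0; [exact: measurable_slice|rewrite power_slice].
Qed.

(** By Tonelli the measures of the sections of a measurable null cover integrate to zero, hence
    vanish almost everywhere. *)
Lemma negligible_section m n (A : set ((m + n).-tuple T)) : (power P (m + n)).-negligible A ->
  (power P m).-negligible [set v : m.-tuple T |
    ~ (power P n).-negligible [set t : n.-tuple T | A [tuple of v ++ t]]].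
Proof.
move=> /negligible_cover [M [mM M0 AM]].
pose J := [set p : m.-tuple T * n.-tuple T | M (totup (m + n) (p.1 ++ p.2))].
have mJ : measurable J.
  apply: measurable_setseq => // i imn; have [im|mi] := ltnP i m.
    apply: (eq_measurable_fun (fun p : m.-tuple T * n.-tuple T => nth point p.1 i)).
      by move=> p _; rewrite nth_cat size_tuple im.
    exact: (measurableT_comp (@measurable_nth _ T m i) measurable_fst).
  apply: (eq_measurable_fun (fun p : m.-tuple T * n.-tuple T => nth point p.2 (i - m))).
    by move=> p _; rewrite nth_cat size_tuple ltnNge mi.
  exact: (measurableT_comp (@measurable_nth _ T n (i - m)) measurable_snd).
pose M' := [set s : seq T | M (totup (m + n) s)].
have M'E : [set t : (m + n).-tuple T | M' t] = M.
  by apply/seteqP; split=> t; rewrite /M' /= totup_tuple.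
have secE (v : m.-tuple T) : seqint P n (fun t => ind R M' (v ++ t)) = power P n (xsection J v).
  have E : xsection J v = [set t : n.-tuple T | M' (v ++ t)].
    by apply/seteqP; split=> t; rewrite /xsection /= inE.
  rewrite E -(@power_seqint _ _ _ _ _ [set t | M' (v ++ t)]) // -E.
  exact: measurable_xsection.
have mf : measurable_fun setT (power P n \o xsection J) by exact: measurable_fun_xsection.
have I0 : \int[power P m]_v (power P n \o xsection J) v = 0.
  rewrite -M0 -M'E power_seqint ?M'E // seqint_cat seqint_power.
  - by apply: eq_integral => v _; rewrite secE.
  - by move=> s; apply: seqint_ge0 => t; exact: ind_ge0.
  - by apply: (eq_measurable_fun (power P n \o xsection J)) => // v _; rewrite secE.
have [+ _] := @ae_eq_integral_abs _ _ _ (power P m) setT measurableT _ mf.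
move=> [|B [mB B0 fB]].
  by rewrite -[RHS]I0; apply: eq_integral => v _; rewrite gee0_abs.
exists B; split=> // v /= nv; apply: fB => /= h; apply: nv.
apply: (@negligibleS _ _ _ _ (xsection J v)).
  move=> t /AM Mt; rewrite /xsection /= inE /J /=.
  rewrite (_ : totup _ _ = [tuple of v ++ t]) //.
  by apply/val_inj; rewrite /= totupK // size_cat !size_tuple.
by apply: negligible0; [exact: measurable_xsection|exact: h].
Qed.

End PowerFacts.

(** * The error of the learner *)

Section OneInclusionRate.
Variables (R : realType) (X : ptopologicalType) (b : nat -> nat).
Variable alive : nat -> seq nat -> seq (X * bool) -> Prop.
Hypothesis alive_um : forall k w,
  univ_meas_set R [set t : (hsize b k).-tuple (ZT X) | alive k w t].
Hypothesis best_exists : forall k v xs, exists c, optimal_labels b alive k v xs c.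
Variables (k : nat) (v : (hsize b k).-tuple (ZT X)) (N : nat).
Hypothesis b_gt0 : (0 < b k)%N.
Local Notation pattern := (pattern best_exists (k := k)).
Local Notation avoiders := (avoiders best_exists (N := N) k v).
Local Notation sample := (N.+1.-tuple (ZT X)).

(** The labels of the block are those the strategy proposes, in which case the rank drops; from a
    position of minimal rank this is a null event. *)
Definition matches (t : (b k).-tuple (ZT X)) :=
  forall a, (tnth t a).2 = nth false (pattern v (fun a => (tnth t a).1)) a.

Definition points (t : sample) : 'I_N.+1 -> X := fun i => (tnth t i).1.
Definition labeling (t : sample) : {ffun 'I_N.+1 -> bool} := [ffun i => (tnth t i).2].

(** Shattering [b k] positions would realise the forbidden pattern on them. *)
Lemma avoiders_not_shatter (p : 'I_N.+1 -> X) (T : {set 'I_N.+1}) :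
  #|T| = (b k).-1.+1 -> ~ shatters (avoiders p) T.
Proof.
rewrite prednK // => cT sT.
have [i [i_inj iT]] : exists i : {ffun 'I_(b k) -> 'I_N.+1}, injective i /\ forall a, i a \in T.
  exists [ffun a => enum_val (cast_ord (esym cT) a)]; split=> [a a'|a].
    by rewrite !ffunE => /enum_val_inj /cast_ord_inj.
  by rewrite ffunE; exact: enum_valP.
pose s := pattern v (fun a => p (i a)).
have [u] := sT [ffun j => if [pick a | i a == j] is Some a then nth false s (a : 'I_(b k)) else false].
rewrite inE => /asboolP /(_ i i_inj) [a ua] ui; apply: ua; rewrite ui // ffunE.
by case: pickP => [a' /eqP /i_inj ->//|/(_ a)]; rewrite eqxx.
Qed.

Lemma avoiders_relabel (s : {perm 'I_N.+1}) (p : 'I_N.+1 -> X) u :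
  (relabel s u \in avoiders (p \o s)) = (u \in avoiders p).
Proof.
rewrite !inE; apply: asbool_equiv_eq; split=> H i i_inj.
- have [|a] := H [ffun a => (s^-1)%g (i a)].
    by move=> a a'; rewrite !ffunE => /perm_inj /i_inj.
  rewrite !ffunE permKV => ua; exists a; rewrite -[X in pattern _ X](_ : (fun a => (p \o s) ([ffun a => (s^-1)%g (i a)] a)) = _) //.
  by apply/funext => a'; rewrite /= ffunE permKV.
- have [|a] := H [ffun a => s (i a)].
    by move=> a a'; rewrite !ffunE => /perm_inj /i_inj.
  rewrite !ffunE => ua; exists a; rewrite ffunE -[X in pattern _ X](_ : (fun a => p ([ffun a => s (i a)] a)) = _) //.
  by apply/funext => a'; rewrite /= ffunE.
Qed.

Definition mistake (t : sample) (i : 'I_N.+1) :=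
  predict (2 * (b k).-1) (avoiders (points t)) (labeling t) i != labeling t i.

Lemma mistake_tperm t i : mistake (retuple (tperm i ord_max) t) ord_max = mistake t i.
Proof.
set s := tperm i ord_max.
have pE : points (retuple s t) = points t \o s by apply/funext => j; rewrite /points tnth_mktuple.
have lE : labeling (retuple s t) = relabel s (labeling t).
  by apply/ffunP => j; rewrite !ffunE tnth_mktuple.
rewrite /mistake pE lE (predict_relabel _ _ _ (perm_inj (s := s)) (avoiders_relabel s (points t))).
by rewrite ffunE /s tpermR.
Qed.

Lemma labeling_avoids t :
  ~ (exists i : {ffun 'I_(b k) -> 'I_N.+1}, injective i /\ matches (retuple i t)) ->
  labeling t \in avoiders (points t).
Proof.
move=> no; rewrite inE; apply/asboolP => i i_inj; apply: contrapT => h; apply: no.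
exists i; split=> // a; apply: contrapT => ua; apply: h; exists a; move: ua.
rewrite tnth_mktuple /labeling ffunE.
rewrite (_ : (fun a => (tnth (retuple i t) a).1) = (fun a => points t (i a))) //.
by apply/funext => a'; rewrite tnth_mktuple.
Qed.

Lemma mistakes_le t : labeling t \in avoiders (points t) ->
  (\sum_i mistake t i <= 2 * (b k).-1)%N.
Proof.
move=> tC; have := predict_errors (avoiders_not_shatter (p := points t)) tC.
apply: leq_trans; rewrite -sum1_card [leqRHS]big_mkcond; apply/eq_leq/eq_bigr => i _.
by rewrite inE /mistake; case: (_ != _).
Qed.

Lemma um_mistake : univ_meas_set R [set t : sample | mistake t ord_max].
Proof.
apply: (@um_comp R _ sample _ (fun t => (avoiders (points t), labeling t))
  (fun z => predict _ z.1 z.2 ord_max != z.2 ord_max)) => -[C0 Y0].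
rewrite (_ : mkset _ = [set t | avoiders (points t) = C0] `&` [set t | labeling t = Y0]); last first.
  by apply/seteqP; split=> t /=; [case=> -> ->|case=> -> ->].
apply: um_setI; last first.
  apply: um_ffun => i; under eq_set do rewrite ffunE.
  have mF : measurable_fun setT (fun t : sample => (tnth t i).2).
    exact: (measurableT_comp measurable_snd (measurable_tnth i)).
  by apply: um_measurable; rewrite -[X in measurable X]setTI; exact: (mF measurableT [set true]).
apply: um_finset => u; under eq_set do rewrite inE.
rewrite (_ : mkset _ = [set t | forall i : {ffun 'I_(b k) -> 'I_N.+1}, injective i ->
    exists a, u (i a) <> nth false (pattern v (fun a => points t (i a))) a]); last first.
  by apply/seteqP; split=> p /asboolP.
apply: um_forall => i; apply: um_imply; first exact: um_prop.
apply: um_exists => a.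
apply: (@um_comp R _ sample _ (fun t => pattern v (fun a => points t (i a)))
                (fun s => u (i a) <> nth false s a)) => s.
apply: um_strategy => //.
  by split=> [t|j jh]; [rewrite size_tuple|exact: measurable_cst].
by move=> j jb; rewrite insubT /=; exact: (measurableT_comp measurable_fst (measurable_tnth (i (Sub j jb)))).
Qed.

(* Exchangeability turns the probability of a mistake on the last point into the average over all positions
   of the indicators of mistakes, of which there are at most [2 * (b k).-1]. *)
Lemma one_inclusion_rate (P : probability (ZT X) R) :
  (power P (b k)).-negligible [set t | matches t] ->
  exists E, [/\ measurable E, [set t : sample | mistake t ord_max] `<=` E &
    (power P N.+1 E <= ((2 * (b k).-1)%:R / N.+1%:R)%:E)%E].
Proof.
move=> nm; have [B1 [E [mB1 mE B1m mistE P0]]] := um_mistake (power P N.+1).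
exists E; split=> //.
have nQ : (power P N.+1).-negligible [set t : sample |
    exists i : {ffun 'I_(b k) -> 'I_N.+1}, injective i /\ matches (retuple i t)].
  apply: negligible_exists => i; have [i_inj|ni] := pselect (injective i).
    apply: negligibleS (negligible_retuple i_inj nm).
    by move=> t [].
  by apply: negligibleS (negligible_set0 _) => t [].
have [Q [mQ Q0 nQQ]] := negligible_cover nQ.
have EB1 : power P N.+1 E = power P N.+1 B1.
  rewrite -[in LHS](setDUK (subset_trans B1m mistE)) measureU //.
  - by rewrite [X in (_ + X)%E](_ : _ = 0%E) // adde0.
  - exact: measurableD.
  - by rewrite setDIK.
pose B i := retuple (tperm i ord_max) @^-1` B1.
have mB i : measurable (B i) by rewrite -[X in measurable X]setTI; exact: measurable_retuple.
have PB i : power P N.+1 (B i) = power P N.+1 B1 by rewrite /B power_retuple //; exact: perm_inj.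
pose c : R := (2 * (b k).-1)%:R.
(* Off the null set [Q] at most [c] positions are mistaken; on [Q] the trivial bound [N.+1] costs
   nothing after integration. *)
have bound t : (\sum_(i < N.+1) (\1_(B i) t)%:E <= c%:E + N.+1%:R%:E * (\1_Q t)%:E :> \bar R)%E.
  rewrite sumEFin -EFinM -EFinD lee_fin.
  have [Qt|nQt] := pselect (Q t).
    rewrite indicE mem_set // mulr1; apply: ler_wpDl => //.
    apply: le_trans (_ : \sum_(i < N.+1) (1 : R) <= _); first by apply: ler_sum => i _; rewrite indicE; case: (_ \in _).
    by rewrite sumr_const card_ord.
  rewrite [\1_Q t]indicE memNset // mulr0 addr0 /c.
  have /labeling_avoids/mistakes_le : ~ (exists i : {ffun 'I_(b k) -> 'I_N.+1}, injective i /\ matches (retuple i t)).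
    by move=> /nQQ.
  rewrite -(ler_nat R); apply: le_trans; rewrite natr_sum; apply: ler_sum => i _.
  rewrite indicE; case: (boolP (t \in B i)) => // /set_mem /B1m /=.
  by rewrite mistake_tperm => ->.
have I1 : (\int[power P N.+1]_t (\sum_(i < N.+1) (\1_(B i) t)%:E) = N.+1%:R%:E * power P N.+1 B1)%E.
  rewrite ge0_integral_sum //; last first.
    by move=> i; apply/measurable_EFinP; exact: measurable_indic.
  under eq_bigr => i _ do rewrite integral_indic // setIT.
  rewrite (eq_bigr (fun=> power P N.+1 B1)); last by move=> i _; exact: PB.
  by rewrite sumr_const card_ord mule_natl.
have I2 : (\int[power P N.+1]_t (c%:E + N.+1%:R%:E * (\1_Q t)%:E) = c%:E)%E.
  have mQ1 : measurable_fun setT (fun t : sample => (\1_Q t)%:E : \bar R).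
    by apply/measurable_EFinP; exact: measurable_indic.
  rewrite ge0_integralD; [|exact: measurableT|by move=> t _; rewrite lee_fin /c|exact: measurable_cst|
    by move=> t _; rewrite mule_ge0 // lee_fin|exact: measurable_funeM].
  rewrite integral_cst // ge0_integralZl_EFin // integral_indic // setIT.
  rewrite [X in (_ + _ * X)%E](_ : _ = 0%E) // mule0 adde0.
  by rewrite [X in (_ * X)%E](_ : _ = 1%E) ?mule1 //; exact: probability_setT.
have := le_integralT (power P N.+1) (f := fun t => (\sum_(i < N.+1) (\1_(B i) t)%:E)%E) _ bound.
rewrite I1 I2 => /(_ _)/wrap[]; first by move=> t; exact: sume_ge0.
rewrite EB1 => h.
rewrite -(fineK (fin_num_measure (power P N.+1) B1 mB1)) in h *.
by move: h; rewrite -EFinM !lee_fin ler_pdivlMr // mulrC.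
Qed.

End OneInclusionRate.

(** * The selected position and the expected error *)

Section UpperBound.
Variables (R : realType) (X : ptopologicalType) (Theta : topologicalType) (h : Theta -> X -> bool).
Variable b : nat -> nat.
Variables (prec : seq nat -> seq nat -> Prop) (alive : nat -> seq nat -> seq (X * bool) -> Prop).
Hypothesis b_gt0 : forall k, (0 < b k)%N.
Hypothesis alive_um : forall k w,
  univ_meas_set R [set t : (hsize b k).-tuple (ZT X) | alive k w t].
Hypothesis best_exists : forall k v xs, exists c, optimal_labels b alive k v xs c.
Hypothesis consistent_um : forall n,
  univ_meas_set R [set t : n.-tuple (ZT X) | consistent h t].
Hypothesis h_measurable : forall th, measurable ([set x | h th x] : set (BorelT X)).
Hypothesis prec_wf : well_founded prec.
Hypothesis root_dead : ~ alive 0 [::] [::].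
Hypothesis alive_compare : forall w w'' k v, alive k w'' v -> ~ alive k w v ->
  exists2 u, prec u w & forall k v, alive k u v -> alive k w'' v.
Hypothesis best_descends : forall k v xs c w, consistent h v -> ~ alive k w v ->
  optimal_labels b alive k v xs c ->
  exists2 w', prec w' w & ~ alive k.+1 w' (v ++ block b k xs c).
Variable P : probability (ZT X) R.
Hypothesis P_realizable : realizable [set h th | th in [set: Theta]] P.

Local Notation matches := (matches best_exists).

Lemma er_measure th : er P (h th) = P [set z | h th z.1 != z.2] /\
  measurable ([set z | h th z.1 != z.2] : set (ZT X)).
Proof.
have mh : measurable ([set z | h th z.1 != z.2] : set (ZT X)).
  rewrite (_ : mkset _ = ([set x | h th x] `*` [set false]) `|` (~` [set x | h th x] `*` [set true])).
    by apply: measurableU; apply: measurableX => //; exact: measurableC.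
  apply/seteqP; split=> -[x y] /=; case: (h th x); case: y => //=; try (by left); try (by right);
  by case=> -[].
split=> //; rewrite /er -[RHS](_ : (\int[P]_z (\1_[set z | h th z.1 != z.2] z)%:E = _)%E).
  by apply: eq_integral => z _; rewrite indicE; case: ifPn => hz; [rewrite mem_set|rewrite memNset //; exact/negP].
by rewrite integral_indic // setIT.
Qed.

(** The infimum in realizability need not be attained, but some hypothesis has error below
    [e / n.+1], and a union bound over the [n] points leaves at most [e]. *)
Lemma inconsistent_negligible n :
  (power P n).-negligible [set t : n.-tuple (ZT X) | ~ consistent h t].
Proof.
apply: um_negligible => [|B mB Bc]; first exact: (um_setC (@consistent_um n)).
apply/eqP; rewrite eq_le measure_ge0 andbT.
apply/lee_addgt0Pr => e e0; rewrite add0e.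
have e'0 : 0 < e / n.+1%:R by rewrite divr_gt0.
have [_ [_ [th _ <-] <-]] : exists2 y, [set er P h0 | h0 in [set h th | th in [set: Theta]]] y & (y < (e / n.+1%:R)%:E)%E.
  by apply: ereal_inf_lt; rewrite P_realizable lte_fin.
have [-> mE] := er_measure th; set E := [set z | _ ] in mE * => PE.
pose F i := [set t : n.-tuple (ZT X) | E (nth point t i)].
have FE (i : 'I_n) : F i = [set t | E (tnth t i)].
  by apply/seteqP; split=> t; rewrite /F /= (tnth_nth point).
have mF i : (i < n)%N -> measurable (F i).
  move=> ni; rewrite (FE (Ordinal ni)) -[X in measurable X]setTI.
  exact: (measurable_tnth (Ordinal ni) measurableT mE).
have BU : B `<=` \big[setU/set0]_(i < n) F i.
  move=> t /Bc nc; rewrite -bigcup_seq; apply: contrapT => no; apply: nc; exists th.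
  apply/all_tnthP => i; apply: contrapT => /negP hi; apply: no; exists i => /=.
    by rewrite mem_index_enum.
  by rewrite FE.
apply: le_trans (@content_subadditive _ _ _ (power P n) B F n mF mB BU) _.
rewrite (eq_bigr (fun=> P E)); last by move=> i _; rewrite FE; exact: power_coord.
have -> : (\sum_(i < n) P E = n%:R%:E * P E)%E by rewrite sumr_const card_ord mule_natl.
apply: le_trans (_ : n%:R%:E * (e / n.+1%:R)%:E <= _)%E.
  by rewrite lee_wpmul2l ?lee_fin // ltW.
rewrite -EFinM lee_fin mulrA ler_pdivrMr // mulrC ler_wpM2l ?ler_nat //.
exact: ltW.
Qed.

Definition dead k w := [set t : (hsize b k).-tuple (ZT X) | ~ alive k w t].
Arguments dead : clear implicits.

Lemma um_dead k w : univ_meas_set R (dead k w).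
Proof. exact: (um_setC (@alive_um k w)). Qed.

Lemma minimal_rank : exists w k, [/\ ~ (power P (hsize b k)).-negligible (dead k w),
  forall w' k', prec w' w -> (power P (hsize b k')).-negligible (dead k' w') &
  forall k', (k' < k)%N -> (power P (hsize b k')).-negligible (dead k' w)].
Proof.
have [w [[k0 posk0] wmin]] : exists w, (exists k, ~ (power P (hsize b k)).-negligible (dead k w)) /\
    forall w', prec w' w -> forall k, (power P (hsize b k)).-negligible (dead k w').
  (* The law of the empty sample is a Dirac mass and the empty position is dead at [[::]], so the
     descent has a starting point. *)
  have pos0 : exists k, ~ (power P (hsize b k)).-negligible (dead k [::]).
    exists 0%N => /= -[B [mB B0 dB]].
    have BT : B = setT by apply/seteqP; split=> // t _; apply: dB; rewrite /dead /= (tuple0 t).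
    move: B0; rewrite BT => B0.
    have := @probability_setT _ _ _ (power P 0); rewrite [LHS]B0.
    by move/eqP; rewrite eq_sym onee_eq0.
  elim/(well_founded_ind prec_wf): [::] pos0 => w IH pos.
  have [[w' w'w pos']|no] := pselect (exists2 w', prec w' w & exists k, ~ (power P (hsize b k)).-negligible (dead k w')).
    exact: IH w'w pos'.
  exists w; split=> // w' w'w k; apply: contrapT => nk; apply: no; exists w' => //.
  by exists k.
have ex : exists k, `[< ~ (power P (hsize b k)).-negligible (dead k w) >] by exists k0; apply/asboolP.
case: (ex_minnP ex) => k /asboolP kpos kmin; exists w, k; split=> // [w' k' /wmin|k' k'k]; first exact.
by apply: contrapT => /asboolP /kmin; rewrite leqNgt k'k.
Qed.

Section MinimalRank.
Variables (w : seq nat) (k : nat).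
Hypothesis w_min : forall w' k', prec w' w -> (power P (hsize b k')).-negligible (dead k' w').
Hypothesis k_min : forall k', (k' < k)%N -> (power P (hsize b k')).-negligible (dead k' w).

(** A matching block leads from a position dead at [w] to one dead at some counter below [w], unless
    the sample is inconsistent. Both events are null, so by Fubini they have positive conditional
    probability only on a null set of positions. *)
Lemma matches_negligible l : (power P (hsize b l)).-negligible
  [set v : (hsize b l).-tuple (ZT X) | ~ alive l w v /\ ~ (power P (b l)).-negligible (matches (k := l) v)].
Proof.
pose J : set ((hsize b l + b l).-tuple (ZT X)) :=
  [set s | ~ consistent h s] `|` [set s | exists w', prec w' w /\ ~ alive l.+1 w' s].
have nJ : (power P (hsize b l + b l)).-negligible J.
  apply: negligibleU; first exact: inconsistent_negligible.
  apply: negligible_exists => w'; have [pw|npw] := pselect (prec w' w).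
    by apply: negligibleS (w_min l.+1 pw) => s [].
  by apply: negligibleS (negligible_set0 _) => s [].
apply: negligibleS (negligible_section nJ) => v [nav nm] nJv; apply: nm.
apply: negligibleS nJv => t mt /=.
pose xs (a : nat) := if insub a is Some a' then (tnth t a').1 else point.
have tE : t = block b l xs (pattern best_exists (k := l) v (fun a => (tnth t a).1)) :> seq _.
  apply: (@eq_from_nth _ (point : ZT X)); first by rewrite size_tuple size_mkseq.
  move=> i; rewrite size_tuple => ib; rewrite nth_mkseq // /xs insubT.
  have := mt (Ordinal ib); rewrite (tnth_nth point) /=.
  by rewrite /= => <-; case: (nth _ _ _).
have [cvt|ncvt] := pselect (consistent h (v ++ t)); last by left.
right; have cv : consistent h v by case: cvt => th; rewrite all_cat => /andP[vh _]; exists th.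
have [w' w'w naw'] := best_descends cv nav (proj1 (proj1 (strategyE best_exists l v xs _) erefl)).
by exists w'; split=> //=; rewrite tE.
Qed.

Lemma exceptional l : exists Om : set ((hsize b l).-tuple (ZT X)),
  [/\ measurable Om, power P (hsize b l) Om = 0%E & forall v, ~ Om v ->
    [/\ forall w', prec w' w -> alive l w' v, (l < k)%N -> alive l w v &
        ~ alive l w v -> (power P (b l)).-negligible (matches (k := l) v)]].
Proof.
have neg1 : (power P (hsize b l)).-negligible [set v | exists w', prec w' w /\ dead l w' v].
  apply: negligible_exists => w'; have [pw|npw] := pselect (prec w' w).
    by apply: negligibleS (w_min l pw) => s [].
  by apply: negligibleS (negligible_set0 _) => s [].
have neg2 : (power P (hsize b l)).-negligible [set v | (l < k)%N /\ dead l w v].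
  have [lk|nlk] := boolP (l < k)%N; first by apply: negligibleS (k_min lk) => s [].
  by apply: negligibleS (negligible_set0 _) => s [].
have [Om [mOm O0 sub]] := negligible_cover (negligibleU (negligibleU neg1 neg2) (matches_negligible l)).
exists Om; split=> // v nO; split.
- by move=> w' w'w; apply: contrapT => nal; apply/nO/sub; left; left; exists w'.
- by move=> lk; apply: contrapT => nal; apply/nO/sub; left; right.
- by move=> nal; apply: contrapT => nm; apply/nO/sub; right.
Qed.

Variable G : set ((hsize b k).-tuple (ZT X)).
Hypothesis G_measurable : measurable G.
Hypothesis G_dead : G `<=` dead k w.
Variable Om : forall l, set ((hsize b l).-tuple (ZT X)).
Hypothesis OP : forall l, [/\ measurable (Om (l := l)), power P (hsize b l) (Om (l := l)) = 0%E &
  forall v, ~ Om v ->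
    [/\ forall w', prec w' w -> alive l w' v, (l < k)%N -> alive l w v &
        ~ alive l w v -> (power P (b l)).-negligible (matches (k := l) v)]].

Variable n1 : nat.
Local Notation position := (position (X := X) b n1).
Local Notation candidates := (candidates b n1).
Local Notation selected := (selected b alive n1).
Let q := (n1 %/ (hsize b k).+1)%N.

Definition bad (s : seq (ZT X)) :=
  (exists c, c \in candidates /\ Om (position c s)) \/ missed q G s.

Lemma positionE c l j s : level n1 c = l -> (c %% n1.+1)%N = j ->
  position c s = slice (j * (hsize b l).+1) (hsize b l) s :> seq (ZT X).
Proof. by move=> <- <-. Qed.

Lemma hsize_ge l : (l <= hsize b l)%N.
Proof.
elim: l => //= l IH; have := b_gt0 l; lia.
Qed.

Lemma selected_good s : ~ bad s -> [/\ selected s \in candidates, level n1 (selected s) = k &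
  (power P (b (level n1 (selected s)))).-negligible (matches (position (selected s) s))].
Proof.
move=> /not_orP [nO nmiss].
have nOc c : c \in candidates -> ~ Om (position c s) by move=> cc Oc; apply: nO; exists c.
have [j jq Gj] : exists2 j, (j < q)%N & G (slice (j * (hsize b k).+1) (hsize b k) s).
  by apply: contrapT => no; apply: nmiss => j jq Gj; apply: no; exists j.
have qn : (q * (hsize b k).+1 <= n1)%N by exact: leq_trunc_div.
have jK : (j.+1 * (hsize b k).+1 <= n1)%N by apply: leq_trans qn; rewrite leq_mul2r jq orbT.
have jn : (j < n1.+1)%N by rewrite ltnS; apply: leq_trans jK; rewrite mulSn; nia.
have kn : (k < n1.+1)%N.
  rewrite ltnS; apply: leq_trans (hsize_ge k) _; apply: leq_trans jK; rewrite mulSn; nia.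
pose c0 := (k * n1.+1 + j)%N.
have lc0 : level n1 c0 = k by rewrite /level divnMDl // divn_small // addn0.
have mc0 : (c0 %% n1.+1 = j)%N by rewrite modnMDl modn_small.
have cc0 : c0 \in candidates.
  rewrite mem_filter lc0 mc0 jK mem_iota /= add0n /c0; nia.
have nal0 : ~ alive k w (position c0 s) by rewrite (positionE _ lc0 mc0); exact: G_dead.
have {}nal0 : ~ alive (level n1 c0) w (position c0 s) by rewrite {1}lc0.
(* The piece that falls into [G] is itself minimal: a candidate of smaller rank would be dead at a
   counter below [w], which is excluded outside the sets [Om]. *)
have min0 : minimal b alive n1 s c0.
  move=> c cc [w'' [nal al]]; have [u uw uw''] := alive_compare al nal0.
  apply: nal; apply: uw''.
  by have [_ _ /(_ _ (nOc c cc)) [h1 _ _]] := OP (level n1 c); exact: h1.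
(* The candidates are sorted, so the selected one is at most [c0] and its level at most [k]; the
   clause on levels below [k] in [OP] gives the converse. *)
have [sF sc0] : selected s \in [seq c <- candidates | `[< minimal b alive n1 s c >]] /\ (selected s <= c0)%N.
  rewrite /selected; set F := [seq c <- _ | _].
  have c0F : c0 \in F by rewrite mem_filter cc0 andbT; exact/asboolP.
  have : sorted leq F by do 2 apply: (sorted_filter leq_trans); exact: iota_sorted.
  case: F c0F => // a F; rewrite inE /= => c0F /(order_path_min leq_trans)/allP aF.
  by rewrite inE eqxx; split=> //; case/orP: c0F => [/eqP ->|/aF].
move: sF; rewrite mem_filter => /andP[/asboolP smin sc].
have nal : ~ alive (level n1 (selected s)) w (position (selected s) s).
  by move=> al; apply: (smin c0 cc0); exists w.
have [_ _ /(_ _ (nOc _ sc)) [_ h2 h3]] := OP (level n1 (selected s)).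
split=> //; last exact: h3.
apply/eqP; rewrite eqn_leq -{1}lc0 leq_div2r //= leqNgt; apply/negP => /h2; exact: nal.
Qed.

Lemma measurable_bad : measurable [set t : n1.-tuple (ZT X) | bad t].
Proof.
apply: measurableU; last exact: measurable_missed.
apply: measurable_exists => c; apply: measurableI; first exact: measurable_prop.
by apply: measurable_slice; have [] := OP (level n1 c).
Qed.

Lemma power_bad r : power P (hsize b k) (~` G) = r%:E ->
  (power P n1 [set t | bad t] <= (r ^+ q)%:E)%E.
Proof.
move=> rE.
have m1 : measurable [set t : n1.-tuple (ZT X) | exists c, c \in candidates /\ Om (position c t)].
  apply: measurable_exists => c; apply: measurableI; first exact: measurable_prop.
  by apply: measurable_slice; have [] := OP (level n1 c).
have m2 : measurable [set t : n1.-tuple (ZT X) | missed q G t] by exact: measurable_missed.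
apply: (le_trans (measureU2 (power P n1) m1 m2)).
rewrite -[leRHS]add0e; apply: leeD.
  have /negligibleP -> // : (power P n1).-negligible [set t | exists c, c \in candidates /\ Om (position c t)].
  apply: negligible_exists => c; have [cc|nc] := boolP (c \in candidates); last first.
    by apply: negligibleS (negligible_set0 _) => t [].
  have [mO PO _] := OP (level n1 c).
  apply: (@negligibleS _ _ _ _ [set t : n1.-tuple (ZT X) | Om (position c t)]); first by move=> t [].
  apply: negligible_slice; last exact: negligible0.
  move: cc; rewrite mem_filter => /andP[cn _]; apply: leq_trans cn.
  by rewrite mulSn addnC leq_add2r.
have E : power P n1 [set t | missed q G t] = (r ^+ q)%:E.
  by apply: power_missed => //; exact: leq_trunc_div.
by rewrite le_eqVlt; apply/orP; left; apply/eqP; exact: E.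
Qed.

End MinimalRank.

Lemma position_cat n1 c s s' : c \in candidates b n1 -> size s = n1 ->
  position b n1 c (s ++ s') = position b n1 c s :> (hsize b (level n1 c)).-tuple (ZT X).
Proof.
rewrite mem_filter => /andP[cn _] sn; apply: eq_from_tnth => i; rewrite !tnth_mktuple !nth_drop nth_cat sn.
case: ifP => // /negP[]; apply: leq_trans cn.
by rewrite mulSn addnC ltn_add2r ltnS ltnW.
Qed.

Lemma selected_cat n1 s s' : size s = n1 ->
  selected b alive n1 (s ++ s') = selected b alive n1 s.
Proof.
move=> sn; congr head; apply: eq_in_filter => c cc; apply: asbool_equiv_eq.
by split=> m c' cc'; have := m c' cc'; rewrite !position_cat.
Qed.

Local Notation learner := (learner best_exists).

(** With the first half fixed, the test point [z] becomes the last of the exchangeable points on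
    which one-inclusion prediction is made. *)
Lemma er_learner n s1 s2 (c := selected b alive n./2 s1) (v := position b n./2 c s1) :
  size s1 = n./2 -> size s2 = (n - n./2)%N -> c \in candidates b n./2 ->
  er P (learner n (s1 ++ s2)) =
  (\int[P]_z ind R [set s | mistake best_exists v (totup (n - n./2).+1 s) ord_max] (rcons s2 z))%E.
Proof.
move=> s1n s2n cc; apply: eq_integral => z _.
suff -> : (learner n (s1 ++ s2) z.1 != z.2) = mistake best_exists v (totup (n - n./2).+1 (rcons s2 z)) ord_max.
  by rewrite /ind indicE; case: ifPn => hz; [rewrite mem_set|rewrite memNset //; exact/negP].
rewrite /learner selected_cat // -/c position_cat // -/v drop_size_cat // /mistake.
set t := totup _ _; have tE : t = rcons s2 z :> seq _ by rewrite totupK // size_rcons s2n.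
have pE : (fun i : 'I_(n - n./2).+1 => nth point (rcons [seq z0.1 | z0 <- s2] z.1) i) = points t.
  apply/funext => i; rewrite /points (tnth_nth point) tE -map_rcons (nth_map point) //.
  by rewrite size_rcons s2n.
have lmax : labeling t ord_max = z.2.
  by rewrite ffunE (tnth_nth point) tE nth_rcons s2n ltnn eqxx.
have lE : labeling t = put ord_max z.2 [ffun i : 'I_(n - n./2).+1 => nth false [seq z0.2 | z0 <- s2] i].
  apply/ffunP => i; rewrite [RHS]ffunE; case: eqP => [->|/eqP im]; first by rewrite lmax.
  have iN : (i < n - n./2)%N.
    by have := ltn_ord i; rewrite ltnS leq_eqVlt => /orP[/eqP iE|//]; case/eqP: im; exact/val_inj.
  by rewrite !ffunE (tnth_nth point) tE nth_rcons s2n iN (nth_map point) // s2n.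
by rewrite lmax pE lE predict_put.
Qed.

Lemma er_le1 g : (0 <= er P g <= 1)%E.
Proof.
apply/andP; split; first by apply: integral_ge0 => z _; case: ifP; rewrite lee_fin.
apply: le_trans (le_integralT P (g := fun=> 1%E) _ _) _.
- by move=> z; case: ifP; rewrite lee_fin.
- by move=> z; case: ifP; rewrite lee_fin.
- by rewrite integral_cst // mul1e; exact: probability_le1.
Qed.

Lemma iid_seqint n (F : seq (ZT X) -> \bar R) :
  iid_int P (fun t : n.-tuple (ZT X) => F t) = seqint P n F.
Proof.
elim: n F => [|n IH] F //=; apply: eq_integral => z _.
exact: (IH (fun s => F (z :: s))).
Qed.

Theorem exp_err_learner : exists k (r : R) L, [/\ 0 <= r < 1, (0 < L)%N & forall n,
  (exp_err P (fun n s x => learner n s x) n <=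
   (r ^+ (n./2 %/ L) + (2 * (b k).-1)%:R / (n - n./2).+1%:R)%:E)%E].
Proof.
have [w [k [npos w_min k_min]]] := minimal_rank.
have [G [mG Gd G0]] := not_negligible_inner (@um_dead k w) npos.
pose Om l := projT1 (cid (exceptional w_min k_min l)).
have OmP l := projT2 (cid (exceptional w_min k_min l)).
have mGC : measurable (~` G) by exact: measurableC.
pose r : R := fine (power P (hsize b k) (~` G)).
have rE : power P (hsize b k) (~` G) = r%:E by rewrite fineK // fin_num_measure.
have r0 : 0 <= r by rewrite -lee_fin -rE measure_ge0.
have r1 : r < 1.
  rewrite -lte_fin -rE probability_setC // lteBlDr; last exact: fin_num_measure.
  by rewrite lteDl // lt0e G0 measure_ge0.
exists k, r, (hsize b k).+1; split=> [|//|n]; first by rewrite r0 r1.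
set n1 := n./2; set N := (n - n1)%N; set e : R := _ / _.
have e0 : 0 <= e by rewrite divr_ge0.
have nE : n = (n1 + N)%N by rewrite /N /n1; lia.
rewrite /exp_err (@iid_seqint n (fun s => er P (learner n s))) [X in seqint _ X _]nE seqint_cat.
pose bad := bad G Om n1.
have mbad : measurable [set t : n1.-tuple (ZT X) | bad t] by exact: (measurable_bad mG OmP).
apply: (@le_trans _ _ (seqint P n1 (fun s1 => ind R bad s1 + e%:E)%E)).
  apply: le_seqint => [s1|s1 s1n]; first by apply: seqint_ge0 => s2; case/andP: (er_le1 (learner n (s1 ++ s2))).
  have [bs|nbs] := pselect (bad s1).
    rewrite ind_in //; apply: le_trans (_ : 1 <= _)%E; last by rewrite leeDl ?lee_fin.
    rewrite -[leRHS](seqint_cst P N); apply: le_seqint => s2; first by case/andP: (er_le1 (learner n (s1 ++ s2))).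
    by case/andP: (er_le1 (learner n (s1 ++ s2))).
  rewrite ind_notin // add0e.
  have [cc lk neg] := selected_good Gd OmP nbs.
  have [E [mE mE' PE]] := one_inclusion_rate alive_um N (b_gt0 _) neg.
  rewrite lk -/e in PE; apply: le_trans PE.
  pose E' := [set s : seq (ZT X) | E (totup N.+1 s)].
  have E'E : [set t : N.+1.-tuple (ZT X) | E' t] = E.
    by apply/seteqP; split=> t; rewrite /E' /= totup_tuple.
  have PE' : power P N.+1 E = seqint P (N + 1) (ind R E').
    rewrite addn1 -[LHS](congr1 (fun S => power P N.+1 S) E'E).
    by apply: power_seqint; rewrite E'E.
  rewrite PE' seqint_cat.
  apply: le_seqint => [s2|s2 s2n]; first by case/andP: (er_le1 (learner n (s1 ++ s2))).
  rewrite er_learner //; apply: le_integralT => z; first exact: ind_ge0.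
  rewrite cats1; set M := [set s | _].
  have [Ms|nMs] := pselect (M (rcons s2 z)); last by rewrite ind_notin // ind_ge0.
  by rewrite !ind_in //; exact: mE'.
rewrite seqint_power; first last.
- by apply: emeasurable_funD; [exact: measurable_ind|exact: measurable_cst].
- by move=> s; rewrite adde_ge0 ?ind_ge0 // lee_fin.
rewrite ge0_integralD; [|exact: measurableT|by move=> t _; exact: ind_ge0|exact: measurable_ind|
  by move=> t _; rewrite lee_fin|exact: measurable_cst].
rewrite -(seqint_power P (ind_ge0 _ bad) (measurable_ind mbad)) -(power_seqint P mbad).
rewrite EFinD; apply: leeD; first exact: (power_bad mG OmP n1 rE).
rewrite integral_cst //; apply: (@le_trans _ _ (e%:E * 1)%E); last by rewrite mule1.
by rewrite lee_wpmul2l ?lee_fin //; exact: probability_le1.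
Qed.

End UpperBound.

(** * Lower bounds *)

Section AtomicMeasure.
Context d (T : measurableType d) (R : realType).
Variables (b : nat -> nat) (t : nat -> R).
Hypothesis b_gt0 : forall k, (0 < b k)%N.
Hypothesis t0 : t 0%N = 1.
Hypothesis t_le : forall k, t k.+1 <= t k.
Hypothesis t_cvg : t @ \oo --> (0 : R).
Hypothesis sing : forall a : T, measurable [set a].
Variable z : nat -> nat -> T.

(* The tails [t] of the level masses are the primary data: level [k] has mass [t k - t k.+1], shared
   equally by its [b k] atoms. *)
Definition weight k : R := (t k - t k.+1) / (b k)%:R.

Lemma weight_ge0 k : 0 <= weight k.
Proof. by rewrite divr_ge0 // subr_ge0. Qed.

Definition level_measure k : {measure set T -> \bar R} :=
  msum (fun i => mscale (NngNum (weight_ge0 k)) \d_(z k i)) (b k).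

Definition atomic := mseries level_measure 0.

Lemma integral_level k (f : T -> \bar R) : measurable_fun setT f -> (forall x, 0 <= f x)%E ->
  (\int[level_measure k]_x f x = \sum_(i < b k) (weight k)%:E * f (z k i))%E.
Proof.
move=> mf f0; rewrite ge0_integral_measure_sum //; apply: eq_bigr => i _.
by rewrite ge0_integral_mscale // integral_dirac // diracT mul1e.
Qed.

Lemma weight_sum k : \sum_(i < b k) weight k = t k - t k.+1.
Proof.
rewrite sumr_const card_ord -mulr_natr /weight mulfVK //.
by rewrite pnatr_eq0 -lt0n.
Qed.

Lemma partial_mass n : \sum_(k < n) (t k - t k.+1) = 1 - t n.
Proof.
elim: n => [|n IH]; first by rewrite big_ord0 t0 subrr.
by rewrite big_ord_recr IH /= addrA subrK.
Qed.

Lemma level_measure_setT k : (level_measure k setT = (t k - t k.+1)%:E)%E.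
Proof.
rewrite -weight_sum -[LHS]mul1e -(integral_cst (level_measure k) measurableT) integral_level //.
by rewrite -sumEFin; apply: eq_bigr => i _; rewrite mule1.
Qed.

Lemma atomic_setT : atomic setT = 1%E.
Proof.
rewrite /atomic /mseries; apply/cvg_lim => //.
rewrite (_ : (fun n => _) = (fun n => (1 - t n)%:E)); last first.
  apply/funext => n; rewrite -partial_mass -sumEFin big_mkord.
  by apply: eq_bigr => k _; exact: level_measure_setT.
apply: cvg_EFin; first exact: nearW.
rewrite -[X in _ --> X]subr0; apply: cvgB => //; exact: cvg_cst.
Qed.

HB.instance Definition _ := Measure.on atomic.
HB.instance Definition _ := Measure_isProbability.Build _ _ _ atomic atomic_setT.
Definition atomic_probability : probability T R := atomic.

Definition finite_support n := [set x | exists k i, [/\ (k < n)%N, (i < b k)%N & x = z k i]].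

Lemma measurable_finite_support n A : measurable (finite_support n `&` A).
Proof.
apply: countable_measurable => //.
have cR : countable (range (fun p : nat * nat => z p.1 p.2)).
  by apply: sub_countable (card_image_le _ _) _; exact: countableP.
by apply: sub_countable cR; apply: subset_card_le => x [[k [i [_ _ ->]]] _]; exists (k, i).
Qed.

(** Cutting [f] off outside the atoms of the first [n] levels makes it measurable, and the integral
    is monotone. *)
Lemma sum_atoms_le n (f : T -> \bar R) : (forall x, 0 <= f x)%E ->
  (\sum_(k < n) \sum_(i < b k) (weight k)%:E * f (z k i) <= \int[atomic]_x f x)%E.
Proof.
move=> f0; pose g := (fun x => if `[< finite_support n x >] then f x else 0%E).
have g0 x : (0 <= g x)%E by rewrite /g; case: ifP.
have mg : measurable_fun setT g.
  move=> _ Y mY; rewrite setTI.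
  have mS : measurable (finite_support n) by rewrite -[X in measurable X]setIT; exact: measurable_finite_support.
  rewrite (_ : g @^-1` Y = (finite_support n `&` (f @^-1` Y)) `|` (~` finite_support n `&` [set _ | Y 0%E])).
    apply: measurableU; first exact: measurable_finite_support.
    by apply: measurableI; [exact: measurableC|exact: measurable_prop].
  apply/seteqP; split=> x /=; rewrite /g; case: asboolP => Sx.
  - by move=> Yx; left.
  - by move=> Yx; right.
  - by case=> [[_ ?]|[/(_ Sx)]].
  - by case=> [[]|[]].
apply: le_trans (_ : \int[atomic]_x g x <= _)%E; last first.
  by apply: le_integralT => // x; rewrite /g; case: ifP.
rewrite ge0_integral_measure_series //.
apply: le_trans (_ : \sum_(0 <= k < n) \int[level_measure k]_x g x <= _)%E; last first.
  by apply: nneseries_lim_ge => k _ _; exact: integral_ge0.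
rewrite big_mkord; apply: lee_sum => k _; rewrite integral_level //.
apply: lee_sum => i _; rewrite lee_wpmul2l ?lee_fin ?weight_ge0 // /g.
by case: asboolP => // -[]; exists k, i.
Qed.

Lemma atomic_support_ge n : ((1 - t n)%:E <= atomic (finite_support n))%E.
Proof.
have mS : measurable (finite_support n) by rewrite -[X in measurable X]setIT; exact: measurable_finite_support.
rewrite -[X in atomic X]setIT -(integral_indic atomic measurableT mS).
apply: le_trans (sum_atoms_le n _) => [|x]; last by rewrite lee_fin.
rewrite -partial_mass -sumEFin; apply: lee_sum => k _.
rewrite -weight_sum -sumEFin; apply: lee_sum => i _.
by rewrite indicE mem_set ?mule1 //; exists k, i.
Qed.

Lemma integral_off_support n (f : T -> \bar R) : (forall x, 0 <= f x <= 1)%E ->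
  (forall k i, (k < n)%N -> (i < b k)%N -> f (z k i) = 0%E) ->
  (\int[atomic]_x f x <= (t n)%:E)%E.
Proof.
move=> f01 fz.
have mS : measurable (finite_support n) by rewrite -[X in measurable X]setIT; exact: measurable_finite_support.
apply: le_trans (_ : \int[atomic]_x (\1_(~` finite_support n) x)%:E <= _)%E.
  apply: le_integralT => x; first by case/andP: (f01 x).
  have [[k [i [kn ik ->]]]|nS] := pselect (finite_support n x).
    by rewrite fz // lee_fin.
  by rewrite indicE mem_set //; case/andP: (f01 x).
rewrite integral_indic ?setIT //; last exact: measurableC.
apply: (@le_trans _ _ (1 - atomic (finite_support n))%E).
  by rewrite le_eqVlt; apply/orP; left; apply/eqP; exact: (probability_setC (atomic : probability T R) mS).
rewrite leeBlDr; last exact: (@fin_num_measure _ _ _ (atomic : probability T R) _ mS).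
rewrite -[leLHS]/((1 : R)%:E) -(subrKC (t n) 1) EFinD leeD2l //.
exact: atomic_support_ge.
Qed.

End AtomicMeasure.

(** * Finite atomic minorants of a law *)

Section FiniteSums.
Context d (T : measurableType d) (R : realType).
Implicit Types (l : seq (R * T)) (f g : seq T -> R).

(** The counterpart of [seqint] for the finite measure with mass [a.1] at [a.2], whose total mass
    may be less than one. *)
Fixpoint lsum l n f : R :=
  if n is n'.+1 then \sum_(a <- l) a.1 * lsum l n' (fun s => f (a.2 :: s)) else f [::].

Definition dominated (P : probability T R) l := {in l, forall a, 0 <= a.1} /\
  forall f : T -> \bar R, (forall x, 0 <= f x)%E ->
    (\sum_(a <- l) a.1%:E * f a.2 <= \int[P]_x f x)%E.

Lemma lsum_ge0 l n f : {in l, forall a, 0 <= a.1} -> (forall s, 0 <= f s) -> 0 <= lsum l n f.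
Proof.
move=> l0; elim: n f => [|n IH] f f0 //=.
by rewrite big_seq; apply: sumr_ge0 => a al; rewrite mulr_ge0 ?l0 // IH.
Qed.

Lemma lsum_eq l n f g : (forall s, f s = g s) -> lsum l n f = lsum l n g.
Proof. by move=> fg; congr lsum; apply/funext. Qed.

Lemma lsumD l n f g : lsum l n (fun s => f s + g s) = lsum l n f + lsum l n g.
Proof.
elim: n f g => [|n IH] f g //=; rewrite -big_split /=; apply: eq_bigr => a _.
by rewrite IH mulrDr.
Qed.

Lemma lsumZ l n c f : lsum l n (fun s => c * f s) = c * lsum l n f.
Proof.
elim: n f => [|n IH] f //=; rewrite mulr_sumr; apply: eq_bigr => a _.
by rewrite IH mulrCA.
Qed.

Lemma lsum_sum l n (I : finType) (F : I -> seq T -> R) :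
  lsum l n (fun s => \sum_i F i s) = \sum_i lsum l n (F i).
Proof.
elim: n F => [|n IH] F //=; rewrite exchange_big /=; apply: eq_bigr => a _.
by rewrite IH mulr_sumr.
Qed.

Lemma lsum1 l n : lsum l n (fun=> 1) = (\sum_(a <- l) a.1) ^+ n.
Proof. by elim: n => //= n IH; rewrite -mulr_suml IH exprS. Qed.

Lemma lsum_perm l l' n f : perm_eq l l' -> lsum l n f = lsum l' n f.
Proof.
move=> ll'; elim: n f => //= n IH f; rewrite (perm_big _ ll') /=.
by apply: eq_bigr => a _; rewrite IH.
Qed.

Lemma lsum_cons a l n f : {in a :: l, forall e, 0 <= e.1} -> (forall s, 0 <= f s) ->
  lsum l n f <= lsum (a :: l) n f.
Proof.
move=> l0; have l0' : {in l, forall e, 0 <= e.1}.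
  by move=> e el; apply: l0; rewrite inE el orbT.
elim: n f => [|n IH] f f0 //=; rewrite big_cons -[leLHS]add0r; apply: lerD.
  by rewrite mulr_ge0 ?l0 ?inE ?eqxx // lsum_ge0.
rewrite big_seq [leRHS]big_seq; apply: ler_sum => e el.
by rewrite ler_wpM2l ?l0' // IH.
Qed.

Lemma dominated_lsum P l n f : dominated P l -> (forall s, 0 <= f s) ->
  ((lsum l n f)%:E <= seqint P n (fun s => (f s)%:E))%E.
Proof.
move=> [l0 dl]; elim: n f => [|n IH] f f0 //=.
apply: le_trans (dl _ _) => [|x]; last by apply: seqint_ge0 => s; rewrite lee_fin.
rewrite -sumEFin big_seq [leRHS]big_seq; apply: lee_sum => a al.
by rewrite EFinM lee_wpmul2l ?lee_fin ?l0 // IH.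
Qed.

End FiniteSums.

Section ErrorLowerBound.
Variables (R : realType) (X : ptopologicalType) (P : probability (ZT X) R).

Lemma exp_err_ge (A : algorithm X) (l l' : seq (R * ZT X)) n : dominated P l -> dominated P l' ->
  ((lsum l n (fun s => \sum_(a <- l') a.1 * (A n (totup n s) a.2.1 != a.2.2)%:R))%:E
   <= exp_err P A n)%E.
Proof.
move=> dl [l0 dl'].
rewrite /exp_err; set F := fun s : seq (ZT X) => er P (A n (totup n s)).
have -> : iid_int P (fun s : n.-tuple (ZT X) => er P (A n s)) = seqint P n F.
  rewrite -iid_seqint; congr iid_int; apply/funext => s; by rewrite /F totup_tuple.
pose f (s : seq (ZT X)) : R := \sum_(a <- l') a.1 * (A n (totup n s) a.2.1 != a.2.2)%:R.
have f0 s : 0 <= f s by rewrite /f big_seq; apply: sumr_ge0 => a al; rewrite mulr_ge0 ?l0.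
apply: (le_trans (dominated_lsum n dl f0)).
apply: le_seqint => [s|s _]; first by rewrite lee_fin.
rewrite /F /er; apply: le_trans (dl' _ _) => [|x]; last by case: ifP; rewrite lee_fin.
rewrite -sumEFin; apply: lee_sum => a _.
by rewrite EFinM; case: ifP => _; rewrite ?mulr1n ?mulr0n.
Qed.

End ErrorLowerBound.

Section LevelChoice.
Variables (R : realType) (X : ptopologicalType).
Variables (l : seq (R * ZT X)) (w : R) (m : nat) (x : nat -> X).
Hypotheses (l_ge0 : {in l, forall a, 0 <= a.1}) (w_ge0 : 0 <= w).

Definition level_atoms (c : nat -> bool) : seq (R * ZT X) := [seq (w, (x i, c i)) | i <- iota 0 m].

(* Averaging over the labels of one level: an atom missing from the sample is mislabelled half of
   the time. *)
Lemma level_choice (F : seq (ZT X) -> X -> bool) n : exists c,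
  w *+ m * (\sum_(a <- l) a.1 + w *+ m.-1) ^+ n / 2 <=
  lsum (l ++ level_atoms c) n (fun s => \sum_(a <- level_atoms c) a.1 * (F s a.2.1 != a.2.2)%:R).
Proof.
pose ext (f : {ffun 'I_m -> bool}) i := if insub i is Some j then f j else false.
have extE f (i : 'I_m) : ext f i = f i.
  by rewrite /ext insubT // => ltim; congr (f _); apply: val_inj.
pose at_ (f : {ffun 'I_m -> bool}) (i : 'I_m) : R * ZT X := (w, (x i, f i)).
have atE f : level_atoms (ext f) = [seq at_ f i | i <- enum 'I_m].
  rewrite /level_atoms -val_enum_ord -map_comp; apply: eq_map => i /=.
  by rewrite /at_ extE.
pose L f := lsum (l ++ level_atoms (ext f)) n
  (fun s => \sum_(a <- level_atoms (ext f)) a.1 * (F s a.2.1 != a.2.2)%:R).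
pose l_ (f : {ffun 'I_m -> bool}) i := l ++ [seq at_ f j | j <- rem i (enum 'I_m)].
pose G (f : {ffun 'I_m -> bool}) i := lsum (l_ f i) n (fun s => (F s (x i) != f i)%:R).
set M := _ + _ *+ m.-1.
have l_M f i : \sum_(a <- l_ f i) a.1 = M.
  rewrite /l_ big_cat big_map /=; congr +%R.
  by rewrite big_const_seq count_predT size_rem ?mem_enum // size_enum_ord iter_addr_0.
(* For the atom [i] only the samples that avoid it are kept; each draw from the shortened list has
   total mass [M]. *)
have LG f : \sum_i w * G f i <= L f.
  rewrite /L (_ : (fun s => _) = (fun s => \sum_(i < m) w * (F s (x i) != f i)%:R)); last first.
    by apply/funext => s; rewrite atE big_map big_enum.
  rewrite lsum_sum; apply: ler_sum => i _; rewrite lsumZ ler_wpM2l // atE.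
  have pe : perm_eq (l ++ [seq at_ f j | j <- enum 'I_m]) (at_ f i :: l_ f i).
    rewrite -cat1s /l_ perm_sym perm_catCA perm_cat2l perm_sym.
    by rewrite (perm_map (at_ f) (perm_to_rem _)) ?mem_enum.
  rewrite (lsum_perm _ _ pe); apply: lsum_cons => // e.
  rewrite inE mem_cat => /orP[/eqP -> //|/orP[/l_ge0 //|/mapP[j _ -> //]]].
pose flip i (f : {ffun 'I_m -> bool}) := [ffun j => (j == i) (+) f j].
have flipK i : involutive (flip i).
  by move=> f; apply/ffunP => j; rewrite !ffunE addbA addbb.
(* The list [l_ f i] is unchanged when the label of [i] is flipped, and exactly one of the two
   labels makes the prediction wrong. *)
have GG f i : G f i + G (flip i f) i = M ^+ n.
  rewrite -(l_M f i) -lsum1 /G (_ : l_ (flip i f) i = l_ f i); last first.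
    congr cat; apply/eq_in_map => j; rewrite mem_rem_uniq ?enum_uniq // inE => /andP[ji _].
    by rewrite /at_ ffunE (negbTE ji).
  rewrite -lsumD; apply: lsum_eq => s; rewrite ffunE eqxx.
  by case: (F s _) (f i) => -[]; rewrite ?addr0 ?add0r.
have avg i : 2 * \sum_f G f i = #|{ffun 'I_m -> bool}|%:R * M ^+ n.
  rewrite mulr2n mulrDl mul1r {2}(reindex_inj (inv_inj (flipK i))) -big_split /=.
  by under eq_bigr do rewrite GG; rewrite sumr_const mulr_natl.
have [//|noc] := pselect (exists f, w *+ m * M ^+ n / 2 <= L f).
  by case=> f Lf; exists (ext f).
exfalso; have: \sum_f L f < \sum_(f : {ffun 'I_m -> bool}) (w *+ m * M ^+ n / 2).
  apply: ltr_sum; first by apply/hasP; exists [ffun=> false] => //; rewrite mem_index_enum.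
  by move=> f _; rewrite ltNge; apply/negP => Lf; apply: noc; exists f.
rewrite sumr_const ltNge => /negP; apply.
apply: le_trans (ler_sum _ (fun f _ => LG f)); rewrite exchange_big /=.
under eq_bigr do rewrite -mulr_sumr.
rewrite -(@ler_pM2l _ 2) // mulr_sumr; under eq_bigr do rewrite mulrCA avg.
rewrite sumr_const card_ord le_eqVlt; apply/orP; left; apply/eqP.
rewrite -(mulr_natl (w *+ m * _ / 2)) -(mulr_natl w m) -(mulr_natl (w * _) m).
rewrite -[#|xpredT|]/(#|{ffun 'I_m -> bool}|).
move: (#|_|%:R : R) (M ^+ n) (m%:R : R) => K Mn m'; by field.
Qed.

End LevelChoice.

(** * The adversary on a tree *)

Section Adversary.
Variables (R : realType) (X : ptopologicalType) (H : set (X -> bool)).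
Variables (b : nat -> nat) (t : nat -> R).
Hypothesis b_gt0 : forall k, (0 < b k)%N.
Hypothesis t0 : t 0%N = 1.
Hypothesis t_le : forall k, t k.+1 <= t k.
Hypothesis t_cvg : t @ \oo --> (0 : R).
Hypothesis sing : forall a : ZT X, measurable [set a].
Variable node : (nat -> nat -> bool) -> nat -> nat -> X.
Local Notation atoms y := (fun k i => (node y k i, y k i) : ZT X).

Definition tree_law y : probability (ZT X) R :=
  atomic_probability b_gt0 t0 t_le t_cvg (atoms y).

(** A hypothesis that fits the first levels errs only on a tail of mass at most [t n]. *)
Lemma tree_law_realizable y : (forall n, exists2 h, H h &
    forall k i, (k <= n)%N -> (i < b k)%N -> h (node y k i) = y k i) -> realizable H (tree_law y).
Proof.
move=> shattered.
apply/eqP; rewrite eq_le; apply/andP; split; last first.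
  apply: le_ereal_inf_tmp => _ [h _ <-]; apply: integral_ge0 => z _.
  by case: ifP; rewrite lee_fin.
apply/lee_addgt0Pr => e e0; rewrite add0e.
have [n _ tn] := cvgr_lt _ t_cvg _ e0.
have [h Hh hy] := shattered n.
apply: le_trans (ereal_inf_lbound _) _; first by exists h.
apply: le_trans (_ : (t n)%:E <= _)%E; last by rewrite lee_fin ltW // tn /=.
apply: integral_off_support => // [z|k i kn ik].
  by case: ifP; rewrite !lee_fin ?lexx ?ler01.
by rewrite /= hy ?eqxx // ltnW.
Qed.

Fixpoint upper_atoms y k : seq (R * ZT X) := if k is k'.+1
  then upper_atoms y k' ++ level_atoms (weight b t k') (b k') (node y k') (y k') else [::].

Lemma upper_atoms_mass y k : \sum_(a <- upper_atoms y k) a.1 = 1 - t k.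
Proof.
elim: k => [|k IH]; first by rewrite big_nil t0 subrr.
rewrite big_cat /= IH big_map /= big_const_seq count_predT size_iota iter_addr_0.
rewrite -[_ *+ b k]mulr_natr /weight mulfVK ?pnatr_eq0 -?lt0n // addrA subrK.
by [].
Qed.

Lemma upper_atoms_dominated y k : dominated (tree_law y) (upper_atoms y k).
Proof.
split; first by elim: k => //= k IH a; rewrite mem_cat => /orP[/IH //|/mapP[i _ ->]]; exact: weight_ge0.
move=> f f0; apply: le_trans; last exact: (sum_atoms_le b t_le sing (atoms y) k f0).
rewrite le_eqVlt; apply/orP; left; apply/eqP.
elim: k => [|k IH]; first by rewrite big_nil big_ord0.
by rewrite big_ord_recr big_cat /= IH big_map -(big_mkord xpredT (fun i => (weight b t k)%:E * f (node y k i, y k i))%E) /index_iota subn0.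
Qed.

Lemma dominated_cat2 (P : probability (ZT X) R) l l' : dominated P (l ++ l') -> dominated P l'.
Proof.
move=> [l0 dl]; split=> [a al|f f0]; first by apply: l0; rewrite mem_cat al orbT.
apply: le_trans (dl f f0); rewrite big_cat /= leeDr // big_seq; apply: sume_ge0 => a al.
by rewrite mule_ge0 ?f0 // lee_fin l0 // mem_cat al.
Qed.

Hypothesis node_predictable : forall y y' k, (forall j, (j < k)%N -> y j = y' j) ->
  node y k = node y' k.
Hypothesis node_shattered : forall y n, exists2 h, H h &
  forall k i, (k <= n)%N -> (i < b k)%N -> h (node y k i) = y k i.

Lemma upper_atoms_predictable y y' k : (forall j, (j < k)%N -> y j = y' j) ->
  upper_atoms y k = upper_atoms y' k.
Proof.
elim: k => //= k IH yy'.
rewrite IH => [|j jk]; last by rewrite yy' // ltnW.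
by rewrite (node_predictable (y' := y')) ?yy' // => j jk; rewrite yy' // ltnW.
Qed.

(** The power is the probability that no draw hits a given atom of level [k] or a deeper level;
    deeper levels must stay unseen because their points depend on the labels being chosen. On such
    an atom [level_choice] forces an error half of the time. *)
Lemma adversary (A : algorithm X) (size : nat -> nat) :
  exists P : probability (ZT X) R, realizable H P /\ forall k,
    (((t k - t k.+1) * (1 - t k.+1 - weight b t k) ^+ size k / 2)%:E <= exp_err P A (size k))%E.
Proof.
have ch (p : nat * (nat -> nat -> bool)) := level_choice (l := upper_atoms p.2 p.1)
  (b p.1) (node p.2 p.1) (upper_atoms_dominated p.2 p.1).1 (weight_ge0 b t_le p.1)
  (fun s => A (size p.1) (totup (size p.1) s)) (size p.1).
have [c cP] := choice ch.
(* [ys k] holds the labels of the levels before [k], which is all that the points of level [k]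
   depend on. *)
pose ys := fix ys k : nat -> nat -> bool :=
  if k is k'.+1 then fun j => if j == k' then c (k', ys k') else ys k' j else fun _ _ => false.
pose y j := c (j, ys j).
have ysE k j : (j < k)%N -> ys k j = y j.
  elim: k => // k IH; rewrite ltnS leq_eqVlt /= => /predU1P[->|jk]; first by rewrite eqxx.
  by rewrite ltn_eqF // IH.
exists (tree_law y); split=> [|k]; first exact: tree_law_realizable (node_shattered y).
have := upper_atoms_dominated y k.+1 => /= dom.
apply: le_trans (exp_err_ge _ _ dom (dominated_cat2 dom)); rewrite lee_fin.
have := cP (k, ys k); rewrite /= (upper_atoms_predictable (y' := y) (ysE k)).
rewrite (node_predictable (ysE k)) -/(y k); apply: le_trans.
have bE : weight b t k *+ b k = t k - t k.+1.
  by rewrite -[_ *+ b k]mulr_natr /weight mulfVK ?pnatr_eq0 -?lt0n.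
have bE1 : weight b t k *+ (b k).-1 = t k - t k.+1 - weight b t k.
  by rewrite -bE -[in RHS](prednK (b_gt0 k)) mulrS addrC addrK.
rewrite bE bE1 upper_atoms_mass addrA addrA subrK.
by [].
Qed.

End Adversary.

Lemma rate_at1 (R : realType) (Rt : nat -> R) n : rate_at Rt 1 n = Rt n.
Proof. by rewrite /rate_at mul1r -[n%:R]/(n%:~R) intrKceil absz_nat. Qed.

Lemma bernoulli_half (R : realType) (x : R) n : 0 <= x <= 1 -> n%:R * x <= 2^-1 ->
  2^-1 <= (1 - x) ^+ n.
Proof.
move=> /andP[x0 x1] nx; have B : 1 - n%:R * x <= (1 - x) ^+ n.
  elim: n {nx} => [|n IH]; first by rewrite mul0r subr0 expr0.
  have : (1 - n%:R * x) * (1 - x) <= (1 - x) ^+ n.+1 by rewrite exprSr ler_wpM2r // subr_ge0.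
  apply: le_trans; rewrite -natr1; have : 0 <= (n%:R : R) by []. nra.
by apply: le_trans B; lra.
Qed.

Lemma polish_closed1 (R : realType) (X : topologicalType) (x : X) : polish R X -> closed [set x].
Proof.
move=> [_ [d [d0 dC dT dO _]]]; rewrite -[X in closed X]setCK; apply: open_closedC.
apply/dO => y /= yx; exists (d y x) => [|z /= yz zx]; last by move: yz; rewrite zx ltxx.
have : d y y <= d y x + d x y by exact: dT.
rewrite (dC x y) ((d0 y y).2 erefl) => dd; rewrite lt_def; apply/andP; split; last by lra.
by apply/eqP => /d0.
Qed.

Lemma measurable_ZT1 (R : realType) (X : ptopologicalType) : polish R X ->
  forall a : ZT X, measurable [set a].
Proof.
move=> polX [x c].
have -> : [set (x, c)] = [set x] `*` [set c].
  by apply/seteqP; split=> [[? ?] [-> ->]|[? ?] [/= -> ->]].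
apply: measurableX => //; rewrite -[X in measurable X]setCK; apply: measurableC.
by apply: sub_sigma_algebra; apply: closed_openC; exact: polish_closed1 polX.
Qed.

Section LowerBounds.
Variables (R : realType) (X : ptopologicalType) (H : set (X -> bool)).
Hypothesis polX : polish R X.

Let sing := measurable_ZT1 polX.

Lemma littlestone_not_faster : has_inf_littlestone H -> not_faster H (fun n => (n%:R : R)^-1).
Proof.
case=> x xH A _; pose t k : R := 2^-1 ^+ k.
have t_le k : t k.+1 <= t k by rewrite /t exprS; have : 0 <= (2^-1 : R) ^+ k by []; lra.
have t_cvg : t @ \oo --> (0 : R) by apply: cvg_expr; rewrite ger0_norm //; lra.
have [//|||P [Preal PA]] := adversary (H := H) (b := fun=> 1%N) _ (expr0 _) t_le t_cvg sing
   (node := fun y k _ => x (Defs.prefix (fun j => y j 0%N) k)) _ _ A (fun k => 2 ^ k.-1)%N.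
- move=> y y' k yy'; apply/funext => _; congr x; apply/eq_in_map => j.
  by rewrite mem_iota => jk; rewrite yy'.
- move=> y n; have [h Hh hy] := xH (fun j => y j 0%N) n; exists h => // k [|//] kn _.
  exact: hy.
(* Level [N.+1] meets [2 ^ N] draws. It has mass [t N / 4], and together with all deeper levels mass
   [t N / 2], so it is missed with probability at least 1/2. With the factor 1/2 from [level_choice]
   this gives [t N / 16]. *)
exists P; split => //; exists 16^-1, 1; split=> // N; exists (2 ^ N)%N.
split; first by rewrite ltnW // ltn_expl.
split; first by rewrite expn_gt0.
apply: le_trans (PA N.+1); rewrite rate_at1 lee_fin /= /weight divr1.
set u := t N.+1 - t N.+2; have uE : u = t N / 4 by rewrite /u /t !exprS; lra.
have tN : t N.+2 + u = t N / 2 by rewrite uE /t !exprS; lra.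
have t1 : 0 <= t N <= 1 by rewrite /t exprn_ge0 // exprn_ile1 //; lra.
rewrite -addrA -opprD tN.
have -> : ((2 ^ N)%:R : R)^-1 = t N by rewrite natrX /t exprVn.
have : 2^-1 <= (1 - t N / 2) ^+ (2 ^ N).
  apply: bernoulli_half; first by lra.
  by rewrite natrX /t mulrA exprVn divff // mul1r.
set e := (_ ^+ (2 ^ N)%N); rewrite uE; nra.
Qed.

(* Level [i] of the subtree is the level [kappa i] of the given one, where the labels of the skipped
   levels are [false]. *)
Lemma vcl_arbitrarily_slow : has_inf_VCL H -> requires_arbitrarily_slow R H.
Proof.
case=> x xH Rt [Rt01 Rt0] A _.
have ch (p : R * nat) : exists n, (p.2 < n)%N /\ (0 < p.1 -> Rt n <= p.1).
  case: (ltP 0 p.1) => [p0|_]; last by exists p.2.+1.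
  have [m _ mP] := cvgr_le _ Rt0 _ p0.
  by exists (maxn p.2.+1 m); split=> [|_]; [exact: leq_maxl|apply: mP; exact: leq_maxr].
have [f fP] := choice ch.
(* The size [n k] is fixed first, with [Rt (n k) <= t k]; then the mass [t k.+1] of the deeper
   levels is taken so small that [n k] draws hit them at most [t k / 4] times on average. *)
pose t := fix t k : R := if k is k'.+1 then t k' / (4 * (f (t k', k'))%:R) else 1.
pose n k := f (t k, k).
have n_gt k : (k < n k)%N by have [] := fP (t k, k).
have n_ge1 k : 1 <= ((n k)%:R : R) by rewrite ler1n (leq_trans _ (n_gt k)).
have tS k : t k.+1 = t k / (4 * (n k)%:R) by [].
have t_gt0 k : 0 < t k.
  by elim: k => // k IH; rewrite tS divr_gt0 // mulr_gt0 // (lt_le_trans ltr01).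
have tn k : t k.+1 * (n k)%:R = t k / 4.
  by rewrite tS; have := n_ge1 k; move: (_%:R) => N N1; field; lra.
have t4 k : t k.+1 <= t k / 4 by rewrite -tn ler_peMr // ltW.
have t_le k : t k.+1 <= t k by have := t4 k; have := t_gt0 k; lra.
have t_cvg : t @ \oo --> (0 : R).
  apply: (@squeeze_cvgr _ _ _ _ (fun=> 0) (fun k => 2^-1 ^+ k)); last 2 first.
  - exact: cvg_cst.
  - by apply: cvg_expr; rewrite ger0_norm //; lra.
  apply: nearW => k; rewrite ltW //=; elim: k => [|k IH]; first by rewrite expr0.
  by rewrite exprS; have := t4 k; have := t_gt0 k; lra.
(* Level [kappa i] has more than [4 * n i] points, so that a single one of them is light enough to
   be missed by [n i] draws. *)
pose kappa i := (\sum_(j < i.+1) 4 * n j)%N.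
have kappaS i : (kappa i < kappa i.+1)%N.
  by rewrite /kappa [in ltnRHS]big_ord_recr /= -[ltnLHS]addn0 ltn_add2l muln_gt0 /= (leq_trans _ (n_gt _)).
have kappa_mono : {mono kappa : i j / (i <= j)%N} by apply: leq_mono; exact: homo_ltn ltn_trans kappaS.
have kappa_ge i : (i <= kappa i)%N.
  by elim: i => // i IH; exact: leq_ltn_trans IH (kappaS i).
pose expand (y : nat -> nat -> bool) k :=
  if [pick i : 'I_k.+1 | kappa i == k] is Some i then y i else fun=> false.
have expandE y i : expand y (kappa i) = y i.
  rewrite /expand; case: pickP => [j /eqP /(incn_inj kappa_mono) -> //|/(_ (inord i))].
  by rewrite inordK ?eqxx // ltnS.
have [//|||P [Preal PA]] := adversary (H := H) (b := fun i => (kappa i).+1) _ (erefl 1) t_le t_cvg sing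
   (node := fun y i => x (vcl_prefix (expand y) (kappa i))) _ _ A n.
- move=> y y' k yy'; congr (x _); apply/eq_in_map => j; rewrite mem_iota => /andP[_ jk].
  congr (mkseq _ _); rewrite /expand; case: pickP => // i /eqP ij.
  by rewrite yy' // -(leqW_mono kappa_mono) ij.
- move=> y m; have [h Hh hy] := xH (expand y) (kappa m); exists h => // k i km ik.
  by rewrite hy ?expandE // kappa_mono.
(* The level has mass at least [3 / 4] of [t N]; two factors 1/2, for missing an atom and for
   mislabelling it, leave more than [t N / 8]. *)
exists P; split => //; exists 8^-1, 1; split=> // N; exists (n N).
split; first exact: ltnW.
split; first exact: leq_ltn_trans (n_gt N).
apply: le_trans (PA N); rewrite rate_at1 lee_fin.
have RtN : Rt (n N) <= t N by have [_ /(_ (t_gt0 N))] := fP (t N, N).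
set w := weight _ _ N; have w0 : 0 <= w by exact: weight_ge0.
have wn : w * (n N)%:R <= t N / 4.
  rewrite /w /weight mulrAC ler_pdivrMr // mulrAC ler_pdivlMr //.
  have kN : (4 * (n N)%:R : R) <= (kappa N).+1%:R.
    by rewrite -natrM ler_nat leqW // /kappa big_ord_recr /= leq_addl.
  have := ltW (t_gt0 N); have := ltW (t_gt0 N.+1); have := n_ge1 N.
  move: (n N)%:R ((kappa N).+1%:R) kN => m K; move: (t N) (t N.+1) => a c mK m1 c0 a0.
  have : c * m >= 0 by rewrite mulr_ge0 //; lra.
  have : a * (K - 4 * m) >= 0 by rewrite mulr_ge0 // subr_ge0.
  nra.
have tN1 : t N <= 1 by elim: N {RtN w w0 wn} => // N; apply: le_trans.
have t' := t4 N; have tN0 := t_gt0 N; have tS0 := t_gt0 N.+1.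
have w4 : w <= t N / 4.
  by apply: le_trans wn; rewrite ler_peMr.
rewrite -addrA -opprD.
have : 2^-1 <= (1 - (t N.+1 + w)) ^+ (n N).
  apply: bernoulli_half; first by lra.
  by rewrite mulrC mulrDl tn; lra.
set e := (_ ^+ n N); nra.
Qed.

Lemma separating_pair : at_least_three H -> exists h1 h2 x x',
  [/\ H h1, H h2, h1 x = h2 x & h1 x' != h2 x'].
Proof.
have neq (f g : X -> bool) : f <> g -> exists x, f x != g x.
  move=> fg; apply/not_existsP => /= fgE; apply: fg; apply/funext => x.
  by apply/eqP; have /negP := fgE x; rewrite negbK.
move=> [f1 [f2 [f3 [[H1 H2 H3] [/neq[x x12] n13 n23]]]]].
wlog x13 : f1 f2 H1 H2 x12 n13 n23 / f3 x = f1 x.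
  move=> wl; have [e|ne] := eqVneq (f3 x) (f1 x); first exact: (wl f1 f2).
  apply: (wl f2 f1) => //; first by rewrite eq_sym.
  by move: ne x12; case: (f1 x) (f2 x) (f3 x) => [] [] [].
have [x' x'13] := neq _ _ n13.
have [e|ne] := eqVneq (f1 x') (f2 x'); first by exists f1, f2, x', x.
exists f2, f3, x', x; split => //; last by rewrite x13 eq_sym.
by move: ne x'13; case: (f1 x') (f2 x') (f3 x') => [] [] [].
Qed.

(* The two distributions put mass 1/2 on a common labelled point [x] and 1/2 on [x'], whose label is
   not determined by a sample consisting of copies of [x] only. *)
Lemma three_not_faster : at_least_three H -> not_faster H (fun n => expR (- (n%:R : R))).
Proof.
move=> /separating_pair[h1 [h2 [x [x' [H1 H2 xE x'N]]]]] A _.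
pose t k : R := if k is 0%N then 1 else if k is 1%N then 2^-1 else 0.
have t_le k : t k.+1 <= t k by case: k => [|[|k]] /=; lra.
have t_cvg : t @ \oo --> (0 : R).
  by apply/cvgrPdist_lt => e e0; exists 2%N => // -[|[|n]] //= _; rewrite subr0 normr0.
pose node (y : nat -> nat -> bool) (k i : nat) := if k is 0%N then x else x'.
pose labels (h : X -> bool) k i := h (node (fun _ _ => false) k i).
pose P h := tree_law (b := fun=> 1%N) (fun=> isT) (erefl 1) t_le t_cvg node (labels h).
have Preal h : H h -> realizable H (P h) by move=> Hh; apply: tree_law_realizable => // n; exists h.
(* On copies of [x] alone the prediction at [x'] is the same under both laws. Either it is wrong for
   [h1] infinitely often, or from some point on it equals [h1 x'] and is wrong for [h2]. *)
pose guess n := A n (totup n (nseq n ((x, h1 x) : ZT X))) x'.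
have err h n : h x = h1 x -> guess n != h x' -> ((2^-1 * expR (- n%:R) : R)%:E <= exp_err (P h) A n)%E.
  move=> hx gn; have d1 := upper_atoms_dominated (b := fun=> 1%N) (fun=> isT) (erefl 1) t_le t_cvg sing node (labels h) 1.
  have d2 := upper_atoms_dominated (b := fun=> 1%N) (fun=> isT) (erefl 1) t_le t_cvg sing node (labels h) 2.
  apply: le_trans (exp_err_ge _ _ d1 (dominated_cat2 d2)); rewrite lee_fin /=.
  rewrite /level_atoms /= /labels /node hx /weight !divr1 /t.
  have lsum1E (a : R * ZT X) m f : lsum [:: a] m f = a.1 ^+ m * f (nseq m a.2).
    elim: m f => [|m IH] f /=; first by rewrite mul1r.
    by rewrite big_seq1 IH exprS mulrA.
  rewrite lsum1E big_seq1 /= -/(guess n) gn mulr1 subr0 mulrC.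
  rewrite ler_wpM2r ?invr_ge0 // -mulN1r mulrC expRM_natl.
  have e2 : expR (-1) <= 2^-1 :> R.
    by rewrite expRN lef_pV2 ?posrE ?expR_gt0 //; have := expR_ge1Dx (1 : R); lra.
  by rewrite lerXn2r ?nnegrE ?expR_ge0 //; lra.
have [inf|] := pselect (forall N, exists n, [/\ (N <= n)%N, (0 < n)%N & guess n != h1 x']).
  exists (P h1); split; first exact: Preal.
  exists 2^-1, 1; split=> // N; have [n [Nn n0 gn]] := inf N.
  by exists n; split=> //; split=> //; rewrite rate_at1; exact: err.
move=> /existsNP[M noM]; exists (P h2); split; first exact: Preal.
exists 2^-1, 1; split=> // N; exists (maxn N M).+1; split; first by rewrite leqW ?leq_maxl.
split=> //; rewrite rate_at1; apply: err => //.
suff -> : guess (maxn N M).+1 = h1 x' by [].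
apply/eqP/negPn/negP => gn; apply: noM; exists (maxn N M).+1; split=> //.
by rewrite leqW ?leq_maxr.
Qed.

End LowerBounds.

(** * Rates *)

Lemma geometric_rate (R : realType) (r : R) L : 0 <= r < 1 -> (0 < L)%N ->
  exists C c : R, [/\ 0 < C, 0 < c & forall n,
    r ^+ (n./2 %/ L) <= C * rate_at (fun n => expR (- n%:R)) c n].
Proof.
(* The maximum with 1/2 keeps the logarithm meaningful when [r = 0]. *)
move=> /andP[r0 r1] L0; pose rho := Num.max r 2^-1.
have rho0 : 0 < rho by rewrite lt_max invr_gt0 ltr0n orbT.
have rho1 : rho < 1 by rewrite gt_max r1 /=; lra.
pose l := - ln rho; have l0 : 0 < l by rewrite oppr_gt0 ln_lt0 ?rho0.
have L0' : 0 < (L%:R : R) by rewrite ltr0n.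
(* The bound [n <= 2 * L * (m + 2)] absorbs both integer divisions and costs [2 * l] in the
   exponent; the ceiling in [rate_at] costs 1. *)
exists (expR (2 * l + 1)), (l / (2 * L%:R)).
have c0 : 0 < l / (2 * L%:R) by rewrite divr_gt0 // mulr_gt0.
split=> // [|n]; first exact: expR_gt0.
set c := l / _; set m := (n./2 %/ L)%N.
apply: (@le_trans _ _ (rho ^+ m)); first by rewrite lerXn2r ?nnegrE ?(ltW rho0) // le_max lexx.
rewrite -[rho]lnK ?posrE // -expRM_natl /rate_at -expRD ler_expR.
have cn0 : 0 <= c * n%:R by rewrite mulr_ge0 // ltW.
have ceil0 : 0 <= Num.ceil (c * n%:R) by rewrite ceil_ge0; lra.
have -> : (`|Num.ceil (c * n%:R)|%N%:R : R) = (Num.ceil (c * n%:R))%:~R.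
  by rewrite -[LHS]/((`|Num.ceil (c * n%:R)|%N : int)%:~R) gez0_abs.
have := ceilB1_lt (c * n%:R); rewrite intrD; set z := (_%:~R) => zn.
have nm : n%:R <= 2 * L%:R * (m%:R + 2) :> R.
  rewrite -natrD -!natrM ler_nat; have := divn_eq n./2 L; have := ltn_pmod n./2 L0.
  by rewrite -/m; have := odd_double_half n; lia.
have cl : c * (2 * L%:R) = l by rewrite /c mulfVK // gt_eqF // mulr_gt0.
have : c * n%:R <= l * (m%:R + 2) by rewrite -cl -mulrA ler_pM2l.
rewrite -[ln rho]opprK -/l mulrN mulrDr -(mulrC l); lra.
Qed.

Lemma linear_rate (R : realType) (r : R) L B : 0 <= r < 1 -> (0 < L)%N ->
  exists C : R, 0 < C /\ forall n, (0 < n)%N ->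
    r ^+ (n./2 %/ L) + (2 * B)%:R / (n - n./2).+1%:R <= C * n%:R^-1.
Proof.
move=> r01 L0; have [C [c [C0 c0 rC]]] := geometric_rate r01 L0.
(* [C / c] comes from bounding [expR (- x)] by [1 / x], and [4 * B] from [n - n./2 + 1 >= n / 2]. *)
exists (C / c + (4 * B)%:R); split; first by rewrite ltr_wpDr // divr_gt0.
move=> n n0; have n0' : 0 < (n%:R : R) by rewrite ltr0n.
rewrite mulrDl lerD //.
  apply: le_trans (rC n) _; rewrite -mulrA ler_pM2l // -invfM /rate_at expRN.
  have cn0 : 0 < c * n%:R by rewrite mulr_gt0.
  rewrite lef_pV2 ?posrE ?expR_gt0 //.
  apply: le_trans (expR_ge1Dx _); have := ceil_ge (c * n%:R).
  have ceil0 : 0 <= Num.ceil (c * n%:R) by rewrite ceil_ge0; lra.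
  have -> : (`|Num.ceil (c * n%:R)|%N%:R : R) = (Num.ceil (c * n%:R))%:~R.
    by rewrite -[LHS]/((`|Num.ceil (c * n%:R)|%N : int)%:~R) gez0_abs.
  by lra.
rewrite ler_pdivrMr // mulrAC ler_pdivlMr // -!natrM ler_nat.
by have := odd_double_half n; nia.
Qed.

Lemma borel_section_measurable (X : ptopologicalType) (Theta : topologicalType) (th : Theta)
  (A : set (Theta * X)) : borel_set (T := (Theta * X)%type) A ->
  measurable ([set x | A (th, x)] : set (BorelT X)).
Proof.
move=> bA; apply: (bA [set B | measurable ([set x | B (th, x)] : set (BorelT X))]); split.
  split=> [|B mB|F mF]; first exact: measurable0.
    by rewrite setTD; exact: measurableC.
  exact: (@bigcup_measurable _ (BorelT X) (fun k => [set x | F k (th, x)]) setT (fun k _ => mF k)).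
move=> B oB; apply: sub_sigma_algebra; rewrite -[X in open X]/((fun x => (th, x)) @^-1` B).
apply: open_comp => // x _; apply: cvg_pair => //=; exact: cvg_cst.
Qed.

Section Learnability.
Variables (R : realType) (X : ptopologicalType) (H : set (X -> bool)).
Hypotheses (polX : polish R X) (measH : measurable_class R H) (H_neq0 : H !=set0).

(* Both learning rates come from one statement: a block size [b k] of [1] at every level gives
   Littlestone trees, the block sizes [k.+1] give VCL trees. *)
Lemma learner_exists b : (forall k, (0 < b k)%N) ->
  (forall x : seq (seq bool) -> nat -> X, exists (y : nat -> seq bool) n, forall h, H h ->
     exists k i, [/\ (k <= n)%N, (i < b k)%N & h (x (mkseq y k) i) <> nth false (y k) i]) ->
  exists A : algorithm X, univ_meas_algorithm R A /\
    forall P : probability (ZT X) R, realizable H P -> exists k (r : R) L,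
      [/\ 0 <= r < 1, (0 < L)%N & forall n, (exp_err P A n <=
        (r ^+ (n./2 %/ L) + (2 * (b k).-1)%:R / (n - n./2).+1%:R)%:E)%E].
Proof.
move=> b_gt0 noH; case: measH => Theta [h [polT h_borel HE]].
have [th0 _] : exists th : Theta, True.
  by have [f] := H_neq0; rewrite HE => -[th]; exists th.
have [phiT [phiT_surj phiT_cont]] := polish_code polT (inhabits th0).
have [phiX [phiX_surj phiX_cont]] := polish_code polX (inhabits point).
have no_tree : ~ has_tree h b.
  case=> x xP; have [y [n yn]] := noH x; have [th thP] := xP y n.
  have /yn[k [i [kn ib]]] : H (h th) by rewrite HE; exists th.
  by apply; exact: thP.
have [prec [alive [wf root alive_ana compare steps]]] :=
  rank_system phiT_surj phiT_cont phiX_surj phiX_cont h_borel no_tree.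
have best_exists k v xs : exists c, optimal_labels b alive k v xs c by have [] := steps k v xs.
have alive_um k w : univ_meas_set R [set t : (hsize b k).-tuple (ZT X) | alive k w t].
  exact: ana_um (alive_ana k w).
have descends k v xs c w : consistent h v -> ~ alive k w v -> optimal_labels b alive k v xs c ->
    exists2 w', prec w' w & ~ alive k.+1 w' (v ++ block b k xs c).
  by have [_] := steps k v xs; apply.
exists (fun n s x => learner best_exists n s x); split.
  by move=> n; exact: (um_learner alive_um best_exists).
move=> P; rewrite HE => realP.
apply: (exp_err_learner b_gt0 alive_um best_exists _ _ wf root compare descends realP).
  by move=> n; apply: ana_um; exact: consistent_ana phiT_surj phiT_cont h_borel n.
by move=> th; exact: borel_section_measurable (h_borel true).
Qed.

Lemma littlestone_learnable : ~ has_inf_littlestone H ->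
  learnable_at H (fun n => expR (- (n%:R : R))).
Proof.
move=> noL; have [//|x|A [A_um AP]] := @learner_exists (fun=> 1%N).
  apply: contrapT => no; apply: noL.
  (* With blocks of one point a label is a one-letter word, so bit strings are translated letter by
     letter. *)
  exists (fun u => x (map (fun c => [:: c]) u) 0%N) => y n.
  apply: contrapT => noh; apply: no; exists (fun k => [:: y k]), n => h Hh.
  apply: contrapT => nok; apply: noh; exists h => // k kn.
  apply: contrapT => hk; apply: nok; exists k, 0%N; split=> //=.
  by rewrite /Defs.prefix -map_comp in hk.
exists A; split=> // P /AP[k [r [L [r01 L0 err]]]].
have [C [c [C0 c0 rC]]] := geometric_rate r01 L0; exists C, c; split=> // n _.
apply: (le_trans (err n)); rewrite lee_fin /= muln0 mul0r addr0; exact: rC.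
Qed.

Lemma vcl_learnable : ~ has_inf_VCL H -> learnable_at H (fun n => (n%:R : R)^-1).
Proof.
move=> noV; have [//|x|A [A_um AP]] := @learner_exists S.
  apply: contrapT => no; apply: noV; exists x => y n.
  apply: contrapT => noh; apply: no; exists (fun k => mkseq (y k) k.+1), n => h Hh.
  apply: contrapT => nok; apply: noh; exists h => // k i kn ik.
  apply: contrapT => hk; apply: nok; exists k, i; split=> //.
  by rewrite nth_mkseq.
exists A; split=> // P /AP[k [r [L [r01 L0 err]]]].
have [C [C0 rC]] := linear_rate k r01 L0; exists C, 1; split=> // n n0.
by apply: (le_trans (err n)); rewrite lee_fin rate_at1; exact: rC.
Qed.

End Learnability.

Theorem mainTheorem2 (R : realType) (X : ptopologicalType) (H : set (X -> bool)) :
  polish R X -> measurable_class R H -> at_least_three H ->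
  [/\ (~ has_inf_littlestone H ->
         optimal_rate H (fun n : nat => expR (- (n%:R : R)))),
      (has_inf_littlestone H -> ~ has_inf_VCL H ->
         optimal_rate H (fun n : nat => (n%:R : R)^-1)) &
      (has_inf_VCL H -> requires_arbitrarily_slow R H)].
Proof.
move=> polX measH H3.
have H0 : H !=set0 by have [h [_ [_ [[Hh _ _] _]]]] := H3; exists h.
split=> [noL|hasL noV|hasV].
- by split; [exact: littlestone_learnable|exact: three_not_faster].
- by split; [exact: vcl_learnable|exact: littlestone_not_faster].
- exact: vcl_arbitrarily_slow.
Qed.
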